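(* Let $m>1$, $\Psi=\Psi_m$, $k\in\mathbb{N}$, $\sigma>0$, and consider the geometry $F=F_{k,\sigma}$, $F_{k,\sigma}(r)=\left(\ln\frac1r\right)\left(\ln^{(k)}\frac1r\right)^\sigma$. The strong $(\Psi,\varphi)$-Sobolev inequality $$\Psi^{(-1)}\left(\int_{B(0,r_0)}\Psi\left(T_{B(0,r_0)}g\right)d\mu_{r_0}\right)\le C\varphi(r_0)\,\|g\|_{L^1(\mu_{r_0})}$$ holds if (either) $k\ge2$ and $\sigma>0$ and $$\varphi(r_0)=r_0^{\,1-C_m\frac{\left(\ln^{(k)}\frac1{r_0}\right)^{\sigma(m-1)}}{\ln\frac1{r_0}}}\qquad\text{for }0<r_0\le\beta_{m,\sigma},$$ for positive constants $C_m$ and $\beta_{m,\sigma}$ depending only on $m$ and $\sigma$; (or) $k=1$ and $\sigma<\frac1{m-1}$ and $$\varphi(r_0)=r_0^{\,1-C_m\frac{1}{\left(\ln\frac1{r_0}\right)^{1-\sigma(m-1)}}}\qquad\text{for }0<r_0\le\beta_{m,\sigma},$$ for positive constants $C_m$ and $\beta_{m,\sigma}$ depending only on $m$ and $\sigma$.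
   Context: $\ln^{(k)}$ is the $k$-fold iterated logarithm; $f(x)=e^{-F(|x|)}$ for small $|x|>0$, $f(0)=0$. $d$ is the control metric of $dt^2=dx^2+\frac1{f(x)^2}dy^2$ in the plane, $B(x,r)$ its balls, $|\cdot|$ Lebesgue measure, $d\mu_{r_0}=\frac{dx}{|B(0,r_0)|}$ on $B(0,r_0)$. With $M$ a fixed sufficiently large constant (depending on $m$) and $A_m=e^{\left((\ln M)^{1/m}+1\right)^m-\ln M}>1$: $\Psi_m(t)=A_me^{-\left((\ln\frac1t)^{1/m}+1\right)^m}$ for $0<t<\frac1M$, $\Psi_m(0)=0$, and $\Psi_m$ is extended to be affine on $[\frac1M,\infty)$, continuously and with slope $\Psi_m'(\frac1M)$; $\Psi^{(-1)}$ is the inverse function. In the inequality, $g$ ranges over nonnegative functions in $L^1(\mu_{r_0})$ and $C$ is independent of $r_0$ and $g$. Operator. For $x_1,t>0$ let $h^*(x_1,t)=\int_{x_1}^{x_1+t}\frac{f(u)^2}{\sqrt{f(x_1+t)^2-f(u)^2}}du$; let $r^*(x_1,r)\in(0,r)$ be determined by $r=\int_{x_1}^{x_1+r^*}\frac{f(x_1+r^* )}{\sqrt{f(x_1+r^* )^2-f(u)^2}}du$. For $x=(x_1,x_2)$, $x_1>0$, and $r>0$ put $\rho_0=r$ and $\rho_{k+1}=r^*(x_1,\rho_k)$ if $\rho_k\ge\frac1{|F'(x_1)|}$, $\rho_{k+1}=\frac12\rho_k$ otherwise; let $E(x,\rho_k)$ be the set of $y$ with $x_1+\rho_{k+1}\le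 y_1<x_1+\rho_k$ and $|y_2-x_2|<h^*(x_1,y_1-x_1)$ (if $\rho_k\ge\frac1{|F'(x_1)|}$), respectively $|y_2-x_2|<h^*(x_1,r^*(x_1,\rho_k))$ (if $\rho_k<\frac1{|F'(x_1)|}$); and $\Gamma(x,r)=\bigcup_{k\ge1}E(x,\rho_k)$ (for $x_1<0$ everything is defined by reflection in the vertical axis). With $\widehat d(x,y)=\min\left\{d(x,y),\frac{1}{|F'(x_1+d(x,y))|}\right\}$, set $$K_{B(0,r)}(x,y)=\frac{\widehat d(x,y)}{|B(x,d(x,y))|}\mathbf 1_{\Gamma(x,r)}(y),\qquad T_{B(0,r)}g(x)=\int_{B(0,r)}K_{B(0,r)}(x,y)g(y)\,dy .$$
   Formalization: The constant β may also depend on k and on the interval where f is given by e^{-F}, not only on m and σ: for a fixed β the iterated logarithm ln^{(k)}(1/r_0), hence F and φ, is undefined for large k. *)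

(* Defs.v *)
From HB Require Import structures.
From mathcomp Require Import all_boot all_order all_algebra.
From mathcomp Require Import all_classical all_reals all_analysis.

Set Implicit Arguments.
Unset Strict Implicit.
Unset Printing Implicit Defensive.

Import Order.TTheory GRing.Theory Num.Theory.
Import numFieldNormedType.Exports.

Local Open Scope classical_set_scope.
Local Open Scope ring_scope.

Section Defs.
Context {R : realType}.
Implicit Types (f F phi g : R -> R) (m M sigma r t : R) (k : nat).

(* Borel sigma-algebra on the plane; every L^1 class has a Borel
   representative. *)
Definition plane := (measurableTypeR R * measurableTypeR R)%type.

Definition leb2 : {measure set plane -> \bar R} :=
  (@lebesgue_measure R \x @lebesgue_measure R)%E.

Definition Psi_const M m : R := expR ((ln M `^ m^-1 + 1) `^ m - ln M).

Definition Psi_core M m t : R :=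
  Psi_const M m * expR (- ((ln t^-1 `^ m^-1 + 1) `^ m)).

Definition Psi M m t : R :=
  if t <= 0 then 0
  else if t < M^-1 then Psi_core M m t
  else Psi_core M m M^-1 + derive1 (Psi_core M m) M^-1 * (t - M^-1).

(* The inverse of Psi : [0, +oo[ -> [0, +oo[. *)
Definition Psi_inv M m : R -> R := 'pinv_(fun=> 0) `[0, +oo[ (Psi M m).

Definition F_geom k sigma r : R := ln r^-1 * (iter k (@ln R) r^-1) `^ sigma.

(* f is unconstrained outside ]-r1, r1[. *)
Definition is_profile F r1 f : Prop :=
  f 0 = 0 /\ forall x, 0 < `|x| < r1 -> f x = expR (- F `|x|).

(* The constraint says dx^2 + dy^2 / f^2 <= dt^2 along the curve; the witness v
   is the quotient y' / f, so that y' = 0 is forced wherever f vanishes. *)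
Definition subunit f r (gx gy : R -> R) : Prop :=
  [/\ [lipschitz gx t | t in `[0, r]%classic],
      [lipschitz gy t | t in `[0, r]%classic] &
      {ae @lebesgue_measure R, forall t, 0 < t < r ->
        [/\ derivable gx t 1, derivable gy t 1 &
            exists2 v : R, derive1 gy t = f (gx t) * v &
              derive1 gx t ^+ 2 + v ^+ 2 <= 1]}].

(* Value +oo when no curve joins p and q. *)
Definition cdist f (p q : plane) : \bar R :=
  ereal_inf [set r%:E | r in [set r : R | 0 <= r /\
    exists gx gy, [/\ subunit f r gx gy,
      (gx 0, gy 0) = p & (gx r, gy r) = q]]].

Definition cball f (p : plane) r : set plane :=
  [set q | (cdist f p q < r%:E)%E].

Definition origin : plane := (0, 0).

Definition reflect_pt (p : plane) : plane := (- p.1, p.2).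

Lemma inv_area_ge0 (B : set plane) : 0 <= (fine (leb2 B))^-1.
Proof. by rewrite invr_ge0 fine_ge0. Qed.

(* Always used with B(0, r) as domain of integration. *)
Definition mu_ball f r : {measure set plane -> \bar R} :=
  mscale (NngNum (inv_area_ge0 (cball f origin r))) leb2.

Definition hstar f (x1 t : R) : R :=
  \int[@lebesgue_measure R]_(u in `[x1, x1 + t])
    (f u ^+ 2 / Num.sqrt (f (x1 + t) ^+ 2 - f u ^+ 2)).

Definition rstar f (x1 r : R) : R :=
  xget 0 [set s : R | 0 < s < r /\
    r = \int[@lebesgue_measure R]_(u in `[x1, x1 + s])
          (f (x1 + s) / Num.sqrt (f (x1 + s) ^+ 2 - f u ^+ 2))].

Fixpoint rho f F (x1 r : R) k : R :=
  if k is k'.+1 then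
    let s := rho f F x1 r k' in
    if `|derive1 F x1|^-1 <= s then rstar f x1 s else s / 2
  else r.

Definition Eset f F (x : plane) r k : set plane :=
  let s := rho f F x.1 r k in
  [set y | x.1 + rho f F x.1 r k.+1 <= y.1 < x.1 + s /\
    `|y.2 - x.2| < if `|derive1 F x.1|^-1 <= s then hstar f x.1 (y.1 - x.1)
                   else hstar f x.1 (rstar f x.1 s)].

Definition Gamma f F (x : plane) r : set plane :=
  \bigcup_(k in [set k | (1 <= k)%N]) Eset f F x r k.

Definition dhat f F (x y : plane) : R :=
  let d := fine (cdist f x y) in Num.min d `|derive1 F (x.1 + d)|^-1.

Definition kernel_right f F r (x y : plane) : R :=
  dhat f F x y / fine (leb2 (cball f x (fine (cdist f x y))))
  * \1_(Gamma f F x r) y.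

(* The vertical axis x.1 = 0 is a null set of points x; the kernel is set to 0
   there. *)
Definition kernelK f F r (x y : plane) : R :=
  if 0 < x.1 then kernel_right f F r x y
  else if x.1 < 0 then kernel_right f F r (reflect_pt x) (reflect_pt y)
  else 0.

Definition opT f F r (g : plane -> R) (x : plane) : \bar R :=
  (\int[leb2]_(y in cball f origin r) (kernelK f F r x y * g y)%:E)%E.

(* Psi and its inverse are extended to [0, +oo] by +oo |-> +oo. *)
Definition strong_sobolev f F M m phi (beta : R) : Prop :=
  exists2 C : R, 0 < C & forall r0, 0 < r0 <= beta ->
    forall g : plane -> R, (forall y, 0 <= g y) ->
    (mu_ball f r0).-integrable (cball f origin r0) (EFin \o g) ->
    (er_map (Psi_inv M m)
       (\int[mu_ball f r0]_(x in cball f origin r0)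
          er_map (Psi M m) (opT f F r0 g x))
     <= (C * phi r0)%:E *
        \int[mu_ball f r0]_(x in cball f origin r0) `|(g x)%:E|)%E.

Definition phi_ge2 k m sigma (Cm r : R) : R :=
  r `^ (1 - Cm * ((iter k (@ln R) r^-1) `^ (sigma * (m - 1)) / ln r^-1)).

Definition phi_1 m sigma (Cm r : R) : R :=
  r `^ (1 - Cm * (1 / ln r^-1 `^ (1 - sigma * (m - 1)))).

End Defs.

(* Main.v *)
(** Write Psi t = t * Xi t. The ratio Xi is nondecreasing, and Bernoulli's
    inequality applied to ((ln (1/t))^(1/m) + 1)^m gives
      Xi (q t) <= b q^(1/lam) exp (c lam^(m-1)) Xi t    for q, lam >= 1.
    The kernel is at most a majorant K(x, y) of order 1 / (|y1| - |x1|), supported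
    on |x1| < |y1|, |y2 - x2| < c f(y1) ((|y1| - |x1|) |y1|)^(1/2). With lam
    proportional to (ln^(k) (1/|y1|))^sigma, the bound on Xi turns into
      K G Xi(w) <= (w/2) Xi(w) + Z Psi(beta)/2    for all w > 0,
    where G = ||g||_1, beta = C phi(r) G / |B(0,r)|, and Z is a weight on the same
    support with an integrable singularity. Integrating in y against g/G at w = T g(x)
    gives Psi(T g(x)) <= Psi(beta) int Z(x,y) g(y)/G dy, and by Tonelli the inequality
    reduces to int Z(x,y) dx <= |B(0,r)|. There the factor exp (c lam^(m-1)) is
    absorbed by phi(r)/r = exp (C_m (ln^(k) (1/r))^(sigma(m-1))).
    No measurability of the kernel or of T g is needed: integrals of nonnegative
    functions are lower integrals, hence monotone. *)

From HB Require Import structures.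
Require Import Defs.
From mathcomp Require Import all_boot all_order all_algebra.
From mathcomp Require Import all_classical all_reals all_analysis.
From mathcomp Require Import unstable measurable_realfun.
From mathcomp Require Import ring lra.
Import Order.TTheory GRing.Theory Num.Theory.
Import numFieldNormedType.Exports.
Local Open Scope ring_scope.

Set Implicit Arguments.
Unset Strict Implicit.
Unset Printing Implicit Defensive.

(** Near the axis the quotient 2 K G / beta has the size of exp (F(|y1|) - F(r)), and for a fixed
    lam its power 1/lam outgrows every power of 1/|y1|. Put a(u) = (ln^(k) (1/u))^sigma. Since F(u)
    - F(w) <= (1 + sigma) a(u) ln (w/u) for u <= w, a lam proportional to a(|y1|) brings that power
    down to a multiple of (r/|y1|)^(1/2). The price exp (c lam^(m-1)) is the source of the exponent
    sigma(m-1) in phi. For |y1| much smaller than r, a factor (|y1|/r)^(1/2) is left to pay it; this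
    is enough once every multiple of (ln^(k) (1/t))^(sigma(m-1)) is at most ln (1/t) / 4 plus a
    constant, which is where k >= 2 or sigma(m-1) < 1 enters. Losses polynomial in a, such as a^2 in
    the area of a ball, go into the same exponential. The singularity of Z is gap^(-5/4), with gap =
    |y1| - |x1|: gap^(-1) from the kernel and gap^(-1/4) from the root, as lam >= 4. The slice
    height gap^(1/2) leaves the integrable gap^(-3/4). *)

Lemma bernoulli_powR (R : realType) (a x : R) : 1 <= a -> 0 <= x ->
  1 + a * (x - 1) <= x `^ a.
Proof.
move=> a1 x0; have a0 : 0 < a by exact: lt_le_trans a1.
have [y0|y0] := leP (1 + a * (x - 1)) 0; first exact: le_trans (powR_ge0 _ _).
have xp : 0 < x.
  rewrite lt_neqAle x0 andbT; apply/eqP => x00; move: y0; rewrite -x00; lra.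
have ia : 0 <= a^-1 <= 1 by rewrite invr_ge0 ltW//= invf_le1.
(* With weight [a^-1], the point [x] is a convex combination of [1 + a * (x - 1)] and 1. *)
have := @concave_ln _ (Itv01 (proj1 (andP ia)) (proj2 (andP ia))) _ 1 y0 ltr01.
rewrite !convRE/= ln1 mulr0 addr0 => h.
rewrite -ler_ln ?posrE ?powR_gt0// ln_powR.
have E : a^-1 * (1 + a * (x - 1)) + onem (a^-1) * 1 = x.
  by rewrite /onem; field; rewrite gt_eqF.
by move: h; rewrite E [X in X <= _]mulrC ler_pdivrMr// [a * ln x]mulrC.
Qed.

(** * Growth of the function Psi *)

Section Theta.
Context {R : realType} (m : R).
Hypothesis m1 : 1 < m.

Definition psi_exponent (v : R) := (v `^ m^-1 + 1) `^ m.
(** [Psi_core M m t] is [t] times the exponential of psi_defect (ln M) - psi_defect (ln (1/t)), so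
    this function carries all the deviation of Psi from linearity. *)
Definition psi_defect (v : R) := psi_exponent v - v.

Let m0 : 0 < m. Proof. exact: lt_trans m1. Qed.

Lemma powR_rootK (v : R) : 0 <= v -> (v `^ m^-1) `^ m = v.
Proof. by move=> v0; rewrite -powRrM mulVf ?gt_eqF// powRr1. Qed.

(** Convexity: [z] and [w + 1] are points of [w, z + 1] with mirrored weights 1/d and 1 - 1/d, d = z
    - w + 1. Adding the two chord inequalities gives the claim. *)
Lemma powR_succ_sub_ndecr (w z : R) : 0 <= w -> w <= z ->
  (w + 1) `^ m - w `^ m <= (z + 1) `^ m - z `^ m.
Proof.
move=> w0 wz; have z0 : 0 <= z by exact: le_trans wz.
pose d := z - w + 1.
have d0 : 0 < d by rewrite /d; lra.
have t01 : 0 <= d^-1 <= 1 by rewrite invr_ge0 ltW//= invf_le1// /d; lra.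
have s01 : 0 <= (z - w) / d <= 1.
  rewrite divr_ge0 ?(ltW d0) ?subr_ge0//= ler_pdivrMr// mul1r /d; lra.
have cvx := @convex_powR R m (ltW m1).
have inI (x : R) : 0 <= x -> x \in (`[0, +oo[%classic : set R).
  by move=> x0; rewrite inE/= in_itv/= andbT.
have z10 : 0 <= z + 1 by lra.
have A : (d^-1 * w + (1 - d^-1) * (z + 1)) `^ m
    <= d^-1 * w `^ m + (1 - d^-1) * (z + 1) `^ m.
  exact: (cvx (Itv01 (proj1 (andP t01)) (proj2 (andP t01))) _ _ (inI _ w0) (inI _ z10)).
have B : ((z - w) / d * w + (1 - (z - w) / d) * (z + 1)) `^ m
    <= (z - w) / d * w `^ m + (1 - (z - w) / d) * (z + 1) `^ m.
  exact: (cvx (Itv01 (proj1 (andP s01)) (proj2 (andP s01))) _ _ (inI _ w0) (inI _ z10)).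
move: A B.
have -> : d^-1 * w + (1 - d^-1) * (z + 1) = z.
  by rewrite /d; field; rewrite /d gt_eqF.
have -> : (z - w) / d * w + (1 - (z - w) / d) * (z + 1) = w + 1.
  by rewrite /d; field; rewrite gt_eqF.
have -> : (z - w) / d = 1 - d^-1.
  by rewrite /d; field; rewrite gt_eqF.
move=> A B; lra.
Qed.

Lemma psi_defect_ndecr (u v : R) : 0 <= u -> u <= v -> psi_defect u <= psi_defect v.
Proof.
move=> u0 uv; have v0 : 0 <= v by exact: le_trans uv.
rewrite /psi_defect /psi_exponent -{2}(powR_rootK u0) -{2}(powR_rootK v0).
apply: powR_succ_sub_ndecr; rewrite ?powR_ge0//.
by rewrite ge0_ler_powR ?nnegrE// invr_ge0 ltW.
Qed.

Lemma psi_defect_ge0 (u : R) : 0 <= u -> 0 <= psi_defect u.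
Proof.
move=> u0; rewrite /psi_defect subr_ge0 -{1}(powR_rootK u0) /psi_exponent.
by rewrite ge0_ler_powR ?nnegrE ?powR_ge0 ?addr_ge0 ?powR_ge0 ?ltW// ltrDl.
Qed.

(** The quotient psi_exponent v / v = (1 + v^(-1/m))^m decreases in v (claim [H]), so [psi_exponent]
    is subadditive, and subtracting the identity preserves this. *)
Lemma psi_defectD (u v : R) : 0 <= u -> 0 <= v ->
  psi_defect (u + v) <= psi_defect u + psi_defect v.
Proof.
move=> u0 v0.
suff H (a c : R) : 0 <= a -> a <= c -> a / c * psi_exponent c <= psi_exponent a.
  have [uv0|uv0] := eqVneq (u + v) 0.
    have -> : u = 0 by lra.
    have -> : v = 0 by lra.
    by rewrite addr0 lerDl psi_defect_ge0.
  have := H u (u + v) u0; have := H v (u + v) v0; rewrite !lerDl !lerDr.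
  move=> /(_ u0) Hv /(_ v0) Hu; have := lerD Hu Hv.
  have -> : u / (u + v) * psi_exponent (u + v) + v / (u + v) * psi_exponent (u + v)
    = psi_exponent (u + v) by field.
  rewrite /psi_defect; move: (psi_exponent _) (psi_exponent u) (psi_exponent v).
  by clear Hu Hv H => a b c; lra.
move=> a0 ac; have c0 : 0 <= c by exact: le_trans ac.
have [->|cn] := eqVneq c 0; first by rewrite invr0 mulr0 mul0r powR_ge0.
have cp : 0 < c by rewrite lt_neqAle eq_sym cn.
have ac0 : 0 <= a / c by rewrite divr_ge0.
rewrite /psi_exponent -{1}(powR_rootK ac0) -powRM ?powR_ge0 ?addr_ge0 ?powR_ge0//.
rewrite ge0_ler_powR ?nnegrE ?mulr_ge0 ?powR_ge0 ?addr_ge0 ?powR_ge0 ?(ltW m0)//.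
rewrite mulrDr -powRM// divfK// mulr1 lerD2l.
have -> : (1 : R) = 1 `^ m^-1 by rewrite powR1.
by rewrite ge0_ler_powR ?nnegrE ?invr_ge0 ?(ltW m0)// ler_pdivrMr// mul1r.
Qed.

Definition defect_cst := m * (m * 2 `^ m + 2) `^ (m - 1).

(** With w = v^(1/m), the defect is at most m (w + 1)^(m-1), one power of w below v. For w > K lam,
    K = m 2^m, this is below v / lam; for w <= K lam, the bound w + 1 <= (K + 2) lam gives the
    second term, whence [defect_cst]. *)
Lemma psi_defect_le (v lam : R) : 0 <= v -> 1 <= lam ->
  psi_defect v <= v / lam + defect_cst * lam `^ (m - 1).
Proof.
move=> v0 l1; have l0 : 0 < lam by exact: lt_le_trans l1.
pose w := v `^ m^-1; have w0 : 0 <= w by exact: powR_ge0.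
have vE : v = w `^ m by rewrite powR_rootK.
have wm : (w + 1) `^ m - w `^ m <= m * (w + 1) `^ (m - 1).
  have w10 : 0 < w + 1 by lra.
  have := @bernoulli_powR _ m (w / (w + 1)) (ltW m1) (divr_ge0 w0 (ltW w10)).
  have p0 : 0 < (w + 1) `^ m by rewrite powR_gt0.
  rewrite -(ler_pM2r p0) -powRM ?divr_ge0 ?(ltW w10)// divfK ?gt_eqF// => h.
  have -> : (w + 1) `^ (m - 1) = (w + 1) `^ m / (w + 1).
    by rewrite powRB ?powRr1 ?ltW// (gt_eqF w10) implybT.
  have E : (1 + m * (w / (w + 1) - 1)) * (w + 1) `^ m
      = (w + 1) `^ m - m * ((w + 1) `^ m / (w + 1)) by field; rewrite gt_eqF.
  by move: h; rewrite E; lra.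
rewrite /psi_defect /psi_exponent -/w {1}vE (le_trans wm)//.
pose K := m * 2 `^ m.
have m10 : 0 <= m - 1 by rewrite subr_ge0 ltW.
have K1 : 1 <= K.
  rewrite /K; have : 1 <= 2 `^ m :> R.
    by rewrite -[leLHS](powRr0 2); apply: ler_powR; [lra|exact: ltW].
  by move=> h; rewrite -[X in X <= _](mulr1 1) ler_pM// ltW.
have [wK|wK] := leP w (K * lam).
  rewrite -[leLHS]add0r lerD ?divr_ge0 ?(ltW l0)// /defect_cst -mulrA ler_pM2l//.
  have K20 : 0 <= m * 2 `^ m + 2 by rewrite -/K; lra.
  rewrite -powRM ?(ltW l0)//; apply: ge0_ler_powR => //; rewrite ?nnegrE.
  - by rewrite addr_ge0.
  - by rewrite mulr_ge0 // ltW.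
  - by rewrite -/K mulrDl; lra.
have w1 : 1 <= w by rewrite (le_trans _ (ltW wK))// -[X in X <= _](mulr1 1) ler_pM.
have wp : 0 < w by lra.
apply: (@le_trans _ _ (v / lam)); last first.
  by rewrite lerDl !mulr_ge0 ?powR_ge0 ?(ltW m0).
have : (w + 1) `^ (m - 1) <= 2 `^ m * (w `^ m / w).
  have -> : w `^ m / w = w `^ (m - 1) by rewrite powRB ?powRr1 ?ltW// (gt_eqF wp) implybT.
  apply: (@le_trans _ _ ((2 * w) `^ (m - 1))).
    by rewrite ge0_ler_powR ?nnegrE//; lra.
  rewrite powRM ?ler_wpM2r ?powR_ge0 ?(ltW wp)// ler_powR; lra.
move=> /(ler_wpM2l (ltW m0)) /le_trans; apply.
rewrite vE mulrA -/K mulrA ler_pdivrMr// mulrAC ler_pdivlMr// mulrAC -mulrA.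
have -> : m * (lam * (2 `^ m * w `^ m)) = w `^ m * (K * lam) by rewrite /K; ring.
by rewrite ler_wpM2l ?powR_ge0// ltW.
Qed.

End Theta.

Section Psi.
Context {R : realType} (m M : R).
Hypotheses (m1 : 1 < m) (M1 : 1 < M).

Let m0 : 0 < m. Proof. exact: lt_trans m1. Qed.
Let M0 : 0 < M. Proof. exact: lt_trans M1. Qed.
Let lnM0 : 0 < ln M. Proof. by rewrite ln_gt0. Qed.

Definition Psi_slope : R := derive1 (Psi_core M m) M^-1.

Lemma Psi_coreE (t : R) : 0 < t ->
  Psi_core M m t = t * expR (psi_defect m (ln M) - psi_defect m (ln t^-1)).
Proof.
move=> t0; rewrite /Psi_core /Psi_const -[X in _ = X * _](@lnK _ t) ?posrE//.
rewrite -!expRD /psi_defect /psi_exponent (@lnV _ t) ?posrE//.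
move: (ln M) (ln t) => u v; congr (expR _).
by move: ((u `^ _ + 1) `^ m) (((- v) `^ _ + 1) `^ m) => x y; lra.
Qed.

Lemma Psi_core_VM : Psi_core M m M^-1 = M^-1.
Proof. by rewrite Psi_coreE ?invr_gt0// invrK subrr expR0 mulr1. Qed.

(** The slope equals (1 + (ln M)^(-1/m))^(m-1). Being at least 1, it keeps [Psi_ratio] nondecreasing
    on the affine part, from 1 at 1/M towards the slope. *)
Lemma Psi_slope_ge1 : 1 <= Psi_slope.
Proof.
pose v := ln M; pose w := v `^ m^-1.
have w0 : 0 < w by rewrite powR_gt0.
have D : is_derive (M^-1) 1 (Psi_core M m)
    (Psi_const M m * (expR (- ((w + 1) `^ m)) *
      (- (m * (w + 1) `^ (m - 1) * (m^-1 * v `^ (m^-1 - 1) * (M^-1 * (- M ^+ 2))))))).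
  apply: is_derive_eq.
    apply: (@is_deriveM _ _ (cst (Psi_const M m)) _ _ _ _ _ _ _).
    apply: (@is_derive1_comp _ expR (fun t : R => - ((ln t^-1 `^ m^-1 + 1) `^ m))).
    apply: is_deriveN.
    apply: (@is_derive1_comp _ (fun x : R => x `^ m) (fun t : R => (ln t^-1 `^ m^-1 + 1))).
      by apply: is_derive1_powR; rewrite addr_gt0 ?invrK.
    apply: is_deriveD.
    apply: (@is_derive1_comp _ (fun x : R => x `^ m^-1) (fun t : R => ln t^-1)).
      by apply: is_derive1_powR; rewrite invrK.
    apply: (@is_derive1_comp _ (@ln R) (fun t : R => t^-1)).
      by apply: is_derive1_ln; rewrite invrK.
    apply: (@is_deriveV _ id).
    by rewrite invr_eq0 gt_eqF.
  rewrite /cst/= !scaler0 !addr0 /GRing.scale/= invrK -/v -/w.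
  by rewrite !mulr1 !exprVn invrK.
rewrite /Psi_slope derive1E (@derive_val _ _ _ _ _ _ _ D).
have C := Psi_core_VM; rewrite /Psi_core invrK -/v -/w in C.
rewrite mulrA C.
have -> : M^-1 * - (m * (w + 1) `^ (m - 1) * (m^-1 * v `^ (m^-1 - 1) * (M^-1 * - M ^+ 2)))
   = (w + 1) `^ (m - 1) * v `^ (m^-1 - 1).
  by field; rewrite !gt_eqF.
have vE : v `^ (m^-1 - 1) = w `^ (- (m - 1)).
  by rewrite /w -powRrM; congr powR; field; rewrite gt_eqF.
rewrite vE powRN -ler_pdivrMr ?invr_gt0 ?powR_gt0// mul1r invrK.
by rewrite ge0_ler_powR ?nnegrE ?subr_ge0 ?(ltW m1) ?(ltW w0)//; lra.
Qed.

Lemma Psi0 : Psi M m 0 = 0. Proof. by rewrite /Psi lexx. Qed.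

Lemma Psi_ltVM (t : R) : 0 < t -> t < M^-1 -> Psi M m t = Psi_core M m t.
Proof. by move=> t0 tM; rewrite /Psi leNgt t0/= tM. Qed.

Lemma Psi_geVM (t : R) : M^-1 <= t -> Psi M m t = M^-1 + Psi_slope * (t - M^-1).
Proof.
move=> tM; have t0 : 0 < t by rewrite (lt_le_trans _ tM)// invr_gt0.
by rewrite /Psi leNgt t0/= ltNge tM/= Psi_core_VM.
Qed.

Definition Psi_ratio (t : R) := Psi M m t / t.

Lemma PsiE (t : R) : 0 < t -> Psi M m t = t * Psi_ratio t.
Proof. by move=> t0; rewrite /Psi_ratio mulrC divfK ?gt_eqF. Qed.

Let ln_inv_gt (t : R) : 0 < t -> t < M^-1 -> ln M < ln t^-1.
Proof. by move=> t0 tM; rewrite ltr_ln ?posrE ?invr_gt0// -(invrK M) ltf_pV2 ?posrE ?invr_gt0. Qed.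

Lemma Psi_ratio_ltVM (t : R) : 0 < t -> t < M^-1 ->
  Psi_ratio t = expR (psi_defect m (ln M) - psi_defect m (ln t^-1)).
Proof.
by move=> t0 tM; rewrite /Psi_ratio Psi_ltVM// Psi_coreE// mulrAC divff ?gt_eqF// mul1r.
Qed.

Lemma Psi_ratio_geVM (t : R) : M^-1 <= t ->
  Psi_ratio t = Psi_slope - (Psi_slope - 1) / (M * t).
Proof.
move=> tM; have t0 : 0 < t by rewrite (lt_le_trans _ tM)// invr_gt0.
by rewrite /Psi_ratio Psi_geVM//; field; rewrite !gt_eqF.
Qed.

Lemma Psi_ratio_le1 (t : R) : 0 < t -> t < M^-1 -> Psi_ratio t <= 1.
Proof.
move=> t0 tM; rewrite Psi_ratio_ltVM// -[leRHS]expR0 ler_expR subr_le0.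
by apply: psi_defect_ndecr => //; apply: ltW => //; exact: ln_inv_gt.
Qed.

Lemma Psi_ratio_ge1 (t : R) : M^-1 <= t -> 1 <= Psi_ratio t.
Proof.
move=> tM; have t0 : 0 < t by rewrite (lt_le_trans _ tM)// invr_gt0.
have Mt : 1 <= M * t by rewrite -ler_pdivrMl// mulr1.
have := Psi_slope_ge1; set b := Psi_slope => b1.
rewrite Psi_ratio_geVM// -/b lerBrDr -lerBrDl ler_pdivrMr ?mulr_gt0//.
by rewrite -[leLHS]mulr1 ler_wpM2l// subr_ge0.
Qed.

Lemma Psi_ratio_le_slope (t : R) : 0 < t -> Psi_ratio t <= Psi_slope.
Proof.
move=> t0; have [tM|tM] := ltP t M^-1.
  by rewrite (le_trans (Psi_ratio_le1 t0 tM))// Psi_slope_ge1.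
by rewrite Psi_ratio_geVM// gerBl divr_ge0 ?subr_ge0 ?Psi_slope_ge1// mulr_ge0 // ltW.
Qed.

Lemma Psi_ratio_gt0 (t : R) : 0 < t -> 0 < Psi_ratio t.
Proof.
move=> t0; have [tM|tM] := ltP t M^-1; first by rewrite Psi_ratio_ltVM// expR_gt0.
by rewrite (lt_le_trans _ (Psi_ratio_ge1 tM)).
Qed.

Lemma Psi_ratio_ndecr (s t : R) : 0 < s -> s <= t -> Psi_ratio s <= Psi_ratio t.
Proof.
move=> s0 st; have t0 : 0 < t by exact: lt_le_trans st.
have [tM|tM] := ltP t M^-1.
  have sM := le_lt_trans st tM.
  rewrite !Psi_ratio_ltVM// ler_expR lerD2l lerN2.
  apply: psi_defect_ndecr => //.
    by apply: ltW; rewrite (lt_trans lnM0)// ln_inv_gt.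
  by rewrite ler_ln ?posrE ?invr_gt0// lef_pV2 ?posrE.
have [sM|sM] := ltP s M^-1.
  by rewrite (le_trans (Psi_ratio_le1 s0 sM))// Psi_ratio_ge1.
rewrite !Psi_ratio_geVM// lerD2l lerN2 ler_wpM2l ?subr_ge0 ?Psi_slope_ge1//.
by rewrite lef_pV2 ?posrE ?mulr_gt0// ler_pM2l.
Qed.

Lemma Psi_gt0 (t : R) : 0 < t -> 0 < Psi M m t.
Proof. by move=> t0; rewrite PsiE// mulr_gt0// Psi_ratio_gt0. Qed.

Lemma Psi_incr (s t : R) : 0 <= s -> s < t -> Psi M m s < Psi M m t.
Proof.
move=> s0 st; have t0 : 0 < t by exact: le_lt_trans st.
move: s0; rewrite le_eqVlt => /predU1P[<-|s0]; first by rewrite Psi0 Psi_gt0.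
rewrite !PsiE// (@lt_le_trans _ _ (t * Psi_ratio s))//.
  by rewrite ltr_pM2r// Psi_ratio_gt0.
by rewrite ler_pM2l// Psi_ratio_ndecr// ltW.
Qed.

(** Below 1/M this is subadditivity of [psi_defect], as ln (1/beta) = ln (1/(q beta)) + ln q. The
    factor [Psi_slope] covers the cases where q beta lies in the affine part. *)
Lemma Psi_ratioM (q beta lam : R) : 1 <= q -> 0 < beta -> 1 <= lam ->
  Psi_ratio (q * beta) <=
  Psi_slope * (q `^ lam^-1 * expR (defect_cst m * lam `^ (m - 1))) * Psi_ratio beta.
Proof.
move=> q1 b0 l1; have q0 : 0 < q by exact: lt_le_trans q1.
have lnq0 : 0 <= ln q by rewrite ln_ge0.
have -> : q `^ lam^-1 * expR (defect_cst m * lam `^ (m - 1)) =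
    expR (ln q / lam + defect_cst m * lam `^ (m - 1)).
  by rewrite /powR gt_eqF// expRD mulrC [_^-1 * _]mulrC mulrC.
suff H : Psi_ratio (q * beta) <= Psi_slope * expR (psi_defect m (ln q)) * Psi_ratio beta.
  rewrite (le_trans H)// ler_wpM2r ?(ltW (Psi_ratio_gt0 _))//.
  rewrite ler_wpM2l ?(le_trans ler01 Psi_slope_ge1)// ler_expR.
  exact: psi_defect_le.
have s1 := Psi_slope_ge1.
have qb0 : 0 < q * beta by rewrite mulr_gt0.
have e1 : 1 <= expR (psi_defect m (ln q)) by rewrite -[leLHS]expR0 ler_expR psi_defect_ge0.
have [bM|bM] := ltP beta M^-1; last first.
  rewrite (le_trans (Psi_ratio_le_slope qb0))// -mulrA -[leLHS]mulr1.
  rewrite ler_wpM2l ?(le_trans ler01 s1)// -[leLHS](mulr1 1) ler_pM//.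
  exact: Psi_ratio_ge1.
rewrite -mulrA (@Psi_ratio_ltVM beta)// -expRD.
have lb : ln beta^-1 = ln (q * beta)^-1 + ln q.
  by rewrite !lnV ?posrE// lnM ?posrE//; ring.
have [qbM|qbM] := ltP (q * beta) M^-1.
  rewrite Psi_ratio_ltVM// -[leLHS]mul1r ler_pM ?expR_ge0// ler_expR.
  have h : psi_defect m (ln beta^-1) <= psi_defect m (ln (q * beta)^-1) + psi_defect m (ln q).
    rewrite lb; apply: psi_defectD => //.
    by apply: ltW; rewrite (lt_trans lnM0)// ln_inv_gt.
  by move: h; move: (psi_defect _ _) (psi_defect _ _) (psi_defect _ _) (psi_defect _ _) => x y z t; lra.
rewrite (le_trans (Psi_ratio_le_slope qb0))// -[leLHS]mulr1.
rewrite ler_wpM2l ?(le_trans ler01 s1)// -[leLHS]expR0 ler_expR.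
have h : psi_defect m (ln beta^-1) <= psi_defect m (ln M) + psi_defect m (ln q).
  apply: (@le_trans _ _ (psi_defect m (ln M + ln q))).
    apply: psi_defect_ndecr => //.
      by apply: ltW; rewrite (lt_trans lnM0)// ln_inv_gt.
    rewrite lb lerD2r ler_ln ?posrE ?invr_gt0//.
    by rewrite -[leRHS](invrK M) lef_pV2 ?posrE ?invr_gt0.
  by apply: psi_defectD => //; exact: ltW.
by move: h; move: (psi_defect _ _) (psi_defect _ _) (psi_defect _ _) => x y z; lra.
Qed.

Lemma Psi_inv_le (v beta : R) : 0 <= beta -> v <= Psi M m beta -> Psi_inv M m v <= beta.
Proof.
move=> b0 vb; rewrite /Psi_inv /pinv_ splitV oinv_surj.
(* Off the range of [Psi] the partial inverse takes its default value 0, which is at most [beta]. *)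
case: pselect => [vi|_ //=]; case: cid2 => u /=.
rewrite in_itv/= andbT => u0 uv; rewrite leNgt; apply/negP => bu.
by have := Psi_incr b0 bu; rewrite ltNge (uv : Psi M m u = v) vb.
Qed.

End Psi.

(** * Subunit curves and the control distance *)

Section Lipschitz.
Context {R : realType}.
Implicit Types (g : R -> R) (A : set R).
Local Open Scope classical_set_scope.

Lemma lipschitz_onE g A : [lipschitz g t | t in A] <->
  exists2 L, 0 <= L & forall s t, A s -> A t -> `|g s - g t| <= L * `|s - t|.
Proof.
split=> [[K [_ KP]]|[L L0 LP]]; last first.
  exists L; split; first exact: num_real.
  by move=> K LK [s t] [/= As At]; rewrite (le_trans (LP _ _ As At))// ler_wpM2r// ltW.
exists (Num.max 0 K + 1); first by rewrite addr_ge0// le_max lexx.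
move=> s t As At.
have /(KP _)/(_ (s, t)) : K < Num.max 0 K + 1.
  by rewrite (@le_lt_trans _ _ (Num.max 0 K)) ?ltrDl// le_max lexx orbT.
by apply; split.
Qed.

Lemma derive1_step (g : R -> R) (s c e : R) : derivable g s 1 -> `|derive1 g s| <= c ->
  0 < e -> exists2 d, 0 < d & forall h, 0 < h -> h < d -> `|g (s + h) - g s| <= (c + e) * h.
Proof.
move=> dg gc e0; have := dg; rewrite /derivable => /cvg_ex[/= l lP].
have lE : derive1 g s = l by rewrite derive1E; exact/cvg_lim.
have /cvgrPdist_lt/(_ _ e0) := lP.
rewrite near_withinE => /nbhs_ballP[d d0 dP]; exists d => // h h0 hd.
have := dP h; rewrite /ball/= sub0r normrN gtr0_norm// => /(_ hd (lt0r_neq0 h0)).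
rewrite /GRing.scale/= mulr1 [h + s]addrC => /ltW le.
have : `|h^-1 * (g (s + h) - g s)| <= c + e.
  rewrite -[X in `|X|](subrK l) (le_trans (ler_normD _ _))// addrC lerD//.
    by rewrite -lE.
  by rewrite distrC.
by rewrite normrM ger0_norm ?invr_ge0 ?(ltW h0)// ler_pdivrMl// mulrC.
Qed.

(* Growth of g off an open set of small measure is controlled by the derivative, and
   on that set by the Lipschitz constant. *)
Lemma lipschitz_ae_derive1_le g (r c : R) : 0 <= r -> 0 <= c -> [lipschitz g t | t in `[0, r]] ->
  {ae @lebesgue_measure R, forall t, 0 < t < r -> derivable g t 1 /\ `|derive1 g t| <= c} ->
  `|g r - g 0| <= c * r.
Proof.
move=> r0 c0 /lipschitz_onE[L L0 LP] [A [mA A0 AP]].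
have [r00|rn] := eqVneq r 0; first by rewrite r00 subrr normr0 mulr0.
have rp : 0 < r by rewrite lt_neqAle eq_sym rn.
pose mu : {measure set (measurableTypeR R) -> \bar R} := @lebesgue_measure R.
(* The origin is added so that a point outside [U] is positive, as the hypothesis on derivatives
   demands. *)
pose N : set (measurableTypeR R) := A `|` [set 0].
have mN : measurable N by apply: measurableU.
have N0 : mu N = 0%E by rewrite measureU0//; exact: lebesgue_measure_set1.
suff H e : 0 < e -> `|g r - g 0| <= (c + e) * r + L * e.
  rewrite -subr_le0; apply/ler_addgt0Pr => e e0; rewrite add0r.
  have k0 : 0 < r + L + 1 by rewrite ltr_wpDl// addr_ge0.
  have := H (e / (r + L + 1)) (divr_gt0 e0 k0); set k := _ / _.
  have : (r + L) * k <= e.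
    rewrite /k mulrA ler_pdivrMr// mulrC ler_pM2l// lerDl//.
  by rewrite !mulrDl lerBlDl; lra.
move=> e0.
have [U [oU NU Ue]] : exists U, [/\ open U, N `<=` U & (mu U < e%:E)%E].
  have Noo : (mu N < +oo)%E by rewrite N0 ltry.
  have [U [oU NU Ue]] := lebesgue_regularity_outer mN Noo e0.
  exists U; split => //.
  suff -> : mu U = mu (U `\` N) by [].
  have mUN : measurable (U `\` N) by apply: measurableD => //; exact: open_measurable.
  by rewrite -{1}(setDKU NU) measureU0.
have mU : measurable U by exact: open_measurable.
have mUt t : measurable (U `&` `[0, t]) by exact: measurableI.
have muS (B C : set (measurableTypeR R)) : measurable B -> measurable C -> B `<=` C ->
  (mu B <= mu C)%E by move=> mB mC BC; rewrite le_measure ?inE.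
pose V t := fine (mu (U `&` `[0, t])).
have Vfin t : mu (U `&` `[0, t]) \is a fin_num.
  rewrite ge0_fin_numE// (le_lt_trans _ (lt_trans Ue (ltry _)))//.
  exact: (muS _ _ (mUt t) mU (@subIsetl _ _ _)).
have VE t : (V t)%:E = mu (U `&` `[0, t]) by rewrite fineK.
have V0 t : 0 <= V t by rewrite fine_ge0.
have Ve t : V t <= e.
  rewrite -lee_fin VE (le_trans _ (ltW Ue))//.
  exact: (muS _ _ (mUt t) mU (@subIsetl _ _ _)).
have Vle s t : s <= t -> V s <= V t.
  move=> st; rewrite -lee_fin !VE; apply: (muS _ _ (mUt s) (mUt t)).
  by apply: setIS => x /=; rewrite !in_itv/= => /andP[-> /le_trans]; apply.
have VD s h : 0 <= s -> 0 < h -> (forall x, s < x -> x <= s + h -> U x) -> V s + h <= V (s + h).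
  move=> s0 h0 sU; rewrite -lee_fin EFinD !VE.
  have mJ : measurable (`]s, s + h] : set (measurableTypeR R)) by [].
  have JE : mu `]s, s + h] = h%:E.
    have := lebesgue_measure_itv `]s, s + h]%R.
    by rewrite /= lte_fin ltrDl h0 -EFinB [(s + h)%R]addrC addrK.
  pose I1 : set (measurableTypeR R) := U `&` `[0, s].
  pose I2 : set (measurableTypeR R) := `]s, s + h].
  have UE : mu (I1 `|` I2) = (mu I1 + mu I2)%E.
    apply: measureU; [exact: mUt|exact: mJ|].
    apply/seteqP; split => x //= [[_ +]]; rewrite /I2/= !in_itv/= => /andP[_ xs] /andP[sx _].
    by move: sx; rewrite ltNge xs.
  rewrite -JE -UE.
  apply: (muS _ _ (measurableU _ _ (mUt s) mJ) (mUt (s + h))).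
  move=> x [[Ux]|] /=; rewrite !in_itv/= => /andP[h1 h2].
    by split => //; rewrite h1/= (le_trans h2)// lerDl ltW.
  by split; [exact: sU|rewrite h2 (le_trans s0)// ltW].
(* Real induction on [0, r]: [P] holds at 0 and passes to the supremum [s] of [S] by Lipschitz
   continuity. If s < r it extends past [s], by the growth of [V] when [s] is in [U] and by the
   derivative at [s] otherwise. *)
pose P t := `|g t - g 0| <= (c + e) * t + L * V t.
pose S := [set t | 0 <= t <= r /\ P t].
have S0 : S 0 by split; rewrite ?lexx//= /P subrr normr0 mulr0 add0r mulr_ge0.
have supS : has_sup S by split; [exists 0|exists r => t [/andP[]]].
pose s := sup S.
have s0 : 0 <= s by apply: ub_le_sup => //; case: supS.
have sr : s <= r by apply: ge_sup; [exists 0|move=> t [/andP[]]].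
have ce0 : 0 <= c + e by rewrite addr_ge0// ltW.
have Ps : P s.
  rewrite /P; apply/ler_addgt0Pr => d d0.
  have k0 : 0 < L + 1 by rewrite ltr_wpDl.
  have [t [/andP[t0 tr] Pt] st] := sup_adherent (divr_gt0 d0 k0) supS.
  have ts : t <= s by apply: ub_le_sup; [case: supS|split => //; rewrite t0].
  have Lts : `|g s - g t| <= d.
    rewrite (le_trans (LP _ _ _ _))/= ?in_itv/= ?s0 ?t0//.
    rewrite ger0_norm ?subr_ge0//.
    have : s - t <= d / (L + 1) by move: st; rewrite -/s; lra.
    rewrite ler_pdivlMr// => h; rewrite (le_trans _ h)// mulrC ler_wpM2l ?subr_ge0//.
    by rewrite lerDl.
  rewrite (le_trans (ler_distD (g t) _ _))// addrC lerD//.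
  rewrite (le_trans (Pt : _ <= _))// lerD ?ler_wpM2l//; exact: Vle.
suff -> : r = s by rewrite (le_trans (Ps : _ <= _))// lerD2l ler_wpM2l.
apply/eqP; rewrite eq_le sr andbT leNgt; apply/negP => slr.
suff [h h0 hS] : exists2 h, 0 < h & S (s + h).
  have : s + h <= s by apply: ub_le_sup => //; case: supS.
  by rewrite gerDl leNgt h0.
have rs : 0 < r - s by rewrite subr_gt0.
have [sU|sU] := pselect (U s).
  have /nbhs_ballP[d /= d0 dU] := open_nbhs_nbhs (conj oU sU).
  pose h := Num.min (d / 2) (r - s).
  have h0 : 0 < h by rewrite lt_min divr_gt0.
  have hd : h < d by rewrite (@le_lt_trans _ _ (d / 2)) ?ge_min ?lexx//; lra.
  have hr : h <= r - s by rewrite ge_min lexx orbT.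
  exists h => //; split; first by rewrite addr_ge0 ?(ltW h0)//=; lra.
  have VS : V s + h <= V (s + h).
    apply: VD => // x sx xh; apply: dU; rewrite /ball/= ltr0_norm; lra.
  rewrite /P (le_trans (ler_distD (g s) _ _))//.
  have A1 : `|g (s + h) - g s| <= L * h.
    rewrite (le_trans (LP _ _ _ _))/= ?in_itv/= ?s0//; last by rewrite addrAC subrr add0r gtr0_norm.
    by rewrite addr_ge0 ?(ltW h0)//=; lra.
  have A2 := ler_wpM2l L0 VS.
  have A3 : 0 <= (c + e) * h by rewrite mulr_ge0// ltW.
  by move: Ps A1 A2 A3; rewrite /P !mulrDr; lra.
have sp : 0 < s.
  by rewrite lt_neqAle s0 andbT; apply/eqP => s00; apply: sU; apply: NU; right.
have [ds dc] : derivable g s 1 /\ `|derive1 g s| <= c.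
  apply: contrapT => ns; apply: sU; apply: NU; left; apply: AP => /=.
  by move=> h; apply: ns; apply: h; rewrite sp.
have [d d0 dP] := derive1_step ds dc e0.
pose h := Num.min (d / 2) (r - s).
have h0 : 0 < h by rewrite lt_min divr_gt0.
have hd : h < d by rewrite (@le_lt_trans _ _ (d / 2)) ?ge_min ?lexx//; lra.
have hr : h <= r - s by rewrite ge_min lexx orbT.
exists h => //; split; first by rewrite addr_ge0 ?(ltW h0)//=; lra.
rewrite /P (le_trans (ler_distD (g s) _ _))//.
have A1 := dP h h0 hd.
have A2 : L * V s <= L * V (s + h) by rewrite ler_wpM2l// Vle// lerDl ltW.
by move: Ps A1 A2; rewrite /P !mulrDr; lra.
Qed.

End Lipschitz.

Section Curves.
Context {R : realType}.
Implicit Types (f g gx gy : R -> R) (p q : plane (R := R)).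
Local Open Scope classical_set_scope.

Lemma ae_lebesgue_sub (P Q : R -> Prop) : (forall t, P t -> Q t) ->
  {ae @lebesgue_measure R, forall t, P t} -> {ae @lebesgue_measure R, forall t, Q t}.
Proof. by move=> PQ; apply: negligibleS => t /= nQ /PQ. Qed.

(** Prolongs a curve beyond time [r] by a segment of constant velocity [a]. *)
Definition extend_affine (r : R) g (a t : R) := if t <= r then g t else g r + a * (t - r).

Lemma extend_affine_lipschitz (r h : R) g (a : R) : 0 <= r -> 0 <= h ->
  [lipschitz g t | t in `[0, r]] -> [lipschitz extend_affine r g a t | t in `[0, r + h]].
Proof.
move=> r0 h0 /lipschitz_onE[L L0 LP]; apply/lipschitz_onE.
have K0 : 0 <= L + `|a| by rewrite addr_ge0.
exists (L + `|a|) => //.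
suff H (s t : R) : 0 <= s -> s <= t ->
    `|extend_affine r g a s - extend_affine r g a t| <= (L + `|a|) * `|s - t|.
  move=> s t /=; rewrite !in_itv/= => /andP[s0 _] /andP[t0 _].
  have [st|/ltW ts] := leP s t; first exact: H.
  by rewrite distrC [in leRHS]distrC H.
move=> s0 st; rewrite /extend_affine.
have t0 : 0 <= t by exact: le_trans st.
have [sr|rs] := leP s r; have [tr|rt] := leP t r.
- rewrite (le_trans (LP _ _ _ _))/= ?in_itv/= ?s0 ?t0//.
  by rewrite ler_wpM2r// lerDl.
- have A1 : `|g s - g r| <= L * (r - s).
    rewrite (le_trans (LP _ _ _ _))/= ?in_itv/= ?s0 ?lexx ?andbT//.
    by rewrite ler0_norm ?opprB// subr_le0.
  have A2 : `|a * (t - r)| = `|a| * (t - r).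
    by rewrite normrM (@ger0_norm _ (t - r))// subr_ge0 ltW.
  have -> : `|s - t| = t - s by rewrite ler0_norm ?opprB// subr_le0.
  have -> : g s - (g r + a * (t - r)) = (g s - g r) - a * (t - r) by ring.
  rewrite (le_trans (ler_normB _ _))// A2 (le_trans (lerD A1 (lexx _)))//.
  have B1 : L * (r - s) <= L * (t - s) by rewrite ler_wpM2l//; lra.
  have B2 : `|a| * (t - r) <= `|a| * (t - s) by rewrite ler_wpM2l//; lra.
  by rewrite mulrDl lerD.
- by move: rs; rewrite ltNge (le_trans st tr).
- have -> : g r + a * (s - r) - (g r + a * (t - r)) = a * (s - t) by ring.
  by rewrite normrM ler_wpM2r// lerDr.
Qed.

Lemma extend_affine_deriv_lt (r : R) g (a t : R) : t < r -> derivable g t 1 ->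
  derivable (extend_affine r g a) t 1 /\ derive1 (extend_affine r g a) t = derive1 g t.
Proof.
move=> tr dg.
have E : \forall x \near t, g x = extend_affine r g a x.
  near=> x; rewrite /extend_affine ifT//; apply: ltW; near: x; exact: lt_nbhsl.
split; first exact: near_eq_derivable dg.
by rewrite !derive1E; apply/esym/near_eq_derive.
Unshelve. all: by end_near. Qed.

Lemma extend_affine_deriv_gt (r : R) g (a t : R) : r < t ->
  derivable (extend_affine r g a) t 1 /\ derive1 (extend_affine r g a) t = a.
Proof.
move=> rt.
have E : \forall x \near t, g r + a * (x - r) = extend_affine r g a x.
  near=> x; rewrite /extend_affine ifF//; apply: lt_geF; near: x; exact: lt_nbhsr.
have D : is_derive t 1 (fun x : R => g r + a * (x - r)) a.
  apply: is_derive_eq.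
  by rewrite add0r mul1r subr0 /GRing.scale/= mulr1.
have D' := near_eq_is_derive E D.
split; first exact: ex_derive.
by rewrite derive1E derive_val.
Unshelve. all: by end_near. Qed.

(** At the junction [r] the derivative may jump; that single point joins the exceptional null
    set. *)
Lemma subunit_extend f (r h : R) gx gy (a c : R) : 0 <= r -> 0 <= h ->
  subunit f r gx gy ->
  (forall t, 0 < t < h -> exists2 v, c = f (gx r + a * t) * v & a ^+ 2 + v ^+ 2 <= 1) ->
  subunit f (r + h) (extend_affine r gx a) (extend_affine r gy c).
Proof.
move=> r0 h0 [lx ly [A [mA A0 AP]]] H; split; [exact: extend_affine_lipschitz..|].
exists (A `|` [set r]); split.
- exact: measurableU.
- by rewrite measureU0//; exact: lebesgue_measure_set1.
move=> t /= nt; apply: contrapT => /not_orP[nA nr]; apply: nt => /andP[t0 th].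
have [tr|rt] := ltP t r.
  have [dx dy [v vE v1]] : [/\ derivable gx t 1, derivable gy t 1 &
      exists2 v : R, derive1 gy t = f (gx t) * v & derive1 gx t ^+ 2 + v ^+ 2 <= 1].
    apply: contrapT => nH; apply: nA; apply: AP => /= K.
    by apply: nH; apply: K; rewrite t0.
  have [dx1 dx2] := extend_affine_deriv_lt a tr dx.
  have [dy1 dy2] := extend_affine_deriv_lt c tr dy.
  split => //; exists v; last by rewrite dx2.
  by rewrite dy2 vE /extend_affine (ltW tr).
have {}rt : r < t by rewrite lt_neqAle rt andbT; apply/eqP => e; exact: nr.
have [dx1 dx2] := @extend_affine_deriv_gt r gx a t rt.
have [dy1 dy2] := @extend_affine_deriv_gt r gy c t rt.
split => //; have [|v vE v1] := H (t - r); first by rewrite subr_gt0 rt ltrBlDl.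
exists v; last by rewrite dx2.
by rewrite dy2 vE /extend_affine leNgt rt.
Qed.

Lemma subunit_const f p : subunit f 0 (cst p.1) (cst p.2).
Proof.
split; try by apply/lipschitz_onE; exists 0 => // s t _ _; rewrite subrr normr0 mul0r.
by apply: aeW => t /andP[t0 /(lt_trans t0)]; rewrite ltxx.
Qed.

Lemma subunit_restrict f (r s : R) gx gy : s <= r -> subunit f r gx gy -> subunit f s gx gy.
Proof.
move=> sr [/lipschitz_onE[L L0 LP] /lipschitz_onE[L' L0' LP'] ae].
have sub (x : R) : `[0, s] x -> `[0, r] x.
  by rewrite /= !in_itv/= => /andP[-> /le_trans]; apply.
split.
- by apply/lipschitz_onE; exists L => // x y /sub + /sub; exact: LP.
- by apply/lipschitz_onE; exists L' => // x y /sub + /sub; exact: LP'.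
- apply: ae_lebesgue_sub ae => t + /andP[t0 ts]; apply; by rewrite t0 (lt_le_trans ts).
Qed.

Lemma subunit_x_le f (r t : R) gx gy : subunit f r gx gy -> 0 <= t -> t <= r ->
  `|gx t - gx 0| <= t.
Proof.
move=> su t0 tr; have [lx _ ae] := subunit_restrict tr su.
rewrite -[leRHS]mul1r; apply: lipschitz_ae_derive1_le => //.
apply: ae_lebesgue_sub ae => x + xt => /(_ xt)[dx _ [v _ v1]]; split => //.
rewrite -(@ler_pXn2r _ 2) ?nnegrE// expr1n real_normK ?num_real//.
by rewrite (le_trans _ v1)// lerDl sqr_ge0.
Qed.

Lemma subunit_y_le f (r c : R) gx gy : subunit f r gx gy -> 0 <= r -> 0 <= c ->
  (forall t, 0 < t < r -> `|f (gx t)| <= c) -> `|gy r - gy 0| <= c * r.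
Proof.
move=> [_ ly ae] r0 c0 fc; apply: lipschitz_ae_derive1_le => //.
apply: ae_lebesgue_sub ae => x + xt => /(_ xt)[_ dy [v vE v1]]; split => //.
rewrite vE normrM -[leRHS]mulr1 ler_pM// ?fc//.
rewrite -(@ler_pXn2r _ 2) ?nnegrE// expr1n real_normK ?num_real//.
by rewrite (le_trans _ v1)// lerDr sqr_ge0.
Qed.

Local Open Scope ereal_scope.

Lemma cdist_ge0 f p q : 0 <= cdist f p q.
Proof. by apply: le_ereal_inf_tmp => _ [r [r0 _] <-]; rewrite lee_fin. Qed.

Lemma cdist_ge f p q : `|q.1 - p.1|%:E <= cdist f p q.
Proof.
apply: le_ereal_inf_tmp => _ [r [r0 [gx [gy [su <- <-]]]] <-]; rewrite lee_fin/=.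
exact: subunit_x_le su _ _.
Qed.

Lemma cdistpp f p : cdist f p p = 0.
Proof.
apply/eqP; rewrite eq_le cdist_ge0 andbT; apply: ereal_inf_lbound => /=.
exists 0%R => //; split => //; exists (cst p.1), (cst p.2).
by split; [exact: subunit_const| |]; rewrite /cst -surjective_pairing.
Qed.

(** Stands in for the triangle inequality, with a straight second leg starting at [q]. *)
Lemma cdist_extend f p q (a c h : R) : (0 <= h)%R ->
  (forall t, 0 < t < h -> exists2 v, c = f (q.1 + a * t) * v & a ^+ 2 + v ^+ 2 <= 1)%R ->
  cdist f p (q.1 + a * h, q.2 + c * h)%R <= cdist f p q + h%:E.
Proof.
move=> h0 H; rewrite -leeBlDr//; apply: le_ereal_inf_tmp => _ [r [r0 [gx [gy [su gp gq]]]] <-].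
rewrite leeBlDr// -EFinD; apply: ereal_inf_lbound => /=.
exists (r + h)%R => //; split; first exact: addr_ge0.
exists (extend_affine r gx a), (extend_affine r gy c); split.
- by apply: subunit_extend => // t th; have := H t th; rewrite -gq.
- by rewrite /extend_affine r0.
rewrite /extend_affine -gq/=; have [rh|rh] := leP (r + h)%R r.
  have -> : h = 0%R by apply/eqP; rewrite eq_le h0 andbT -(gerDl r).
  by rewrite !mulr0 !addr0.
by rewrite [(r + h)%R]addrC addrK.
Qed.

(** Horizontal motion at unit speed is subunit whatever [f] is, even where it vanishes: the witness
    is v = 0. *)
Lemma cdist_hmove f p q (x : R) : cdist f p (x, q.2) <= cdist f p q + `|x - q.1|%:E.
Proof.
have [xq|qx] := leP q.1 x.
  have := @cdist_extend f p q 1%R 0%R `|x - q.1|%R (normr_ge0 _).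
  rewrite ger0_norm ?subr_ge0// mul1r mul0r addr0 subrKC; apply => t _.
  by exists 0%R; rewrite ?mulr0// expr1n expr0n addr0.
have := @cdist_extend f p q (-1)%R 0%R `|x - q.1|%R (normr_ge0 _).
rewrite ltr0_norm ?subr_lt0// mulN1r opprK mul0r addr0 subrKC; apply => t _.
by exists 0%R; rewrite ?mulr0// sqrrN expr1n expr0n addr0.
Qed.

Lemma cdist_vmove f p q (y : R) : (0 < f q.1)%R ->
  cdist f p (q.1, y) <= cdist f p q + (`|y - q.2| / f q.1)%:E.
Proof.
move=> f0; have h0 : (0 <= `|y - q.2| / f q.1)%R by rewrite divr_ge0// ltW.
have := @cdist_extend f p q 0%R (f q.1 * Num.sg (y - q.2))%R _ h0.
rewrite mul0r addr0.
have -> : (f q.1 * Num.sg (y - q.2) * (`|y - q.2| / f q.1) = y - q.2)%R.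
  transitivity (Num.sg (y - q.2) * `|y - q.2|)%R; last by rewrite -numEsg.
  by field; rewrite gt_eqF.
rewrite subrKC; apply => t _; exists (Num.sg (y - q.2)); first by rewrite mul0r addr0.
rewrite expr0n add0r sqr_sg; by case: (_ != 0)%R.
Qed.

End Curves.

(** * Iterated logarithms *)

Section IteratedLog.
Context {R : realType}.
Implicit Types (x y t u w : R) (k j n : nat).

(** The common domain of the estimates on iterated logarithms: from e on, ln x is at least 1 and ln
    x / x is nonincreasing. *)
Definition ln_chain_ge_e k x := forall j, (j <= k)%N -> expR 1 <= iter j (@ln R) x.

Lemma expR1_ge2 : 2 <= expR 1 :> R.
Proof. by rewrite (le_trans _ (expR_ge1Dx _)). Qed.

Lemma ln_ge1 x : expR 1 <= x -> 1 <= ln x.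
Proof.
by move=> ex; rewrite -[leLHS](@expRK R) ler_ln ?posrE ?expR_gt0// (lt_le_trans _ ex)// expR_gt0.
Qed.

Lemma ln_le_id x : 0 < x -> ln x <= x.
Proof. by move=> x0; rewrite -{2}(lnK x0) (le_trans _ (expR_ge1Dx _))// lerDr. Qed.

Lemma ln_sub1_le x : 0 < x -> ln x <= x - 1.
Proof. by move=> x0; rewrite lerBrDl -{2}(lnK x0) expR_ge1Dx. Qed.

Lemma ln_chain_succ k x : ln_chain_ge_e k.+1 x <-> expR 1 <= x /\ ln_chain_ge_e k (ln x).
Proof.
split=> [H|[ex H] [|j] jk//]; last by rewrite iterSr; exact: H.
by split=> [|j jk]; [exact: (H 0%N)|rewrite -iterSr; exact: (H j.+1)].
Qed.

Lemma ln_chain_pos k x : ln_chain_ge_e k x -> 0 < x.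
Proof. by move=> /(_ 0%N isT); apply: lt_le_trans; exact: expR_gt0. Qed.

Lemma ln_chain_exists k : exists2 X : R, 0 < X & forall x, X <= x -> ln_chain_ge_e k x.
Proof.
elim: k => [|k [X X0 XP]]; first by exists (expR 1); rewrite ?expR_gt0// => x xe [].
exists (Num.max (expR 1) (expR X)); first by rewrite lt_max expR_gt0.
move=> x; rewrite ge_max => /andP[ex eX]; apply/ln_chain_succ; split => //.
apply: XP; rewrite -[leLHS](@expRK R) ler_ln ?posrE ?expR_gt0// (lt_le_trans _ eX)//.
exact: expR_gt0.
Qed.

Lemma iter_ln_le k x y : ln_chain_ge_e k x -> x <= y ->
  ln_chain_ge_e k y /\ iter k (@ln R) x <= iter k (@ln R) y.
Proof.
elim: k x y => [|k IH] x y xk xy.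
  by split => //; case=> // _; rewrite (le_trans (xk 0%N isT)).
have x0 := ln_chain_pos xk.
have [ex lxk] := (ln_chain_succ _ _).1 xk.
have [|h1 h2] := IH _ (ln y) lxk; first by rewrite ler_ln ?posrE// (lt_le_trans x0).
by rewrite !iterSr; split => //; apply/ln_chain_succ; rewrite (le_trans ex).
Qed.

Lemma iter_ln_le_id k x : ln_chain_ge_e k x -> iter k (@ln R) x <= x.
Proof.
elim: k x => // k IH x xk; have x0 := ln_chain_pos xk.
have [_ lxk] := (ln_chain_succ _ _).1 xk.
by rewrite iterSr (le_trans (IH _ lxk))// ln_le_id.
Qed.

(** The k-fold logarithm over the identity is nonincreasing: by induction its quotient between y and
    x is at most ln y / ln x, which is at most y / x because ln x >= 1. *)
Lemma iter_ln_ratio k x y : ln_chain_ge_e k x -> x <= y ->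
  iter k (@ln R) y * x <= iter k (@ln R) x * y.
Proof.
elim: k x y => [|k IH] x y xk xy; first by rewrite mulrC.
have x0 := ln_chain_pos xk; have y0 := lt_le_trans x0 xy.
have [ex lxk] := (ln_chain_succ _ _).1 xk.
have lx1 := ln_ge1 ex; have lx0 : 0 < ln x by exact: lt_le_trans lx1.
have lxy : ln x <= ln y by rewrite ler_ln.
rewrite !iterSr; have H1 := IH _ _ lxk lxy.
have H2 : ln y * x <= ln x * y.
  have -> : ln y = ln x + ln (y / x) by rewrite ln_div ?posrE// subrKC.
  rewrite mulrDl -[in leRHS](subrKC x y) mulrDr lerD2l.
  have : ln (y / x) * x <= y - x.
    by rewrite -ler_pdivlMr// mulrBl divff ?gt_eqF// ln_sub1_le// divr_gt0.
  by move=> /le_trans; apply; rewrite ler_peMl// subr_ge0.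
have i0 : 0 <= iter k (@ln R) (ln x).
  by rewrite (le_trans _ (lxk k (leqnn k)))// expR_ge0.
rewrite -(ler_pM2r lx0) mulrAC (le_trans (ler_wpM2r (ltW x0) H1))//.
by rewrite -!mulrA ler_wpM2l// [leRHS]mulrC.
Qed.

Lemma iter_ln_derive k x : ln_chain_ge_e k x -> exists d, is_derive x 1 (iter k (@ln R)) d.
Proof.
elim: k => [|k IH] xk; first by exists 1; exact: is_derive_id.
have [|d dP] := IH; first by move=> j jk; apply: xk; rewrite (leq_trans jk).
exists ((iter k (@ln R) x)^-1 * d).
apply: (@is_derive1_comp _ (@ln R) (iter k (@ln R))).
by apply: is_derive1_ln; rewrite (lt_le_trans _ (xk k _))// expR_gt0.
Qed.

End IteratedLog.

(** * Monotonicity and growth of F *)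

Section Geometry.
Context {R : realType} (k : nat) (sigma t0 : R).
Hypotheses (sigma0 : 0 < sigma) (t00 : 0 < t0) (t0k : ln_chain_ge_e k.+1 t0^-1).
Implicit Types (t u w x : R).

Notation F := (F_geom k.+1 sigma).

(** The index of the geometry is [k.+1] from here on, so [k = 0] is the case of a single
    logarithm. *)
Definition ell t : R := iter k.+1 (@ln R) t^-1.
(** Up to a factor 1 + sigma this is |t F'(t)|; [F_geom_sub_ge] and [F_geom_sub_le] express that
    through differences of F, without computing the derivative. *)
Definition amp t : R := ell t `^ sigma.

Lemma chain_inv t : 0 < t -> t <= t0 -> ln_chain_ge_e k.+1 t^-1.
Proof. by move=> tp tt; apply: (iter_ln_le t0k _).1; rewrite lef_pV2. Qed.

Lemma ampE t : amp t = ell t `^ sigma. Proof. by []. Qed.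

Lemma F_geomE t : F t = ln t^-1 * amp t. Proof. by []. Qed.

Lemma ell_ge1 t : 0 < t -> t <= t0 -> 1 <= ell t.
Proof.
move=> tp tt; rewrite (le_trans _ (chain_inv tp tt (leqnn _)))//.
by rewrite (le_trans _ expR1_ge2)// ler1n.
Qed.

Lemma amp_ge1 t : 0 < t -> t <= t0 -> 1 <= amp t.
Proof.
move=> tp tt; rewrite /amp -[leLHS](powRr0 (ell t)) ler_powR ?ell_ge1//.
exact: ltW.
Qed.

Lemma ln_inv_ge1 t : 0 < t -> t <= t0 -> 1 <= ln t^-1.
Proof. by move=> tp tt; apply: ln_ge1; exact: (chain_inv tp tt (leq0n _)). Qed.

Lemma ell_le u w : 0 < u -> u <= w -> w <= t0 -> ell w <= ell u.
Proof.
move=> u0 uw wt; have w0 := lt_le_trans u0 uw.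
by apply: (iter_ln_le (chain_inv w0 wt) _).2; rewrite lef_pV2.
Qed.

Lemma amp_le u w : 0 < u -> u <= w -> w <= t0 -> amp w <= amp u.
Proof.
move=> u0 uw wt; have w0 := lt_le_trans u0 uw.
rewrite /amp ge0_ler_powR ?nnegrE ?(ltW sigma0)// ?ell_le//.
- by rewrite (le_trans ler01)// ell_ge1.
- by rewrite (le_trans ler01)// ell_ge1// (le_trans uw).
Qed.

Lemma ln_inv_le u w : 0 < u -> u <= w -> ln w^-1 <= ln u^-1.
Proof.
move=> u0 uw; have w0 := lt_le_trans u0 uw.
by rewrite ler_ln ?posrE ?invr_gt0// lef_pV2.
Qed.

Lemma ell_ratio u w : 0 < u -> u <= w -> w <= t0 -> ell u * ln w^-1 <= ell w * ln u^-1.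
Proof.
move=> u0 uw wt; have w0 := lt_le_trans u0 uw; rewrite /ell !iterSr.
have [_ lk] := (ln_chain_succ _ _).1 (chain_inv w0 wt).
by apply: iter_ln_ratio => //; exact: ln_inv_le.
Qed.

Lemma ln_ratioE u w : 0 < u -> 0 < w -> ln (w / u) = ln u^-1 - ln w^-1.
Proof. by move=> u0 w0; rewrite ln_div ?posrE// !lnV ?posrE// opprK addrC. Qed.

Lemma F_geom_sub_ge u w : 0 < u -> u <= w -> w <= t0 -> amp w * ln (w / u) <= F u - F w.
Proof.
move=> u0 uw wt; have w0 := lt_le_trans u0 uw; have ut := le_trans uw wt.
rewrite !F_geomE ln_ratioE// mulrBr ![amp w * _]mulrC lerD2r ler_wpM2l ?amp_le//.
by rewrite (le_trans ler01)// ln_inv_ge1.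
Qed.

Lemma amp_ratio u w : 0 < u -> u <= w -> w <= t0 ->
  amp u * (ln w^-1 / ln u^-1) `^ sigma <= amp w.
Proof.
move=> u0 uw wt; have w0 := lt_le_trans u0 uw; have ut := le_trans uw wt.
have Lu := ln_inv_ge1 u0 ut; have Lw := ln_inv_ge1 w0 wt.
have Lu0 : 0 < ln u^-1 by exact: lt_le_trans Lu.
have Lw0 : 0 < ln w^-1 by exact: lt_le_trans Lw.
have eu0 : 0 <= ell u by rewrite (le_trans ler01)// ell_ge1.
have ew0 : 0 <= ell w by rewrite (le_trans ler01)// ell_ge1.
rewrite /amp -powRM//; last by rewrite divr_ge0 ?ltW.
rewrite ge0_ler_powR ?nnegrE ?(ltW sigma0)//.
  by rewrite mulr_ge0// divr_ge0 ?ltW.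
by rewrite mulrA ler_pdivrMr// ell_ratio.
Qed.

(** By [ell_ratio], F(w) >= F(u) q^(1 + sigma) with q = ln (1/w) / ln (1/u). Bernoulli linearizes
    the power, and F(u) (1 - q) = amp(u) ln (w/u). *)
Lemma F_geom_sub_le u w : 0 < u -> u <= w -> w <= t0 ->
  F u - F w <= (1 + sigma) * amp u * ln (w / u).
Proof.
move=> u0 uw wt; have w0 := lt_le_trans u0 uw; have ut := le_trans uw wt.
have Lu := ln_inv_ge1 u0 ut; have Lw := ln_inv_ge1 w0 wt.
have Lu0 : 0 < ln u^-1 by exact: lt_le_trans Lu.
have Lw0 : 0 < ln w^-1 by exact: lt_le_trans Lw.
have a0 : 0 <= amp u by exact: powR_ge0.
have H := amp_ratio u0 uw wt.
pose q := ln w^-1 / ln u^-1; have q0 : 0 < q by rewrite divr_gt0.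
have B : 1 + (1 + sigma) * (q - 1) <= q `^ (1 + sigma).
  by apply: bernoulli_powR; rewrite ?(ltW q0)// lerDl ltW.
have qE : q `^ (1 + sigma) = q * q `^ sigma by rewrite powRD ?powRr1 ?(ltW q0)// (gt_eqF q0) implybT.
have H1 : ln u^-1 * (amp u * (1 + (1 + sigma) * (q - 1))) <= ln w^-1 * amp w.
  rewrite (@le_trans _ _ (ln u^-1 * (amp u * (q * q `^ sigma))))//.
    by rewrite ler_pM2l// ler_wpM2l// -qE.
  have -> : ln u^-1 * (amp u * (q * q `^ sigma)) = ln w^-1 * (amp u * q `^ sigma).
    by rewrite /q; field; rewrite gt_eqF.
  by rewrite ler_pM2l.
rewrite !F_geomE ln_ratioE// lerBlDr -lerBlDl (le_trans _ H1)//.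
have -> : ln u^-1 * (amp u * (1 + (1 + sigma) * (q - 1)))
   = ln u^-1 * amp u - (1 + sigma) * amp u * (ln u^-1 - ln w^-1).
  by rewrite /q; field; rewrite gt_eqF.
exact: lexx.
Qed.

(** Here ln (2/w) <= 2 ln (1/w), since ln 2 <= 1 <= ln (1/w). *)
Lemma amp_half w : 0 < w -> w <= t0 -> amp (w / 2) <= 2 `^ sigma * amp w.
Proof.
move=> w0 wt; have w20 : 0 < w / 2 by rewrite divr_gt0.
have w2w : w / 2 <= w by lra.
have Lw := ln_inv_ge1 w0 wt; have Lu := ln_inv_ge1 w20 (le_trans w2w wt).
have H := amp_ratio w20 w2w wt.
have h2 : 2^-1 <= ln w^-1 / ln (w / 2)^-1.
  rewrite ler_pdivlMr ?(lt_le_trans _ Lu)// invf_div lnM ?posrE ?invr_gt0//.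
  have := @ln_sub1_le R 2 (ltr0n _ 2); lra.
rewrite -ler_pdivrMl ?powR_gt0//; apply: le_trans H.
rewrite mulrC ler_wpM2l ?powR_ge0//.
have -> : (2 `^ sigma)^-1 = 2^-1 `^ sigma :> R.
  by apply: (@mulfI _ (2 `^ sigma)); rewrite ?gt_eqF ?powR_gt0// -powRM// !divff ?powR1 ?gt_eqF ?powR_gt0.
have h0 : 0 <= 2^-1 :> R by rewrite invr_ge0.
by rewrite ge0_ler_powR ?nnegrE ?(ltW sigma0)// (le_trans h0 h2).
Qed.

Lemma F_geom_derivable x : 0 < x -> x <= t0 -> derivable F x 1.
Proof.
move=> x0 xt; have [d dP] := iter_ln_derive (chain_inv x0 xt).
have VP : is_derive x 1 (fun t : R => t^-1) (- x ^- 2 *: 1).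
  by apply: (@is_deriveV _ id); rewrite gt_eqF.
have D1 : is_derive x 1 (fun t : R => ln t^-1) (x^-1^-1 * (- x ^- 2 *: 1)).
  apply: (@is_derive1_comp _ (@ln R) (fun t : R => t^-1)).
  by apply: is_derive1_ln; rewrite invr_gt0.
have D2 : is_derive x 1 ell (d * (- x ^- 2 *: 1)).
  exact: (@is_derive1_comp _ (iter k.+1 (@ln R)) (fun t : R => t^-1)).
have D3 : is_derive x 1 amp (sigma * ell x `^ (sigma - 1) * (d * (- x ^- 2 *: 1))).
  apply: (@is_derive1_comp _ (fun y : R => y `^ sigma) ell).
  by apply: is_derive1_powR; rewrite (lt_le_trans ltr01)// ell_ge1.
by have D4 := is_deriveM D1 D3; exact: ex_derive.
Qed.

Lemma F_geom_derive1 x : 0 < x -> x <= t0 -> amp x / x <= `|derive1 F x|.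
Proof.
move=> x0 xt; have dF := F_geom_derivable x0 xt.
suff : derive1 F x <= - (amp x / x) by move=> h; rewrite ler_normr; apply/orP; right; lra.
apply/ler_addgt0Pr => e e0.
have := dF; rewrite /derivable => /cvg_ex[/= l lP].
have -> : derive1 F x = l by rewrite derive1E; exact/cvg_lim.
have /cvgrPdist_lt/(_ _ e0) := lP.
rewrite near_withinE => /nbhs_ballP[d /= d0 dP].
pose h := Num.min (d / 2) (x / 2).
have h0 : 0 < h by rewrite lt_min !divr_gt0.
have hd : h < d by rewrite (@le_lt_trans _ _ (d / 2)) ?ge_min ?lexx//; lra.
have hx : h < x by rewrite (@le_lt_trans _ _ (x / 2)) ?ge_min ?lexx ?orbT//; lra.
(* A difference quotient from the left, so that the lower bound on F(x - h) - F(x) carries the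
   amplitude at [x] itself. *)
have := dP (- h); rewrite /ball/= sub0r opprK gtr0_norm// oppr_eq0 => /(_ hd (lt0r_neq0 h0)).
rewrite /GRing.scale/= mulr1 [- h + x]addrC ltr_norml => /andP[_ H].
have u0 : 0 < x - h by rewrite subr_gt0.
have G := @F_geom_sub_ge (x - h) x u0 _ xt.
have {}G : amp x * (h / x) <= F (x - h) - F x.
  rewrite (le_trans _ (G _))//; last by lra.
  rewrite ler_wpM2l ?powR_ge0//.
  have := @ln_sub1_le R ((x - h) / x) (divr_gt0 u0 x0).
  have -> : ln ((x - h) / x) = - ln (x / (x - h)).
    by rewrite -[in RHS]invf_div lnV ?posrE ?divr_gt0// opprK.
  by rewrite mulrBl divff ?gt_eqF//; lra.
have : (- h)^-1 * (F (x - h) - F x) <= - (amp x / x).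
  rewrite invrN mulNr lerN2 ler_pdivlMl//.
  by rewrite (le_trans _ G)// mulrA [h * amp x]mulrC mulrA.
by lra.
Qed.

(** The alternative on [k] and [p] enters here. In both cases ell^p is bounded by a power p' < 1 of
    L = ln (1/t), hence by a small multiple of L up to a constant. *)
Lemma ell_powR_le (C p : R) : 0 <= C -> 0 < p -> (0 < k)%N \/ p < 1 ->
  exists2 D, 0 <= D & forall t, 0 < t -> t <= t0 -> C * ell t `^ p <= ln t^-1 / 4 + D.
Proof.
move=> C0 p0 kp.
have [c [p' [c0 p1 H]]] : exists c p', [/\ 0 <= c, p' < 1 &
    forall t, 0 < t -> t <= t0 -> ell t `^ p <= c * ln t^-1 `^ p'].
  case: kp => [k0|p1]; last first.
    exists 1, p; split => // t tp tt; rewrite mul1r.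
    rewrite ge0_ler_powR ?nnegrE ?(ltW p0)//.
    - by rewrite (le_trans ler01)// ell_ge1.
    - by rewrite (le_trans ler01)// ln_inv_ge1.
    - rewrite /ell iterSr; apply: iter_ln_le_id.
      exact: ((ln_chain_succ _ _).1 (chain_inv tp tt)).2.
  (* For k > 0, ell <= ln L <= 2 p L^(1/(2p)), and taking p-th powers gives p' = 1/2. *)
  exists ((2 * p) `^ p), (2^-1); split; [exact: powR_ge0|lra|move=> t tp tt].
  have L1 := ln_inv_ge1 tp tt; have L0 : 0 < ln t^-1 by exact: lt_le_trans L1.
  have el : ell t <= ln (ln t^-1).
    have := chain_inv tp tt; rewrite /ell -(prednK k0) => ck.
    rewrite !iterSr; apply: iter_ln_le_id.
    exact: ((ln_chain_succ _ _).1 ((ln_chain_succ _ _).1 ck).2).2.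
  have e0 : 0 <= ell t by rewrite (le_trans ler01)// ell_ge1.
  have lnL : ln (ln t^-1) <= 2 * p * ln t^-1 `^ (2 * p)^-1.
    have p20 : 0 < 2 * p by rewrite mulr_gt0.
    have := ln_le_id (powR_gt0 (2 * p)^-1 L0); rewrite ln_powR.
    by rewrite ler_pdivrMl.
  have -> : ln t^-1 `^ 2^-1 = (ln t^-1 `^ (2 * p)^-1) `^ p.
    by rewrite -powRrM; congr powR; field; rewrite gt_eqF.
  rewrite -powRM ?mulr_ge0 ?powR_ge0 ?(ltW p0)//.
  rewrite ge0_ler_powR ?nnegrE ?(ltW p0) ?mulr_ge0 ?powR_ge0 ?(ltW p0)//.
  exact: le_trans lnL.
have Cc0 : 0 <= C * c by rewrite mulr_ge0.
pose K := 4 * (C * c) + 1; have K0 : 0 < K by rewrite /K ltr_wpDl// mulr_ge0.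
have q0 : 0 < 1 - p' by rewrite subr_gt0.
pose L1 := K `^ (1 - p')^-1.
(* Covers L below the threshold [L1]; the maximum with 0 keeps the power monotone, as only p' < 1 is
   recorded. *)
exists (C * c * Num.max 1 L1 `^ Num.max 0 p'); first by rewrite mulr_ge0// powR_ge0.
move=> t tp tt; have L1' := ln_inv_ge1 tp tt; have L0 : 0 < ln t^-1 by exact: lt_le_trans L1'.
apply: (@le_trans _ _ (C * c * ln t^-1 `^ p')).
  by rewrite -mulrA ler_wpM2l// H.
have [LL|LL] := leP L1 (ln t^-1).
  rewrite -[leLHS]addr0 lerD//; last by rewrite mulr_ge0// powR_ge0.
  have KL : K <= ln t^-1 `^ (1 - p').
    have -> : K = L1 `^ (1 - p') by rewrite /L1 -powRrM mulVf ?gt_eqF// powRr1// ltW.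
    by rewrite ge0_ler_powR ?nnegrE ?(ltW q0) ?(ltW L0) ?powR_ge0.
  have LE : ln t^-1 = ln t^-1 `^ p' * ln t^-1 `^ (1 - p').
    by rewrite -powRD ?(gt_eqF L0) ?implybT// subrKC powRr1// ltW.
  rewrite ler_pdivlMr// [leRHS]LE mulrAC [leRHS]mulrC ler_wpM2r ?powR_ge0//.
  by rewrite (le_trans _ KL)// /K; lra.
rewrite -[leLHS]add0r lerD ?divr_ge0 ?(ltW L0)// ler_wpM2l//.
apply: (@le_trans _ _ (ln t^-1 `^ Num.max 0 p')).
  by rewrite ler_powR// le_max lexx orbT.
rewrite ge0_ler_powR ?nnegrE ?(ltW L0)//; first by rewrite le_max lexx.
- by rewrite le_max ler01.
- by rewrite le_max (ltW LL) orbT.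
Qed.

Lemma ell_powR_absorb (C p : R) : 0 <= C -> 0 < p -> (0 < k)%N \/ p < 1 ->
  exists2 D, 0 <= D & forall t r, 0 < t -> t <= r -> r <= t0 ->
    C * ell t `^ p - ln (r / t) / 2 <= D + C * 2 `^ p * ell r `^ p.
Proof.
move=> C0 p0 kp; have [D D0 DP] := ell_powR_le C0 p0 kp.
exists D => // t r tp tr rt; have r0 := lt_le_trans tp tr; have tt := le_trans tr rt.
have lnr := ln_inv_ge1 r0 rt; have lnt := ln_inv_ge1 tp tt.
have er := ell_ge1 r0 rt; have et := ell_ge1 tp tt.
have E := ln_ratioE tp r0.
have P0 : 0 <= C * 2 `^ p * ell r `^ p by rewrite !mulr_ge0// powR_ge0.
(* If ln (1/t) > 2 ln (1/r), then ln (r/t) exceeds half of ln (1/t), so ln (r/t) / 2 pays for the ln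
   (1/t) / 4 of [ell_powR_le]. *)
have [h|h] := leP (ln t^-1) (2 * ln r^-1).
  have ee : ell t <= 2 * ell r.
    have := ell_ratio tp tr rt; have lr0 : 0 < ln r^-1 by exact: lt_le_trans lnr.
    move=> /le_trans/(_ (ler_wpM2l (le_trans ler01 er) h)).
    by rewrite mulrA ler_pM2r// mulrC.
  have : C * ell t `^ p <= C * 2 `^ p * ell r `^ p.
    rewrite -mulrA ler_wpM2l// -powRM ?(le_trans ler01 er)//.
    by rewrite ge0_ler_powR ?nnegrE ?(ltW p0) ?mulr_ge0 ?(le_trans ler01 er) ?(le_trans ler01 et).
  have : 0 <= ln (r / t) by rewrite E subr_ge0 ln_inv_le.
  by move: (ln (r / t)) => z; lra.
have := DP t tp tt; rewrite E.
by move: (C * ell t `^ p) P0 => z; move: (C * 2 `^ p * ell r `^ p) => y; lra.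
Qed.

End Geometry.

(** * Integrals of nonnegative functions *)

Section Integration.
Local Open Scope ereal_scope.

Lemma ge0_le_integral_nonmeas d (T : measurableType d) (R : realType)
    (mu : {measure set T -> \bar R}) (D : set T) (f g : T -> \bar R) :
  (forall x, D x -> 0 <= f x) -> (forall x, D x -> f x <= g x) ->
  \int[mu]_(x in D) f x <= \int[mu]_(x in D) g x.
Proof.
move=> f0 fg; have g0 x : D x -> 0 <= g x by move=> Dx; rewrite (le_trans (f0 _ Dx)) ?fg.
rewrite !ge0_integralE//; apply: le_ereal_sup => _ [h hf <-]; exists h => // x.
by rewrite (le_trans (hf x))// lee_restrict.
Qed.

(** Meant for integrands singular at an end: the fundamental theorem is applied on compact
    subintervals, and monotone convergence needs only a bound on the increments of [F]. *)
Lemma ge0_integral_oo_le (R : realType) (f F : R -> R) (a b C : R) : (a < b)%R ->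
  (forall x, a < x < b -> 0 <= f x)%R ->
  (forall x, (a < x < b)%R -> {for x, continuous f}) ->
  (forall x, (a < x < b)%R -> is_derive x 1%R F (f x)) ->
  (forall u v, a < u -> u < v -> v < b -> F v - F u <= C)%R ->
  \int[@lebesgue_measure R]_(x in `]a, b[) (f x)%:E <= C%:E.
Proof.
move=> ab f0 fc dF FC.
(* At most a third of the length, so that each [E n] is a nondegenerate interval. *)
pose e n : R := ((b - a) / n.+3%:R)%R.
have ba0 : (0 < b - a)%R by rewrite subr_gt0.
have e0 n : (0 < e n)%R by rewrite divr_gt0.
have e3 n : (e n * 3 <= b - a)%R.
  by rewrite /e mulrAC ler_pdivrMr// ler_wpM2l ?(ltW ba0)// ler_nat.
have eab n : (a + e n < b - e n)%R by have := e3 n; have := e0 n; lra.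
pose E n : set (measurableTypeR R) := `[(a + e n)%R, (b - e n)%R]%classic.
have Esub n x : E n x -> (a < x < b)%R.
  by rewrite /E/= in_itv/= => /andP[h1 h2]; have := e0 n; lra.
have -> : `]a, b[%classic = (\bigcup_n E n)%classic.
  apply/seteqP; split => [x|x [n _ /Esub]]; last by rewrite /= in_itv.
  rewrite /= in_itv/= => /andP[ax xb].
  pose d : R := Num.min (x - a)%R (b - x)%R.
  have d0 : (0 < d)%R by rewrite lt_min !subr_gt0 ax.
  have [n nP] : exists n : nat, (b - a < n%:R * d)%R.
    have := archimedean.Num.Theory.truncnS_gt ((b - a) / d).
    by exists (Num.truncn ((b - a) / d)).+1; rewrite -ltr_pdivrMr.
  have ed : (e n <= d)%R.
    rewrite /e ler_pdivrMr// mulrC (le_trans (ltW nP))// ler_wpM2r ?(ltW d0)// ler_nat.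
    by rewrite -addn3 leq_addr.
  exists n => //; rewrite /E/= in_itv/=.
  have : (d <= x - a)%R by rewrite ge_min lexx.
  have : (d <= b - x)%R by rewrite ge_min lexx orbT.
  by lra.
have mE n : measurable (E n) by exact: measurable_itv.
have cE n : {within E n, continuous f}%classic.
  apply: continuous_in_subspaceT => x /set_mem /Esub; exact: fc.
have ndE : nondecreasing_seq E.
  move=> n n' nn'; apply/subsetPset => x; rewrite /E/= !in_itv/= => /andP[h1 h2].
  have : (e n' <= e n)%R.
    by rewrite /e ler_wpM2l ?(ltW ba0)// lef_pV2 ?posrE// ler_nat.
  by lra.
have cvgE := @ge0_nondecreasing_set_cvg_integral _ _ R E (EFin \o f) (@lebesgue_measure R) ndE mE.
apply: (cvge_le _ (cvgE _ _)).
- apply: nearW => n /=; rewrite (@continuous_FTC2 _ f F)//.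
  + by rewrite -EFinB lee_fin FC//; have := e0 n; lra.
  + exact: cE.
  + have dFn x : E n x -> derivable F x 1 by move=> /Esub/dF ?; exact: ex_derive.
    have cF x : E n x -> {for x, continuous F}.
      by move=> /dFn ?; apply: differentiable_continuous; exact/derivable1_diffP.
    split.
    * by move=> x /subset_itv_oo_cc xE; apply: dFn.
    * by apply: cvg_at_right_filter; apply: cF; rewrite /E/= in_itv/= lexx/= ltW.
    * by apply: cvg_at_left_filter; apply: cF; rewrite /E/= in_itv/= lexx andbT ltW.
  + move=> x /subset_itv_oo_cc xE; have := dF x (Esub n x xE) => ?.
    by rewrite derive1E derive_val.
- move=> n; apply/measurable_EFinP.
  by apply: subspace_continuous_measurable_fun; [exact: mE|exact: cE].
- by move=> n x /Esub xab /=; rewrite lee_fin f0.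
Qed.

Lemma is_derive_powR_subl (R : realType) (b q x : R) : (0 < b - x)%R ->
  is_derive x 1%R (fun u : R => (b - u) `^ q)%R (- (q * (b - x) `^ (q - 1)))%R.
Proof.
move=> bx; apply: is_derive_eq.
  apply: (@is_derive1_comp _ (fun y : R => y `^ q)%R (fun u : R => b - u)%R).
  exact: is_derive1_powR.
by rewrite add0r mul1r mulrN mulr1.
Qed.

Lemma is_derive_powR_subr (R : realType) (a q x : R) : (0 < x - a)%R ->
  is_derive x 1%R (fun u : R => (u - a) `^ q)%R (q * (x - a) `^ (q - 1))%R.
Proof.
move=> bx; apply: is_derive_eq.
  apply: (@is_derive1_comp _ (fun y : R => y `^ q)%R (fun u : R => u - a)%R).
  exact: is_derive1_powR.
by rewrite oppr0 addr0 mulr1.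
Qed.

Lemma integral_powR_end_le (R : realType) (a b p : R) : (a <= b)%R -> (0 < p < 1)%R ->
  \int[@lebesgue_measure R]_(u in `[a, b]) ((b - u) `^ (- p))%:E
    <= ((b - a) `^ (1 - p) / (1 - p))%:E /\
  \int[@lebesgue_measure R]_(u in `[a, b]) ((u - a) `^ (- p))%:E
    <= ((b - a) `^ (1 - p) / (1 - p))%:E.
Proof.
move=> ab /andP[p0 p1]; have q0 : (0 < 1 - p)%R by rewrite subr_gt0.
have [<-|anb] := eqVneq a b.
  have I0 (h : R -> \bar R) : \int[@lebesgue_measure R]_(u in `[a, a]) h u = 0.
    by apply: (@integral_Sset1 _ _ _ a); rewrite set_itv1.
  by rewrite !I0 subrr powR0 ?gt_eqF// mul0r.
have {}ab : (a < b)%R by rewrite lt_neqAle anb.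
have m1 : measurable_fun setT (fun u : R => (b - u) `^ (- p))%R.
  by apply: (measurableT_comp (@measurable_powR R (- p)%R)) => //; exact: measurable_funB.
have m2 : measurable_fun setT (fun u : R => (u - a) `^ (- p))%R.
  by apply: (measurableT_comp (@measurable_powR R (- p)%R)) => //; exact: measurable_funB.
have qV : (1 - p - 1 = - p)%R by ring.
split; rewrite (@integral_itv_bndoo _ a b _ true false).
- apply: (@ge0_integral_oo_le _ _ (fun u => - ((b - u) `^ (1 - p) / (1 - p)))%R) => //.
  + by move=> x _; exact: powR_ge0.
  + move=> x /andP[_ xb]; apply: differentiable_continuous; apply/derivable1_diffP.
    have D : (0 < b - x)%R by rewrite subr_gt0.
    by have D' := is_derive_powR_subl (- p)%R D; exact: ex_derive.
  + move=> x /andP[_ xb].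
    have D0 : (0 < b - x)%R by rewrite subr_gt0.
    have D := is_derive_powR_subl (1 - p)%R D0.
    have -> : (fun u => - ((b - u) `^ (1 - p) / (1 - p)))%R =
       (fun u => - (1 - p)^-1 * (b - u) `^ (1 - p))%R.
      by apply/funext => u; rewrite mulNr mulrC.
    apply: is_derive_eq; rewrite qV /GRing.scale/=.
    by field; rewrite gt_eqF.
  + move=> u v au uv vb; rewrite opprK addrC.
    rewrite (@le_trans _ _ ((b - u) `^ (1 - p) / (1 - p))%R)//.
      by rewrite gerDl oppr_le0 divr_ge0 ?powR_ge0 ?ltW.
    rewrite ler_pM2r ?invr_gt0// ge0_ler_powR ?nnegrE ?(ltW q0)//; lra.
- by apply/measurable_EFinP; apply: measurable_funTS.
- apply: (@ge0_integral_oo_le _ _ (fun u => ((u - a) `^ (1 - p) / (1 - p)))%R) => //.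
  + by move=> x _; exact: powR_ge0.
  + move=> x /andP[ax _]; apply: differentiable_continuous; apply/derivable1_diffP.
    have D : (0 < x - a)%R by rewrite subr_gt0.
    by have D' := is_derive_powR_subr (- p)%R D; exact: ex_derive.
  + move=> x /andP[ax _].
    have D0 : (0 < x - a)%R by rewrite subr_gt0.
    have D := is_derive_powR_subr (1 - p)%R D0.
    have -> : (fun u => ((u - a) `^ (1 - p) / (1 - p)))%R =
       (fun u => (1 - p)^-1 * (u - a) `^ (1 - p))%R.
      by apply/funext => u; rewrite mulrC.
    apply: is_derive_eq; rewrite qV /GRing.scale/=.
    by field; rewrite gt_eqF.
  + move=> u v au uv vb.
    rewrite (@le_trans _ _ ((v - a) `^ (1 - p) / (1 - p))%R)//.
      by rewrite gerDl oppr_le0 divr_ge0 ?powR_ge0 ?ltW.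
    rewrite ler_pM2r ?invr_gt0// ge0_ler_powR ?nnegrE ?(ltW q0)//; lra.
- by apply/measurable_EFinP; apply: measurable_funTS.
Qed.

End Integration.

(** * Measurable sets and rectangles in the plane *)

Section Plane.
Context {R : realType}.
Local Open Scope classical_set_scope.

(** An open set is a union of boxes with rational centre and radius, which are countably many and
    measurable for the product sigma-algebra. *)
Lemma box_open_measurable (B : set (plane (R := R))) :
  (forall q, B q -> exists2 e : R, 0 < e &
     forall q', `|q'.1 - q.1| < e -> `|q'.2 - q.2| < e -> B q') ->
  measurable B.
Proof.
move=> Bo.
pose box (a b e : R) : set (plane (R := R)) := `]a - e, a + e[ `*` `]b - e, b + e[.
have boxE a b e q : box a b e q <-> `|q.1 - a| < e /\ `|q.2 - b| < e.
  by rewrite /box/= !in_itv/= !ltr_distl; split.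
pose G (a b e : rat) := if pselect (box (ratr a) (ratr b) (ratr e) `<=` B)
  then box (ratr a) (ratr b) (ratr e) else set0.
have -> : B = \bigcup_a \bigcup_b \bigcup_e G a b e.
  apply/seteqP; split => [q Bq|q [a _ [b _ [e _]]]]; last first.
    by rewrite /G; case: pselect => // h /h.
  have [d d0 dP] := Bo q Bq.
  have [e] := @rat_in_itvoo R (d / 4) (d / 2) ltac:(lra).
  rewrite in_itv/= => /andP[e1 e2].
  have e0 : 0 < ratr e :> R by rewrite (lt_trans _ e1)// divr_gt0.
  have [a] := @rat_in_itvoo R (q.1 - ratr e) (q.1 + ratr e) ltac:(lra).
  rewrite in_itv/= => /andP[a1 a2].
  have [b] := @rat_in_itvoo R (q.2 - ratr e) (q.2 + ratr e) ltac:(lra).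
  rewrite in_itv/= => /andP[b1 b2].
  have qb : box (ratr a) (ratr b) (ratr e) q.
    by apply/boxE; rewrite !ltr_distl; split; lra.
  exists a => //; exists b => //; exists e => //; rewrite /G; case: pselect => // nb.
  exfalso; apply: nb => q' /boxE; rewrite !ltr_distl => -[/andP[h1 h2] /andP[h3 h4]].
  by apply: dP; rewrite ltr_distl; lra.
have mG a b e : measurable (G a b e).
  by rewrite /G; case: pselect => h //=; exact: measurableX.
do 3 (apply: bigcupT_measurable_rat => ?); exact: mG.
Qed.

Lemma leb2_rect (a b c d : R) : a <= b -> c <= d ->
  leb2 (`]a, b[ `*` `]c, d[ : set (plane (R := R))) = ((b - a) * (d - c))%:E.
Proof.
have := @product_measure1E _ _ _ _ R (@lebesgue_measure R) (@lebesgue_measure R)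
  `]a, b[ `]c, d[ (measurable_itv _) (measurable_itv _).
rewrite /leb2/= => ->.
move=> ab cd; rewrite !lebesgue_measure_itv/= !lte_fin.
have [_|ba] := ltP a b; have [_|dc] := ltP c d; rewrite ?mul0e ?mule0 -?EFinB -?EFinM//.
- suff -> : d = c by rewrite subrr mulr0.
  by apply/eqP; rewrite eq_le cd dc.
- suff -> : b = a by rewrite subrr mul0r.
  by apply/eqP; rewrite eq_le ab ba.
- suff -> : b = a by rewrite subrr mul0r.
  by apply/eqP; rewrite eq_le ab ba.
Qed.

End Plane.

(** * Areas of balls and the size of the kernel *)

Section Profile.
Context {R : realType} (k : nat) (sigma t0 : R) (f : R -> R).
Hypotheses (sigma0 : 0 < sigma) (t00 : 0 < t0) (t0k : ln_chain_ge_e k.+1 t0^-1).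
Hypothesis f0 : f 0 = 0.
Hypothesis fE : forall x, 0 < `|x| <= t0 -> f x = expR (- F_geom k.+1 sigma `|x|).
Implicit Types (t u w x : R) (p q : plane (R := R)).
Local Open Scope classical_set_scope.

Notation F := (F_geom k.+1 sigma).
Notation amp := (amp k sigma).

Lemma profileE x : 0 < x -> x <= t0 -> f x = expR (- F x).
Proof. by move=> x0 xt; rewrite fE gtr0_norm// x0. Qed.

Lemma profile_gt0 x : 0 < `|x| -> `|x| <= t0 -> 0 < f x.
Proof. by move=> x0 xt; rewrite fE ?expR_gt0// x0. Qed.

Lemma profile_pos x : 0 < x -> x <= t0 -> 0 < f x.
Proof. by move=> x0 xt; rewrite profileE// expR_gt0. Qed.

Lemma F_geom_le u w : 0 < u -> u <= w -> w <= t0 -> F w <= F u.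
Proof.
move=> u0 uw wt; have w0 := lt_le_trans u0 uw; rewrite -subr_ge0.
rewrite (le_trans _ (F_geom_sub_ge sigma0 t00 t0k u0 uw wt))// mulr_ge0 ?powR_ge0//.
by rewrite ln_ge0// ler_pdivlMr// mul1r.
Qed.

Lemma profile_le u w : 0 < u -> u <= w -> w <= t0 -> f u <= f w.
Proof.
move=> u0 uw wt; have w0 := lt_le_trans u0 uw.
rewrite (profileE w0 wt) (profileE u0 (le_trans uw wt)) ler_expR lerN2.
exact: F_geom_le.
Qed.

Lemma profile_norm_le x w : `|x| <= w -> w <= t0 -> 0 < w -> `|f x| <= f w.
Proof.
move=> xw wt w0; have [->|x0] := eqVneq x 0; first by rewrite f0 normr0 ltW// profile_pos.
have xp : 0 < `|x| by rewrite normr_gt0.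
have xt : 0 < `|x| <= t0 by rewrite xp (le_trans xw).
rewrite (fE xt) (ger0_norm (expR_ge0 _)) (profileE w0 wt) ler_expR lerN2.
exact: F_geom_le.
Qed.

(** So [f] changes by a bounded factor over a length u / amp u, the order of 1/|F'(u)|. *)
Lemma profile_le_expR u w : 0 < u -> u <= w -> w <= t0 ->
  f w <= f u * expR ((1 + sigma) * amp u * ((w - u) / u)).
Proof.
move=> u0 uw wt; have w0 := lt_le_trans u0 uw; have ut := le_trans uw wt.
rewrite (profileE u0 ut) (profileE w0 wt) -expRD ler_expR.
have H := F_geom_sub_le sigma0 t00 t0k u0 uw wt.
have : (1 + sigma) * amp u * ln (w / u) <= (1 + sigma) * amp u * ((w - u) / u).
  rewrite ler_wpM2l ?mulr_ge0 ?powR_ge0 ?addr_ge0 ?(ltW sigma0)//.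
  by rewrite mulrBl divff ?gt_eqF// ln_sub1_le// divr_gt0.
lra.
Qed.

(** The ball is open. As [f] vanishes on the axis, vertical motion at [q] may be impossible, so the
    path shifts to a nearby column [a] off the axis, moves vertically there and returns. *)
Lemma cball_measurable p r : `|p.1| + r <= t0 -> measurable (cball f p r).
Proof.
move=> prt; apply: box_open_measurable => q; rewrite /cball/= => qr.
have q1 : `|q.1| < t0.
  have := le_lt_trans (cdist_ge f p q) qr; rewrite lte_fin => h.
  by rewrite (lt_le_trans _ prt)// -ltrBlDl (le_lt_trans _ h)// (le_trans _ (ler_dist_dist _ _))// ler_norm.
have dfin : cdist f p q \is a fin_num by rewrite ge0_fin_numE ?cdist_ge0// (lt_trans qr) ?ltry.
pose d := fine (cdist f p q); have dE : cdist f p q = d%:E by rewrite fineK.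
have dr : d < r by rewrite -lte_fin -dE.
(* The path costs at most 4 s: s to reach the column, s vertically and 2 s to return. *)
pose s := (r - d) / 8; have s0 : 0 < s by rewrite divr_gt0 ?subr_gt0.
pose h := Num.min s (t0 - `|q.1|).
have h0 : 0 < h by rewrite lt_min s0 subr_gt0.
have hs : h <= s by rewrite ge_min lexx.
have ht : h <= t0 - `|q.1| by rewrite ge_min lexx orbT.
have [a [aq a0 at0]] : exists a, [/\ `|a - q.1| <= h, 0 < `|a| & `|a| <= t0].
  have [q0|q0] := leP 0 q.1.
    exists (q.1 + h); have qh0 : 0 <= q.1 + h by lra.
    rewrite addrAC subrr add0r (gtr0_norm h0) (ger0_norm qh0).
    by move: ht; rewrite (ger0_norm q0); split; lra.
  exists (q.1 - h); have qh0 : q.1 - h < 0 by lra.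
  rewrite addrAC subrr add0r normrN (gtr0_norm h0) (ltr0_norm qh0).
  by move: ht; rewrite (ltr0_norm q0); split; lra.
have fa := profile_gt0 a0 at0.
exists (Num.min s (s * f a)); first by rewrite lt_min s0 mulr_gt0.
move=> q'; rewrite !lt_min => /andP[h1 _] /andP[_ h2].
have D1 := cdist_hmove f p q a.
have D2 := @cdist_vmove _ f p (a, q.2) q'.2 fa.
have D3 := cdist_hmove f p (a, q'.2) q'.1; rewrite /= -surjective_pairing in D2 D3.
rewrite (le_lt_trans D3)// (le_lt_trans (leeD2r _ D2))// (le_lt_trans (leeD2r _ (leeD2r _ D1)))//.
rewrite dE -!EFinD lte_fin.
have e2 : `|q'.2 - q.2| / f a < s by rewrite ltr_pdivrMr.
have e3 : `|q'.1 - a| <= `|q'.1 - q.1| + `|a - q.1|.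
  by rewrite (distrC a q.1); exact: ler_distD.
by move: aq e2 e3 h1 hs; rewrite /s; lra.
Qed.

Lemma cdist_rect_lt p (a y : R) : 0 < f a -> (cdist f p (a, y) <= (`|a - p.1| + `|y - p.2| / f a)%:E)%E.
Proof.
move=> fa; have D1 := cdist_hmove f p p a.
have := @cdist_vmove _ f p (a, p.2) y fa; move=> /le_trans; apply.
by rewrite EFinD leeD2r// (le_trans D1)// cdistpp add0e.
Qed.

Definition area_cst : R := expR ((1 + sigma) * 2 `^ sigma) * 8.

Lemma area_cst_ge1 : 1 <= area_cst.
Proof.
rewrite /area_cst -[leLHS](mulr1 1) ler_pM//; last by lra.
by rewrite -[leLHS]expR0 ler_expR mulr_ge0 ?powR_ge0// addr_ge0// ltW.
Qed.

(** Near its right end w = p.1 + d the ball contains a rectangle of width e / 2 and height f(u) e,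
    where e = d / (2 amp w) and u = w - e. There f(w) <= exp ((1 + sigma) 2^sigma) f(u); with the 8
    coming from e^2 / 2 this makes up [area_cst]. *)
Lemma cball_area_ge p (d : R) : 0 <= p.1 -> 0 < d -> p.1 + d <= t0 ->
  ((f (p.1 + d) * d ^+ 2 / (area_cst * amp (p.1 + d) ^+ 2))%:E <= leb2 (cball f p d))%E.
Proof.
move=> p0 d0 wt; set w := p.1 + d; have w0 : 0 < w by rewrite ltr_wpDl.
have A1 := amp_ge1 sigma0 t00 t0k w0 wt; have A0 : 0 < amp w by exact: lt_le_trans A1.
pose e := d / (2 * amp w).
have e0 : 0 < e by rewrite divr_gt0// mulr_gt0.
have ed : e <= d / 2.
  rewrite /e ler_wpM2l ?(ltW d0)// lef_pV2 ?posrE ?mulr_gt0//; lra.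
have dw : d <= w by rewrite lerDr.
pose u := w - e.
have uw2 : w / 2 <= u by rewrite /u; lra.
have u0 : 0 < u by rewrite (lt_le_trans _ uw2)// divr_gt0.
have uw : u <= w by rewrite /u; lra.
have ut : u <= t0 by exact: le_trans wt.
have fu0 := profile_pos u0 ut.
pose h := f u * (e / 2).
have h0 : 0 < h by rewrite mulr_gt0// divr_gt0.
have sub : (`](u : R), (u + e / 2)[ `*` `]p.2 - h, p.2 + h[ : set (plane (R := R))) `<=` cball f p d.
  move=> [a y] [/=]; rewrite !in_itv/= => /andP[a1 a2] y12; rewrite /cball/=.
  have a0 : 0 < a by exact: lt_trans a1.
  have aw : a <= w by move: a2; rewrite /u; lra.
  have fua : f u <= f a by rewrite profile_le// ?(ltW a1) ?(le_trans aw).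
  have fa0 : 0 < f a by exact: lt_le_trans fua.
  rewrite (le_lt_trans (cdist_rect_lt _ _ fa0))// lte_fin/=.
  have yh : `|y - p.2| < h by rewrite ltr_distl.
  have yf : `|y - p.2| / f a < e / 2.
    rewrite ltr_pdivrMr// (lt_le_trans yh)// /h mulrC ler_wpM2l// ltW// divr_gt0//.
  have ap : 0 <= a - p.1 by move: a1 ed; rewrite /u /w; lra.
  have a3 : a - p.1 < d - e / 2 by move: a2; rewrite /u /w; lra.
  by rewrite (ger0_norm ap); lra.
have mB : measurable (cball f p d) by apply: cball_measurable; rewrite ger0_norm.
apply: (@le_trans _ _ (leb2 (`]u, (u + e / 2)[ `*` `]p.2 - h, p.2 + h[ : set (plane (R := R))))); last first.
  by apply: le_measure => //; rewrite inE//; exact: measurableX.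
rewrite leb2_rect; [|lra..].
rewrite lee_fin.
have -> : (u + e / 2 - u) * (p.2 + h - (p.2 - h)) = f u * (e ^+ 2 / 2).
  by rewrite /h; field.
have fw : f w <= f u * expR ((1 + sigma) * 2 `^ sigma).
  rewrite (le_trans (profile_le_expR u0 uw wt))// ler_wpM2l ?(ltW fu0)// ler_expR.
  rewrite -[leLHS]mulrA ler_wpM2l ?addr_ge0 ?(ltW sigma0)//.
  have Au : amp u <= 2 `^ sigma * amp w.
    rewrite (le_trans _ (amp_half sigma0 t00 t0k w0 wt))//.
    by rewrite (amp_le sigma0 t00 t0k)// divr_gt0.
  have B : (w - u) / u <= (amp w)^-1.
    rewrite ler_pdivrMr// /u opprB subrKC ler_pdivlMl//.
    have : amp w * e = d / 2 by rewrite /e; field; rewrite gt_eqF.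
    by move=> ->; move: uw2; rewrite /u; lra.
  rewrite (le_trans (ler_pM _ _ Au B)) ?powR_ge0//.
    by rewrite divr_ge0 ?(ltW u0)// subr_ge0.
  by rewrite -mulrA divff ?mulr1 ?gt_eqF.
rewrite /area_cst ler_pdivrMr ?mulr_gt0 ?expR_gt0 ?exprn_gt0//.
have -> : f u * (e ^+ 2 / 2) * (expR ((1 + sigma) * 2 `^ sigma) * 8 * amp w ^+ 2)
   = f u * expR ((1 + sigma) * 2 `^ sigma) * d ^+ 2.
  by rewrite /e; field; rewrite gt_eqF.
by rewrite ler_wpM2r// sqr_ge0.
Qed.

Lemma cball_origin_sub r q : 0 < r -> r <= t0 -> cball f origin r q ->
  `|q.1| < r /\ `|q.2| <= f r * r.
Proof.
move=> r0 rt qr; split.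
  have := le_lt_trans (cdist_ge f origin q) qr; rewrite lte_fin/= subr0//.
have [_ [s [s0 [gx [gy [su g0 <-]]]] <-]] := ereal_inf_lt qr.
rewrite lte_fin => sr; case: g0 => gx0 gy0 /=.
have fr0 := profile_pos r0 rt.
rewrite -[gy s]subr0 -gy0 (le_trans (subunit_y_le su s0 (ltW fr0) _))//.
  move=> t /andP[tp ts]; apply: profile_norm_le => //.
  rewrite -[gx t]subr0 -gx0 (le_trans (subunit_x_le su (ltW tp) (ltW ts)))//.
  by rewrite ltW// (lt_trans ts).
by rewrite ler_wpM2l ?ltW.
Qed.

Lemma cball_origin_area_le r : 0 < r -> r <= t0 ->
  (leb2 (cball f origin r) <= (8 * r ^+ 2 * f r)%:E)%E.
Proof.
move=> r0 rt; have fr0 := profile_pos r0 rt.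
have rr : 0 < f r * r by rewrite mulr_gt0.
pose Q : set (plane (R := R)) := `]- r, r[ `*` `]- (2 * (f r * r)), 2 * (f r * r)[.
apply: (@le_trans _ _ (leb2 Q)).
  apply: le_measure; rewrite ?inE.
  - by apply: cball_measurable; rewrite normr0 add0r.
  - exact: measurableX.
  - move=> q /(cball_origin_sub r0 rt)[h1 h2]; rewrite /Q/= !in_itv/= -!ltr_norml.
    by split => //; rewrite (le_lt_trans h2)//; lra.
by rewrite leb2_rect; [rewrite lee_fin; nra|lra..].
Qed.

(** The path goes to the column [r], where vertical motion is fastest, spends time at most 2 r
    moving vertically, and comes back. *)
Lemma cdist_le_4r p q r : 0 < r -> r <= t0 -> 0 <= p.1 -> p.1 <= r -> 0 <= q.1 -> q.1 <= r ->
  `|p.2| <= f r * r -> `|q.2| <= f r * r -> (cdist f p q <= (4 * r)%:E)%E.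
Proof.
move=> r0 rt p0 pr q0 qr p2 q2; have fr0 := profile_pos r0 rt.
have D := cdist_rect_lt p q.2 fr0.
have := cdist_hmove f p (r, q.2) q.1; rewrite /= -surjective_pairing => /le_trans; apply.
rewrite (le_trans (leeD2r _ D))// -EFinD lee_fin.
have h : `|q.2 - p.2| / f r <= 2 * r.
  by rewrite ler_pdivrMr// (le_trans (ler_normB _ _))//; lra.
rewrite (@ger0_norm _ (r - p.1)) ?subr_ge0// (@ler0_norm _ (q.1 - r)) ?subr_le0//.
by lra.
Qed.

(** Combines dhat <= d with the area bound at w = p.1 + d, then replaces w by q.1 <= w and d by q.1
    - p.1 <= d, which only enlarges the bound. The hypothesis 5 r <= t0 keeps w <= r + 4 r in the
    range of the profile. *)
Lemma kernel_le p q r : 0 < r -> 5 * r <= t0 -> 0 < p.1 -> p.1 < q.1 -> q.1 <= r ->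
  `|p.2| <= f r * r -> `|q.2| <= f r * r ->
  dhat f F p q / fine (leb2 (cball f p (fine (cdist f p q))))
   <= area_cst * amp q.1 ^+ 2 / (f q.1 * (q.1 - p.1)).
Proof.
move=> r0 rt p0 pq qr p2 q2; have rt' : r <= t0 by lra.
have q0 : 0 < q.1 by exact: lt_trans pq.
have d4 : (cdist f p q <= (4 * r)%:E)%E.
  by apply: (cdist_le_4r r0 rt') => //; [exact: ltW|exact: le_trans (ltW pq) _|exact: ltW].
have dfin : cdist f p q \is a fin_num.
  by rewrite ge0_fin_numE ?cdist_ge0// (le_lt_trans d4) ?ltry.
set d := fine (cdist f p q); have dE : cdist f p q = d%:E by rewrite fineK.
have d4r : d <= 4 * r by rewrite -lee_fin -dE.
have dge : q.1 - p.1 <= d.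
  rewrite -lee_fin -dE (le_trans _ (cdist_ge f p q))// lee_fin ler_norm//.
have pq0 : 0 < q.1 - p.1 by rewrite subr_gt0.
have d0 : 0 < d by exact: lt_le_trans dge.
pose w := p.1 + d; have w0 : 0 < w by rewrite addr_gt0.
have wt : w <= t0 by rewrite /w; lra.
have qw : q.1 <= w by rewrite /w; lra.
have qt := le_trans qw wt.
have C0 : 0 < area_cst by rewrite (lt_le_trans ltr01) ?area_cst_ge1.
have Aw : 1 <= amp w := amp_ge1 sigma0 t00 t0k w0 wt.
have Aq : 1 <= amp q.1 := amp_ge1 sigma0 t00 t0k q0 qt.
have fq0 := profile_pos q0 qt; have fw0 := profile_pos w0 wt.
have dh0 : 0 <= dhat f F p q by rewrite /dhat le_min (ltW d0)//= invr_ge0.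
have dhd : dhat f F p q <= d by rewrite /dhat ge_min lexx.
have RHS0 : 0 <= area_cst * amp q.1 ^+ 2 / (f q.1 * (q.1 - p.1)).
  have N0 : 0 <= area_cst * amp q.1 ^+ 2 := mulr_ge0 (ltW C0) (sqr_ge0 _).
  have D0 : 0 <= f q.1 * (q.1 - p.1) := mulr_ge0 (ltW fq0) (ltW pq0).
  exact: divr_ge0.
have LB := cball_area_ge (ltW p0) d0 wt; rewrite -/w in LB.
(* For an infinite area [fine] returns 0, and then the quotient is 0 as well. *)
have [Bfin|Binf] := boolP (leb2 (cball f p d) \is a fin_num); last first.
  suff -> : fine (leb2 (cball f p d)) = 0 by rewrite invr0 mulr0.
  by move: Binf; rewrite fin_numE negb_and !negbK => /orP[] /eqP ->.
have {}LB : f w * d ^+ 2 / (area_cst * amp w ^+ 2) <= fine (leb2 (cball f p d)).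
  by rewrite -lee_fin fineK.
have Aw0 : 0 < amp w by exact: lt_le_trans Aw.
have LB0 : 0 < f w * d ^+ 2 / (area_cst * amp w ^+ 2).
  exact: divr_gt0 (mulr_gt0 fw0 (exprn_gt0 2 d0)) (mulr_gt0 C0 (exprn_gt0 2 Aw0)).
apply: (@le_trans _ _ (d / (f w * d ^+ 2 / (area_cst * amp w ^+ 2)))).
  apply: ler_pM; [exact: dh0|by rewrite invr_ge0 (le_trans (ltW LB0))|exact: dhd|].
  by rewrite lef_pV2 ?posrE// (lt_le_trans LB0).
have -> : d / (f w * d ^+ 2 / (area_cst * amp w ^+ 2)) = area_cst * amp w ^+ 2 / (f w * d).
  by field; rewrite !gt_eqF.
apply: ler_pM.
- exact: mulr_ge0 (ltW C0) (sqr_ge0 _).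
- by rewrite invr_ge0 mulr_ge0 ?(ltW fw0) ?(ltW d0).
- rewrite ler_wpM2l ?(ltW C0)// ler_pXn2r ?nnegrE ?powR_ge0//.
  exact: (amp_le sigma0 t00 t0k).
- rewrite lef_pV2 ?posrE ?mulr_gt0//; apply: ler_pM => //; [exact: ltW..|].
  exact: profile_le.
Qed.

End Profile.

(** * The slices of the region Gamma *)

Section MeasurableGeometry.
Context {R : realType}.

Lemma ln_invE (t : R) : ln t^-1 = - ln t.
Proof.
have [t0|t0] := ltP 0 t; first by rewrite lnV ?posrE.
by rewrite !ln0 ?oppr0// invr_le0.
Qed.

Lemma measurable_iter_ln n : measurable_fun [set: R] (iter n (@ln R)).
Proof.
elim: n => [|n IH]; first exact: measurable_id.
exact: (measurableT_comp (@measurable_ln R) IH).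
Qed.

Lemma measurable_iter_ln_inv n : measurable_fun [set: R] (fun t => iter n.+1 (@ln R) t^-1).
Proof.
under eq_fun do rewrite iterSr ln_invE.
apply: (measurableT_comp (measurable_iter_ln n)).
exact: measurableT_comp (@measurable_ln R).
Qed.

Lemma measurable_amp n (s : R) : measurable_fun [set: R] (amp n s).
Proof. exact: (measurableT_comp (@measurable_powR R s) (measurable_iter_ln_inv n)). Qed.

Lemma measurable_F_geom n (s : R) : measurable_fun [set: R] (F_geom n.+1 s).
Proof.
apply: measurable_funM; first exact: (measurable_iter_ln_inv 0).
exact: measurable_amp.
Qed.

End MeasurableGeometry.

Section Slices.
Context {R : realType} (k : nat) (sigma t0 : R) (f : R -> R).
Hypotheses (sigma0 : 0 < sigma) (t00 : 0 < t0) (t0k : ln_chain_ge_e k.+1 t0^-1).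
Hypothesis f0 : f 0 = 0.
Hypothesis fE : forall x, 0 < `|x| <= t0 -> f x = expR (- F_geom k.+1 sigma `|x|).
Implicit Types (t u w x : R) (p q : plane (R := R)).
Local Open Scope classical_set_scope.

Notation F := (F_geom k.+1 sigma).
Notation amp := (amp k sigma).
Notation leb := (@lebesgue_measure R).

Lemma profile_measurable a b : 0 < a -> b <= t0 -> measurable_fun `[a, b] f.
Proof.
move=> a0 bt.
apply: (@eq_measurable_fun _ _ _ _ _ (fun x => expR (- F x))).
  move=> x /set_mem/=; rewrite in_itv/= => /andP[ax xb].
  by rewrite (profileE fE)// ?(lt_le_trans a0) ?(le_trans xb).
apply: measurable_funTS; apply: measurableT_comp; first exact: measurable_expR.
exact: measurableT_comp (measurable_F_geom _ _).
Qed.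

(** From F(u) - F(w) >= ln (w/u) >= (w - u) / w one gets f(w)^2 - f(u)^2 >= f(u)^2 (w - u) / w. At u
    = w the left side is 0, since dividing by 0 yields 0. *)
Lemma hstar_integrand_le u w : 0 < u -> u <= w -> w <= t0 ->
  f u ^+ 2 / Num.sqrt (f w ^+ 2 - f u ^+ 2) <=
  f w * Num.sqrt w * (w - u) `^ (- 2^-1).
Proof.
move=> u0 uw wt; have w0 := lt_le_trans u0 uw; have ut := le_trans uw wt.
have fu := profile_pos fE u0 ut; have fw := profile_pos fE w0 wt.
have fuw := profile_le sigma0 t00 t0k fE u0 uw wt.
have RHS0 : 0 <= f w * Num.sqrt w * (w - u) `^ (- 2^-1).
  by rewrite !mulr_ge0 ?powR_ge0 ?sqrtr_ge0 ?(ltW fw).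
have [wu|nwu] := eqVneq u w; first by rewrite [X in _ / X](_ : _ = 0) ?invr0 ?mulr0// wu subrr sqrtr0.
have {}uw : u < w by rewrite lt_neqAle nwu.
have wu0 : 0 < w - u by rewrite subr_gt0.
have G : (w - u) / w <= F u - F w.
  rewrite (le_trans _ (F_geom_sub_ge sigma0 t00 t0k u0 (ltW uw) wt))//.
  have h : (w - u) / w <= ln (w / u).
    have := @ln_sub1_le R (u / w) (divr_gt0 u0 w0).
    have -> : ln (u / w) = - ln (w / u) by rewrite -invf_div lnV ?posrE ?divr_gt0.
    by rewrite mulrBl divff ?gt_eqF//; lra.
  rewrite (le_trans h)// ler_peMl ?(amp_ge1 sigma0 t00 t0k)//.
  by rewrite (le_trans _ h)// divr_ge0// ltW.
have low : f u ^+ 2 * ((w - u) / w) <= f w ^+ 2 - f u ^+ 2.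
  have -> : f w = f u * expR (F u - F w).
    by rewrite (profileE fE u0 ut) (profileE fE w0 wt) -expRD; congr expR; ring.
  have E : 1 + (w - u) / w <= expR (F u - F w).
    by rewrite (le_trans _ (expR_ge1Dx _))// lerD2l.
  have -> : (f u * expR (F u - F w)) ^+ 2 - f u ^+ 2 = f u ^+ 2 * (expR (F u - F w) ^+ 2 - 1).
    by move: (expR _) => z; ring.
  rewrite ler_wpM2l ?sqr_ge0//.
  have q0 : 0 <= (w - u) / w by rewrite divr_ge0// ltW.
  move: E q0; move: ((w - u) / w) (expR _) => z e h1 h2.
  by rewrite expr2; nra.
have sq : f u * Num.sqrt ((w - u) / w) <= Num.sqrt (f w ^+ 2 - f u ^+ 2).
  rewrite -[X in X * _](@ger0_norm _ (f u)) ?(ltW fu)// -sqrtr_sqr -sqrtrM ?sqr_ge0//.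
  by rewrite ler_wsqrtr.
have sp : 0 < Num.sqrt ((w - u) / w) by rewrite sqrtr_gt0 divr_gt0.
apply: (@le_trans _ _ (f u ^+ 2 / (f u * Num.sqrt ((w - u) / w)))).
  rewrite ler_wpM2l ?sqr_ge0// lef_pV2 ?posrE ?mulr_gt0//.
  by rewrite (lt_le_trans _ sq)// mulr_gt0.
have -> : f u ^+ 2 / (f u * Num.sqrt ((w - u) / w)) = f u * (Num.sqrt w * (w - u) `^ (- 2^-1)).
  rewrite sqrtrM ?(ltW wu0)// sqrtrV ?(ltW w0)// powRN powR12_sqrt ?(ltW wu0)//.
  by field; rewrite !gt_eqF// sqrtr_gt0.
by rewrite -mulrA ler_wpM2r ?mulr_ge0 ?sqrtr_ge0 ?powR_ge0.
Qed.

Lemma Rintegral_le_nonmeas (D : set R) (h h' : R -> R) (C : R) :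
  (forall u, D u -> 0 <= h u) -> (forall u, D u -> h u <= h' u) ->
  (\int[leb]_(u in D) (h' u)%:E <= C%:E)%E -> \int[leb]_(u in D) h u <= C.
Proof.
move=> h0 hh hC; rewrite /Rintegral.
have I0 : (0 <= \int[leb]_(u in D) (h u)%:E)%E by apply: integral_ge0 => u Du; rewrite lee_fin h0.
have IC : (\int[leb]_(u in D) (h u)%:E <= C%:E)%E.
  apply: le_trans hC; apply: ge0_le_integral_nonmeas => u Du; rewrite lee_fin; [exact: h0|exact: hh].
by rewrite -lee_fin fineK// ge0_fin_numE// (le_lt_trans IC) ?ltry.
Qed.

Lemma hstar_le x t : 0 < x -> 0 <= t -> x + t <= t0 ->
  hstar f x t <= 2 * f (x + t) * Num.sqrt ((x + t) * t).
Proof.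
move=> x0 tp wt; set w := x + t; have w0 : 0 < w by rewrite ltr_wpDr.
have xw : x <= w by rewrite lerDl.
have fw := profile_pos fE w0 wt.
apply: (@Rintegral_le_nonmeas _ _ (fun u => f w * Num.sqrt w * (w - u) `^ (- 2^-1))).
- by move=> u _; rewrite divr_ge0 ?sqr_ge0 ?sqrtr_ge0.
- move=> u /=; rewrite in_itv/= => /andP[xu uw]; apply: hstar_integrand_le => //.
  exact: lt_le_trans xu.
have K0 : 0 <= f w * Num.sqrt w by rewrite mulr_ge0 ?sqrtr_ge0 ?(ltW fw).
under eq_integral do rewrite EFinM.
rewrite ge0_integralZl//=; last 2 first.
- apply/measurable_EFinP; apply: measurable_funTS.
  apply: (measurableT_comp (@measurable_powR R (- 2^-1))) => //.
  exact: measurable_funB.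
- by move=> ? _; rewrite lee_fin powR_ge0.
have half : 0 < (2^-1 : R) < 1.
  by apply/andP; split; [rewrite invr_gt0|rewrite invf_lt1// ltr1n].
have [H _] := @integral_powR_end_le R x w 2^-1 xw half.
apply: le_trans (lee_wpmul2l _ H) _; first by rewrite lee_fin.
rewrite -EFinM lee_fin.
have -> : 1 - 2^-1 = 2^-1 :> R by lra.
have -> : w - x = t by rewrite /w addrAC subrr add0r.
rewrite powR12_sqrt// invrK sqrtrM ?(ltW w0)//; lra.
Qed.

(** The value 0 is the default when the defining equation has no solution; by [hstar0] it makes the
    second kind of slice in [Eset] empty. *)
Lemma rstarP x r : rstar f x r = 0 \/
  0 < rstar f x r < r /\ r = \int[leb]_(u in `[x, x + rstar f x r])
          (f (x + rstar f x r) / Num.sqrt (f (x + rstar f x r) ^+ 2 - f u ^+ 2)).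
Proof. by rewrite /rstar; case: xgetP => [y _ []|]; [right|left]. Qed.

Lemma hstar0 x : hstar f x 0 = 0.
Proof.
rewrite /hstar /Rintegral addr0.
by rewrite (@integral_Sset1 _ _ _ x) ?set_itv1.
Qed.

(** The integrand of [hstar] is at most f(w) times that of the equation defining [rstar], whose
    integral is r. *)
Lemma hstar_rstar_le x r : 0 < x -> 0 < r -> x + r <= t0 -> rstar f x r != 0 ->
  [/\ 0 < rstar f x r, rstar f x r < r & hstar f x (rstar f x r) <= f (x + rstar f x r) * r].
Proof.
move=> x0 r0 xrt; have [->|[/andP[s0 sr] rE] _] := rstarP x r; first by rewrite eqxx.
split => //; set s := rstar f x r in s0 sr rE *; set w := x + s.
have w0 : 0 < w by rewrite addr_gt0.
have wt : w <= t0 by rewrite (le_trans _ xrt)// lerD2l ltW.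
have fw := profile_pos fE w0 wt.
have fu_le u : `[x, w] u -> 0 < f u /\ f u <= f w.
  rewrite /= in_itv/= => /andP[xu uw]; have u0 := lt_le_trans x0 xu.
  split; first by rewrite (profile_pos fE)// (le_trans uw).
  exact: (profile_le sigma0 t00 t0k fE).
pose g u := f w / Num.sqrt (f w ^+ 2 - f u ^+ 2).
have g0 u : 0 <= g u by rewrite divr_ge0 ?sqrtr_ge0 ?(ltW fw).
have I0 : (0 <= \int[leb]_(u in `[x, w]) (g u)%:E)%E.
  by apply: integral_ge0 => u _; rewrite lee_fin.
have IE : (\int[leb]_(u in `[x, w]) (g u)%:E = r%:E)%E.
  (* An infinite integral would have real value 0, against r > 0. *)
  rewrite rE /Rintegral fineK//; apply/negPn/negP => nfin.
  have : r = 0.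
    rewrite rE /Rintegral; move: nfin; rewrite fin_numE negb_and !negbK.
    by move=> /orP[] /eqP ->.
  by move=> r00; move: r0; rewrite r00 ltxx.
apply: (@Rintegral_le_nonmeas _ _ (fun u => f w * g u)).
- by move=> u _; rewrite divr_ge0 ?sqr_ge0 ?sqrtr_ge0.
- move=> u /fu_le[fu0 fu]; rewrite /g mulrA ler_wpM2r ?invr_ge0 ?sqrtr_ge0//.
  by rewrite expr2 ler_pM// ltW.
under eq_integral do rewrite EFinM.
rewrite ge0_integralZl//=; last 3 first.
- apply/measurable_EFinP; apply: measurable_funM; first exact: measurable_cst.
  apply: (@eq_measurable_fun _ _ _ _ _ (fun u => (f w ^+ 2 - f u ^+ 2) `^ (- 2^-1))).
    move=> u /set_mem/fu_le[fu0 fu]; rewrite powRN powR12_sqrt// subr_ge0.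
    by rewrite ler_pXn2r ?nnegrE// ltW.
  apply: (measurableT_comp (@measurable_powR R (- 2^-1))).
  apply: measurable_funB => //.
  apply: measurable_funX; exact: profile_measurable.
- by move=> u _; rewrite lee_fin.
- by rewrite lee_fin ltW.
by rewrite IE -EFinM lee_fin.
Qed.

Lemma rho_bounds x r n : 0 <= r -> 0 <= rho f F x r n <= r.
Proof.
move=> r0; elim: n => [|n /andP[h1 h2]]/=; first by rewrite r0 lexx.
case: ifP => _; last by rewrite divr_ge0//=; lra.
by have [->|[/andP[s0 sr] _]] := rstarP x (rho f F x r n); rewrite ?lexx ?r0// ltW//= (le_trans (ltW sr)).
Qed.

Definition slice_cst : R := 2 * expR (1 + sigma).

(** For s >= 1/|F'(p.1)|, [hstar_le] applies directly. For smaller s, one has q.1 - p.1 >= s / 2 and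
    s < p.1 / amp p.1, so the value of f at p.1 + rstar is at most exp (1 + sigma) f(q.1). *)
Lemma slice_le p q r : 0 < p.1 -> p.1 <= r -> 0 < r -> 3 * r <= t0 -> q.1 <= r ->
  Gamma f F p r q ->
  p.1 < q.1 /\ `|q.2 - p.2| < slice_cst * f q.1 * Num.sqrt ((q.1 - p.1) * q.1).
Proof.
move=> p0 pr r0 rt qr [n _]; rewrite /Eset/=.
set s := rho f F p.1 r n.
have /andP[s0 sr] : 0 <= s <= r by apply: rho_bounds; exact: ltW.
have e1 : 1 <= expR (1 + sigma).
  by rewrite -[leLHS]expR0 ler_expR addr_ge0// ltW.
case: ifPn => [Fs|]; last rewrite -ltNge => sF.
- have /andP[s'0 _] : 0 <= rho f F p.1 r n.+1 <= r by apply: rho_bounds; exact: ltW.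
  move: s'0; rewrite /= -/s Fs => s'0 [/andP[h1 h2] h3].
  have tp : 0 <= q.1 - p.1 by rewrite subr_ge0 (le_trans _ h1)// lerDl.
  have pq : p.1 < q.1.
    rewrite -subr_gt0 lt_neqAle tp andbT; apply/eqP => t0'.
    by move: h3; rewrite -t0' hstar0 ltNge normr_ge0.
  split => //; rewrite (lt_le_trans h3)//.
  have q0 := lt_trans p0 pq.
  have := @hstar_le p.1 (q.1 - p.1) p0 tp; rewrite subrKC => /(_ _)/le_trans; apply.
    by rewrite (le_trans qr)//; lra.
  rewrite [(q.1 - p.1) * _]mulrC ler_wpM2r ?sqrtr_ge0// /slice_cst.
  have := profile_pos fE q0; rewrite (le_trans qr) ?(le_trans _ rt)//; last by lra.
  by move=> /(_ isT) fq; rewrite ler_wpM2r ?(ltW fq)// ler_peMr.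
- move=> -[/andP[h1 h2] h3].
  have sp : 0 < s by rewrite lt_neqAle s0 andbT; apply/eqP => s00; move: h1 h2; rewrite -s00; lra.
  have pq : p.1 < q.1 by lra.
  have q0 := lt_trans p0 pq.
  have tq : 0 < q.1 - p.1 by rewrite subr_gt0.
  split => //; rewrite (lt_le_trans h3)//.
  have [r'0|r'n] := eqVneq (rstar f p.1 s) 0.
    by move: h3; rewrite r'0 hstar0 ltNge normr_ge0.
  have [|r'p r's H] := hstar_rstar_le p0 sp _ r'n; first by lra.
  rewrite (le_trans H)//; set r' := rstar f p.1 s in r'p r's H *.
  have qt : q.1 <= t0 by rewrite (le_trans qr)//; lra.
  have fq := profile_pos fE q0 qt.
  have pt : p.1 <= t0 by rewrite (le_trans pr)//; lra.
  have sA : s < p.1 / amp p.1.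
    rewrite (lt_le_trans sF)// -invf_div lef_pV2 ?posrE.
    - exact: (F_geom_derive1 sigma0 t00 t0k).
    - rewrite (lt_le_trans _ (F_geom_derive1 sigma0 t00 t0k p0 pt))//.
      by rewrite divr_gt0// (lt_le_trans ltr01) ?(amp_ge1 sigma0 t00 t0k).
    - by rewrite divr_gt0// (lt_le_trans ltr01) ?(amp_ge1 sigma0 t00 t0k).
  have fr' : f (p.1 + r') <= expR (1 + sigma) * f q.1.
    have [r'q|qr'] := leP (p.1 + r') q.1.
      rewrite (le_trans (profile_le sigma0 t00 t0k fE _ r'q qt)) ?addr_gt0//.
      by rewrite ler_peMl// ltW.
    have wt : p.1 + r' <= t0 by lra.
    rewrite (le_trans (profile_le_expR sigma0 t00 t0k fE q0 (ltW qr') wt))//.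
    rewrite mulrC ler_wpM2r ?(ltW fq)// ler_expR -mulrA ler_piMr ?addr_ge0 ?(ltW sigma0)//.
    have Aq := amp_ge1 sigma0 t00 t0k q0 qt; have Ap := amp_ge1 sigma0 t00 t0k p0 pt.
    have Aqp := amp_le sigma0 t00 t0k p0 (ltW pq) qt.
    have Ap0 : 0 < amp p.1 by exact: lt_le_trans Ap.
    rewrite mulrA ler_pdivrMr// mul1r (le_trans _ (ltW pq))//.
    rewrite (@le_trans _ _ (amp p.1 * s))//.
      by rewrite ler_pM ?powR_ge0// ?subr_ge0 ?(ltW qr')//; lra.
    by move: sA; rewrite ltr_pdivlMr// mulrC => /ltW.
  have tsq : q.1 - p.1 <= Num.sqrt ((q.1 - p.1) * q.1).
    rewrite -[leLHS](@ger0_norm _ (q.1 - p.1)) ?(ltW tq)// -sqrtr_sqr ler_wsqrtr// expr2.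
    by rewrite ler_wpM2l ?(ltW tq)//; lra.
  apply: (@le_trans _ _ (expR (1 + sigma) * f q.1 * (2 * (q.1 - p.1)))).
    rewrite ler_pM ?(ltW sp)//; last by lra.
    by rewrite ltW// (profile_pos fE)// ?addr_gt0//; lra.
  have K0 : 0 <= expR (1 + sigma) * f q.1 by rewrite mulr_ge0 ?expR_ge0 ?(ltW fq).
  by rewrite /slice_cst; have := ler_wpM2l K0 tsq; lra.
Qed.

End Slices.

(** * Splitting the kernel *)

Section Core.
Context {R : realType} (m M : R).
Hypotheses (m1 : 1 < m) (M1 : 1 < M).
Context d (T : measurableType d) (mu : {sigma_finite_measure set T -> \bar R}).
(** [Gh] is a positive majorant of the norm [G], which may be 0; it is let tend to [G] at the
    end. *)
Variables (K Z : T * T -> R) (g : T -> R) (G Gh beta vol : R).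
Hypotheses (K0 : forall z, 0 <= K z) (mK : measurable_fun setT K).
Hypotheses (Z0 : forall z, 0 <= Z z) (mZ : measurable_fun setT Z).
Hypotheses (g0 : forall y, 0 <= g y) (mg : measurable_fun setT g).
Hypotheses (beta0 : 0 < beta) (Gh0 : 0 < Gh) (GGh : G <= Gh) (vol0 : 0 <= vol).
Hypothesis intg : (\int[mu]_y (g y)%:E = G%:E)%E.
Hypothesis KZ : forall z w, 0 < w ->
  K z * Gh * Psi_ratio m M w <= w / 2 * Psi_ratio m M w + Z z * Psi M m beta / 2.
Hypothesis intZ : forall y, (\int[mu]_x (Z (x, y))%:E <= vol%:E)%E.

Local Open Scope ereal_scope.

Let J x := \int[mu]_y (Z (x, y) * (g y / Gh))%:E.

Let J0 x : 0 <= J x.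
Proof.
by apply: integral_ge0 => y _; rewrite lee_fin mulr_ge0// divr_ge0// ltW.
Qed.

Let mZg : measurable_fun setT (fun z : T * T => (Z z * (g z.2 / Gh))%:E).
Proof.
apply/measurable_EFinP; apply: measurable_funM => //.
by apply: measurable_funM => //; apply: measurableT_comp.
Qed.

Let mJ : measurable_fun setT J.
Proof.
apply: (measurable_fun_fubini_tonelli_F (fun z : T * T => (Z z * (g z.2 / Gh))%:E)) => //.
by move=> z; rewrite lee_fin mulr_ge0// divr_ge0// ltW.
Qed.

Let mK1 x : measurable_fun setT (fun y => K (x, y)).
Proof. exact: measurableT_comp. Qed.

Let mZ1 x : measurable_fun setT (fun y => Z (x, y)).
Proof. exact: measurableT_comp. Qed.

Let Psi_le_J x (w : R) : (0 < w)%R -> w%:E <= \int[mu]_y (K (x, y) * g y)%:E ->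
  (Psi M m w)%:E <= (Psi M m beta)%:E * J x.
Proof.
move=> w0 wK; have rw0 := Psi_ratio_gt0 m1 M1 w0; have Pb0 := Psi_gt0 m1 M1 beta0.
have [->|Joo] := eqVneq (J x) +oo; first by rewrite gt0_muley ?lte_fin// leey.
have Jfin : J x \is a fin_num by rewrite ge0_fin_numE// lt_neqAle Joo leey.
have wG0 : (0 <= w / 2 * Psi_ratio m M w / Gh)%R.
  by rewrite divr_ge0 ?(ltW Gh0)// mulr_ge0 ?(ltW rw0)// divr_ge0 ?(ltW w0).
have P20 : (0 <= Psi M m beta / 2)%R by rewrite divr_ge0// ltW.
have E1 : (Psi_ratio m M w)%:E * (\int[mu]_y (K (x, y) * g y)%:E) <=
    (w / 2 * Psi_ratio m M w / Gh)%:E * G%:E + (Psi M m beta / 2)%:E * J x.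
  rewrite -ge0_integralZl//; last 3 first.
  - by apply/measurable_EFinP; exact: measurable_funM.
  - by move=> y _; rewrite lee_fin mulr_ge0.
  - by rewrite lee_fin ltW.
  rewrite -intg -ge0_integralZl//; last 2 first.
  - exact/measurable_EFinP.
  - by move=> y _; rewrite lee_fin.
  rewrite /J -ge0_integralZl//; last 2 first.
  - by apply/measurable_EFinP; apply: measurable_funM => //; exact: measurable_funM.
  - by move=> y _; rewrite lee_fin mulr_ge0// divr_ge0// ltW.
  rewrite -ge0_integralD//; last 4 first.
  - by move=> y _; rewrite -EFinM lee_fin mulr_ge0.
  - by apply/measurable_EFinP; exact: measurable_funM.
  - by move=> y _; rewrite -EFinM lee_fin mulr_ge0// mulr_ge0// divr_ge0// ltW.
  - by apply/measurable_EFinP; apply: measurable_funM => //; apply: measurable_funM => //; exact: measurable_funM.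
  apply: ge0_le_integral_nonmeas => y _.
    by rewrite -EFinM lee_fin mulr_ge0 ?(ltW rw0)// mulr_ge0.
  rewrite -!EFinM -EFinD lee_fin.
  have := ler_wpM2r (divr_ge0 (g0 y) (ltW Gh0)) (KZ (x, y) w0).
  by congr (_ <= _)%R; field; rewrite gt_eqF.
have E2 : (Psi_ratio m M w)%:E * w%:E <= (Psi_ratio m M w)%:E * (\int[mu]_y (K (x, y) * g y)%:E).
  by rewrite lee_wpmul2l// lee_fin ltW.
have := le_trans E2 E1; rewrite -(fineK Jfin) -!EFinM -EFinD !lee_fin (@PsiE _ m M _ w0).
set r := Psi_ratio m M w in rw0 wG0 *; set P := Psi M m beta; set j := fine _.
have : (w / 2 * r / Gh * G <= w / 2 * r)%R.
  have q0 : (0 <= w / 2 * r)%R by rewrite mulr_ge0 ?(ltW rw0)// divr_ge0 ?(ltW w0).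
  by rewrite -[leRHS]mulr1 -mulrA ler_wpM2l// mulrC ler_pdivrMr// mul1r.
move=> h1 h2; lra.
Qed.

Let Psi_op_le_J x (v : \bar R) : 0 <= v -> v <= \int[mu]_y (K (x, y) * g y)%:E ->
  er_map (Psi M m) v <= (Psi M m beta)%:E * J x.
Proof.
have Pb0 := Psi_gt0 m1 M1 beta0.
case: v => [v v0 vK| _ vK|//] /=.
  move: v0; rewrite lee_fin le_eqVlt => /predU1P[<-|v0].
    by rewrite Psi0 mule_ge0// lee_fin ltW.
  exact: Psi_le_J.
(* If the operator is infinite at [x], every positive real w is admissible, and Psi w >= w Psi_ratio
   1 for w >= 1 forces J = +oo. *)
rewrite leye_eq; apply/eqP/eqyP => A A0.
pose w := (A / Psi_ratio m M 1 + 1)%R.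
have r1 := Psi_ratio_gt0 m1 M1 (@ltr01 R).
have w0 : (0 < w)%R by rewrite /w addr_gt0// divr_gt0.
apply: le_trans (Psi_le_J w0 _); last by rewrite (le_trans _ vK)// leey.
rewrite lee_fin (@PsiE _ m M _ w0) (@le_trans _ _ (w * Psi_ratio m M 1)%R)//.
  by rewrite /w mulrDl divfK ?gt_eqF// lerDl mul1r ltW.
rewrite ler_wpM2l ?(ltW w0)// (Psi_ratio_ndecr m1 M1)// /w lerDr divr_ge0 ?(ltW r1)//.
exact: ltW.
Qed.

Lemma Psi_operator_le (c : {nonneg R}) (B : set T) (Op : T -> \bar R) : measurable B ->
  (forall x, B x -> 0 <= Op x /\ Op x <= \int[mu]_y (K (x, y) * g y)%:E) ->
  \int[mscale c mu]_(x in B) er_map (Psi M m) (Op x)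
    <= (c%:num * (Psi M m beta * vol))%:E.
Proof.
move=> mB OpK; have Pb0 := Psi_gt0 m1 M1 beta0.
apply: (@le_trans _ _ (\int[mscale c mu]_(x in B) ((Psi M m beta)%:E * J x))).
  apply: ge0_le_integral_nonmeas => x Bx; last first.
    by have [v0 vK] := OpK x Bx; exact: Psi_op_le_J.
  have [+ _] := OpK x Bx; case: (Op x) => [v|//|//]; rewrite /= !lee_fin le_eqVlt => /predU1P[<-|v0].
    by rewrite Psi0.
  by rewrite ltW// Psi_gt0.
rewrite ge0_integral_mscale//; last 2 first.
- by apply: measurable_funTS; exact: measurable_funeM.
- by move=> x _; rewrite mule_ge0// lee_fin ltW.
rewrite EFinM lee_wpmul2l ?lee_fin//.
rewrite ge0_integralZl//; last 2 first.
- exact: measurable_funTS.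
- by rewrite lee_fin ltW.
rewrite EFinM lee_wpmul2l ?lee_fin ?(ltW Pb0)//.
apply: (@le_trans _ _ (\int[mu]_x J x)).
  by apply: ge0_subset_integral.
rewrite /J (@fubini_tonelli _ _ _ _ _ mu mu (fun z : T * T => (Z z * (g z.2 / Gh))%:E))//=; last first.
  by move=> z; rewrite lee_fin mulr_ge0// divr_ge0// ltW.
apply: (@le_trans _ _ (\int[mu]_y ((vol / Gh)%:E * (g y)%:E))).
  apply: ge0_le_integral_nonmeas => y _.
    by apply: integral_ge0 => x _; rewrite lee_fin mulr_ge0// divr_ge0// ltW.
  under eq_integral do rewrite mulrC EFinM.
  rewrite ge0_integralZl//; last 3 first.
  - by apply/measurable_EFinP; apply: measurableT_comp.
  - by move=> x _; rewrite lee_fin.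
  - by rewrite lee_fin divr_ge0// ltW.
  rewrite (le_trans (lee_wpmul2l _ (intZ y)))//; first by rewrite lee_fin divr_ge0// ltW.
  by rewrite -!EFinM lee_fin mulrAC [leRHS]mulrAC [(vol * _)%R]mulrC.
rewrite ge0_integralZl//; last 3 first.
- exact/measurable_EFinP.
- by move=> y _; rewrite lee_fin.
- by rewrite lee_fin divr_ge0// ltW.
rewrite intg -EFinM lee_fin -mulrA ler_piMr// mulrC ler_pdivrMr// mul1r//.
Qed.

End Core.

Section KernelPointwise.
Context {R : realType} (m M : R).
Hypotheses (m1 : 1 < m) (M1 : 1 < M).

(** If w >= 2 K Gh, the first term on the right suffices. Otherwise w < Q beta, and monotonicity of
    [Psi_ratio] with [Psi_ratioM] compares its values at w and beta. *)
Lemma Psi_kernel_split (K Z Gh beta Q lam w : R) : 0 <= K -> 0 < Gh -> 0 < beta -> 1 <= Q ->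
  1 <= lam -> 2 * K * Gh <= Q * beta ->
  2 * K * Gh * (Psi_slope m M * (Q `^ lam^-1 * expR (defect_cst m * lam `^ (m - 1)))) <= Z * beta ->
  0 < w ->
  K * Gh * Psi_ratio m M w <= w / 2 * Psi_ratio m M w + Z * Psi M m beta / 2.
Proof.
move=> K0 Gh0 b0 Q1 l1 KQ KZ w0.
have rw0 := Psi_ratio_gt0 m1 M1 w0; have rb0 := Psi_ratio_gt0 m1 M1 b0.
have S1 := Psi_slope_ge1 m1 M1.
have KG0 : 0 <= 2 * K * Gh by rewrite !mulr_ge0// ltW.
have Zb0 : 0 <= Z * beta.
  apply: le_trans KZ; rewrite mulr_ge0// mulr_ge0 ?(le_trans ler01 S1)//.
  by rewrite mulr_ge0 ?powR_ge0 ?expR_ge0.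
have [h|h] := leP (2 * K * Gh) w.
  have A : K * Gh * Psi_ratio m M w <= w / 2 * Psi_ratio m M w.
    by rewrite ler_wpM2r ?(ltW rw0)//; lra.
  rewrite (le_trans A)// lerDl divr_ge0// (@PsiE _ m M _ b0) mulrA mulr_ge0 ?(ltW rb0)//.
have A1 : Psi_ratio m M w <= Psi_ratio m M (Q * beta).
  by apply: (Psi_ratio_ndecr m1 M1) => //; rewrite (le_trans (ltW h)).
have A2 := Psi_ratioM m1 M1 Q1 b0 l1.
have A3 := le_trans A1 A2.
have A4 := ler_wpM2l KG0 A3.
have A5 := ler_wpM2r (ltW rb0) KZ.
rewrite (@PsiE _ m M _ b0).
have A6 : 0 <= w / 2 * Psi_ratio m M w by rewrite mulr_ge0 ?(ltW rw0)// divr_ge0 ?(ltW w0).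
have : 2 * K * Gh * Psi_ratio m M w <= Z * beta * Psi_ratio m M beta.
  by apply: le_trans A4 _; rewrite [leLHS]mulrA.
move: A6; move: (Psi_ratio m M w) => r A6.
have -> : 2 * K * Gh * r = 2 * (K * Gh * r) by ring.
by move=> A7; lra.
Qed.

End KernelPointwise.

(** * The majorant of the kernel *)

Section Majorant.
Context {R : realType} (k : nat) (sigma t0 : R) (f : R -> R) (r : R).
Hypotheses (sigma0 : 0 < sigma) (t00 : 0 < t0) (t0k : ln_chain_ge_e k.+1 t0^-1).
Hypothesis f0 : f 0 = 0.
Hypothesis fE : forall x, 0 < `|x| <= t0 -> f x = expR (- F_geom k.+1 sigma `|x|).
Hypotheses (r0 : 0 < r) (rt : 5 * r <= t0).
Local Open Scope classical_set_scope.

Notation F := (F_geom k.+1 sigma).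
Notation amp := (amp k sigma).
Notation plane := (plane (R := R)).
Implicit Types (p q : plane) (z : plane * plane) (U : R -> R) (e : R).

(* Here z = (x, y). Absolute values treat both half-planes at once, since the
   kernel at x.1 < 0 is the reflected one. *)
Definition gap z : R := `|z.2.1| - `|z.1.1|.

(** Written with expR (- F) rather than [f], which is unconstrained far from 0, so as to be
    measurable on the whole plane. *)
Definition near_slice z : bool :=
  [&& `|z.1.1| < `|z.2.1|, `|z.2.1| < r &
   `|z.2.2 - z.1.2| < slice_cst sigma * expR (- F `|z.2.1|) * (gap z * `|z.2.1|) `^ 2^-1].

(** Serves twice: with [kernel_coef] and e = 1 as majorant of the kernel, with [weight] and e = 5/4
    as Z. *)
Definition sliced U e z : R := if near_slice z then U `|z.2.1| * gap z `^ (- e) else 0.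

Definition kernel_coef (a : R) : R := area_cst sigma * amp a ^+ 2 * expR (F a).

Lemma measurable_norm_fst_fst : measurable_fun setT (fun z : plane * plane => `|z.1.1|).
Proof.
apply: measurableT_comp => //; apply: (measurableT_comp measurable_fst); exact: measurable_fst.
Qed.

Lemma measurable_norm_snd_fst : measurable_fun setT (fun z : plane * plane => `|z.2.1|).
Proof.
apply: measurableT_comp => //; apply: (measurableT_comp measurable_fst); exact: measurable_snd.
Qed.

Lemma measurable_gap : measurable_fun setT gap.
Proof.
by apply: measurable_funB; [exact: measurable_norm_snd_fst|exact: measurable_norm_fst_fst].
Qed.

Lemma measurable_near_slice : measurable_fun setT near_slice.
Proof.
have m21 := measurable_norm_snd_fst; have m11 := measurable_norm_fst_fst.
apply: measurable_and; first exact: measurable_fun_ltr.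
apply: measurable_and; first exact: measurable_fun_ltr.
apply: measurable_fun_ltr.
- apply: measurableT_comp => //; apply: measurable_funB.
  + by apply: (measurableT_comp measurable_snd); exact: measurable_snd.
  + by apply: (measurableT_comp measurable_snd); exact: measurable_fst.
- apply: measurable_funM.
  + apply: measurable_funM => //; apply: measurableT_comp; first exact: measurable_expR.
    apply: measurableT_comp => //.
    exact: (measurableT_comp (measurable_F_geom k sigma) m21).
  + apply: (measurableT_comp (@measurable_powR R 2^-1)).
    by apply: measurable_funM => //; exact: measurable_gap.
Qed.

Lemma measurable_sliced U e : measurable_fun setT U -> measurable_fun setT (sliced U e).
Proof.
move=> mU; apply: measurable_fun_ifT => //; first exact: measurable_near_slice.
apply: measurable_funM; first exact: (measurableT_comp mU measurable_norm_snd_fst).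
exact: (measurableT_comp (@measurable_powR R (- e)) measurable_gap).
Qed.

Lemma measurable_kernel_coef : measurable_fun setT kernel_coef.
Proof.
apply: measurable_funM; last exact: (measurableT_comp (@measurable_expR R) (measurable_F_geom k sigma)).
by apply: measurable_funM => //; apply: measurable_funX; exact: measurable_amp.
Qed.

Lemma kernel_coef_ge0 a : 0 <= kernel_coef a.
Proof.
rewrite mulr_ge0 ?expR_ge0// mulr_ge0 ?sqr_ge0//.
by rewrite (le_trans ler01)// area_cst_ge1.
Qed.

Lemma sliced_ge0 U e z : (forall a, 0 <= U a) -> 0 <= sliced U e z.
Proof. by move=> U0; rewrite /sliced; case: ifP => // _; rewrite mulr_ge0 ?powR_ge0. Qed.

Lemma kernel_right_ge0 p q : 0 <= kernel_right f F r p q.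
Proof.
apply: mulr_ge0 => //; apply: divr_ge0; last by rewrite fine_ge0.
by rewrite /dhat le_min fine_ge0 ?cdist_ge0//= invr_ge0.
Qed.

Lemma kernelK_ge0 p q : 0 <= kernelK f F r p q.
Proof. by rewrite /kernelK; do 2 (case: ifP => _; rewrite ?kernel_right_ge0//). Qed.

Lemma kernel_right_le p q : 0 < p.1 -> p.1 < r -> `|q.1| < r ->
  `|p.2| <= f r * r -> `|q.2| <= f r * r ->
  kernel_right f F r p q <= sliced kernel_coef 1 (p, q).
Proof.
move=> p0 pr qr p2 q2.
have S0 : 0 <= sliced kernel_coef 1 (p, q) by apply: sliced_ge0; exact: kernel_coef_ge0.
rewrite /kernel_right indicE; have [qG|] := boolP (q \in Gamma f F p r); last by rewrite mulr0.
rewrite mulr1; move/set_mem: qG => qG.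
have qr' : q.1 <= r by rewrite (le_trans (ler_norm _))// ltW.
have r3 : 3 * r <= t0 by rewrite (le_trans _ rt)// ler_wpM2r ?(ltW r0)// ler_nat.
have [pq Hq] := slice_le sigma0 t00 t0k fE p0 (ltW pr) r0 r3 qr' qG.
have q0 : 0 < q.1 by exact: lt_trans pq.
have pa : `|p.1| = p.1 by rewrite gtr0_norm.
have qa : `|q.1| = q.1 by rewrite gtr0_norm.
have qt : q.1 <= t0 by rewrite (le_trans qr')// (le_trans _ rt)// ler_peMl ?(ltW r0)// ler1n.
have fq := profileE fE q0 qt.
have tq : 0 < q.1 - p.1 by rewrite subr_gt0.
have ns : near_slice (p, q).
  rewrite /near_slice /gap/= pa qa pq -{1}qa qr/= powR12_sqrt ?mulr_ge0 ?(ltW tq) ?(ltW q0)//.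
  by rewrite -fq.
rewrite /sliced ns /kernel_coef /gap/= pa qa powR_inv1 ?(ltW tq)//.
rewrite (le_trans (kernel_le sigma0 t00 t0k fE r0 rt p0 pq qr' p2 q2))//.
by rewrite fq invfM expRN invrK mulrA.
Qed.

Lemma kernelK_le p q : cball f origin r p -> cball f origin r q ->
  kernelK f F r p q <= sliced kernel_coef 1 (p, q).
Proof.
have rt' : r <= t0 by rewrite (le_trans _ rt)// ler_peMl ?(ltW r0)// ler1n.
move=> /(cball_origin_sub sigma0 t00 t0k f0 fE r0 rt')[p1 p2].
move=> /(cball_origin_sub sigma0 t00 t0k f0 fE r0 rt')[q1 q2].
rewrite /kernelK; case: ifPn => [p0|_].
  by apply: kernel_right_le => //; rewrite (le_lt_trans (ler_norm _)).
case: ifPn => [p0|_]; last by apply: sliced_ge0; exact: kernel_coef_ge0.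
have -> : sliced kernel_coef 1 (p, q) = sliced kernel_coef 1 (reflect_pt p, reflect_pt q).
  by rewrite /sliced /near_slice /gap/= !normrN.
apply: kernel_right_le => /=; rewrite ?normrN ?oppr_gt0//.
by rewrite (le_lt_trans (ler_norm _))// normrN.
Qed.

Lemma gap_powR_le (a x : R) : `|x| < a ->
  (a - `|x|) `^ (- (3 / 4)) <= (a - x) `^ (- (3 / 4)) + (x - - a) `^ (- (3 / 4)).
Proof.
move=> xa; rewrite opprK; have [x0|x0] := leP 0 x.
  by rewrite ger0_norm// lerDl powR_ge0.
by rewrite ltr0_norm// opprK [x + a]addrC lerDr powR_ge0.
Qed.

(** Integrating over x.2 first contributes a length of order (gap a)^(1/2), leaving gap^(-3/4). The
    constant 32 is 2 for that length, times two endpoint integrals of 4 (2 a)^(1/4) each, with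
    2^(1/4) <= 2. *)
Lemma integral_sliced_le U (q : plane) (C : R) : measurable_fun setT U -> (forall a, 0 <= U a) ->
  (forall a, 0 < a -> a < r -> 32 * slice_cst sigma * U a * expR (- F a) * a `^ (3 / 4) <= C) ->
  0 <= C ->
  (\int[@lebesgue_measure R \x @lebesgue_measure R]_p (sliced U (5 / 4) (p, q))%:E <= C%:E)%E.
Proof.
move=> mU U0 UC C0; set a := `|q.1|.
have [ar|ra] := ltP a r; last first.
  rewrite integral0_eq ?lee_fin// => p _.
  by rewrite /sliced /near_slice/= -/a (ltNge _ r) ra/= andbF.
have [a0|a0] := eqVneq a 0.
  rewrite integral0_eq ?lee_fin// => p _.
  by rewrite /sliced /near_slice/= -/a a0 ltNge normr_ge0.
have ap : 0 < a by rewrite lt_neqAle eq_sym a0 normr_ge0.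
have mS : measurable_fun setT (fun p => (sliced U (5 / 4) (p, q))%:E).
  apply/measurable_EFinP.
  apply: (measurableT_comp (measurable_sliced (5 / 4) mU)).
  exact: measurable_pair2.
rewrite (fubini_tonelli1 (fun p => (sliced U (5 / 4) (p, q))%:E))//=; last first.
  by move=> p; rewrite lee_fin sliced_ge0.
have c0 : 0 <= slice_cst sigma by rewrite /slice_cst mulr_ge0 ?expR_ge0.
pose W := 2 * slice_cst sigma * U a * expR (- F a) * a `^ 2^-1.
have W0 : 0 <= W by rewrite /W !mulr_ge0 ?expR_ge0 ?powR_ge0 ?U0 ?c0.
apply: (@le_trans _ _ (\int[@lebesgue_measure R]_(x in `[(- a)%R, a])
   (W%:E * (((a - x) `^ (- (3 / 4)))%:E + ((x - - a) `^ (- (3 / 4)))%:E)))%E).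
  rewrite [leRHS]integral_mkcond; apply: ge0_le_integral_nonmeas => x _.
    by apply: integral_ge0 => y _; rewrite lee_fin sliced_ge0.
  rewrite /fubini_F patchE; have [xa|ax] := ltP `|x| a; last first.
    rewrite integral0_eq.
      by case: ifP => // _; rewrite mule_ge0 ?adde_ge0 ?lee_fin ?powR_ge0.
    by move=> y _; rewrite /sliced /near_slice/= -/a ltNge ax.
  have xin : x \in `[(- a)%R, a] by rewrite inE/= in_itv/= -ler_norml ltW.
  rewrite xin; pose H := slice_cst sigma * expR (- F a) * ((a - `|x|) * a) `^ 2^-1.
  have H0 : 0 <= H by rewrite /H !mulr_ge0 ?expR_ge0 ?powR_ge0.
  pose V := U a * (a - `|x|) `^ (- (5 / 4)).
  have V0 : 0 <= V by rewrite /V mulr_ge0 ?powR_ge0.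
  have tau0 : 0 < a - `|x| by rewrite subr_gt0.
  rewrite (_ : (fun y => _) = (fun y => V%:E * (\1_`]q.2 - H, q.2 + H[ y)%:E)%E); last first.
    apply/funext => y; rewrite /sliced /near_slice /gap/= -/a xa ar/= -/H indicE.
    have -> : (y \in `]q.2 - H, q.2 + H[) = (`|q.2 - y| < H).
      by rewrite distrC ltr_distl; apply/idP/idP; rewrite inE/= in_itv.
    by case: ifP => _; rewrite ?mule1 ?mule0.
  rewrite ge0_integralZl//=; last by apply/measurable_EFinP; exact: measurable_indic.
  rewrite [X in (V%:E * X)%E](_ : _ = (2 * H)%:E); last first.
    rewrite integral_indic// setIT.
    have := lebesgue_measure_itv `]q.2 - H, q.2 + H[%R; rewrite /= lte_fin.
    case: ifPn => [_ ->|]; first by rewrite -EFinB; congr EFin; ring.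
    rewrite -leNgt => h ->; have -> : H = 0 by apply/eqP; rewrite eq_le H0 andbT; lra.
    by rewrite mulr0.
  rewrite -EFinD -!EFinM lee_fin.
  have -> : V * (2 * H) = W * (a - `|x|) `^ (- (3 / 4)).
    rewrite /V /H /W powRM ?(ltW tau0) ?(ltW ap)//.
    have -> : (a - `|x|) `^ (- (3 / 4)) = (a - `|x|) `^ (- (5 / 4)) * (a - `|x|) `^ 2^-1.
      by rewrite -powRD ?(gt_eqF tau0) ?implybT//; congr powR; field.
    ring.
  by rewrite ler_wpM2l// gap_powR_le.
have mp1 : measurable_fun `[(- a)%R, a] (fun x => ((a - x) `^ (- (3 / 4)))%:E).
  apply/measurable_EFinP; apply: measurable_funTS.
  by apply: (measurableT_comp (@measurable_powR R (- (3 / 4)))) => //; exact: measurable_funB.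
have mp2 : measurable_fun `[(- a)%R, a] (fun x => ((x - - a) `^ (- (3 / 4)))%:E).
  apply/measurable_EFinP; apply: measurable_funTS.
  by apply: (measurableT_comp (@measurable_powR R (- (3 / 4)))) => //; exact: measurable_funB.
rewrite ge0_integralZl//; last 2 first.
- exact: emeasurable_funD.
- by move=> x _; rewrite adde_ge0 ?lee_fin ?powR_ge0.
rewrite ge0_integralD//; last 2 first.
- by move=> x _; rewrite lee_fin powR_ge0.
- by move=> x _; rewrite lee_fin powR_ge0.
have q34 : 0 < (3 / 4 : R) < 1 by apply/andP; split; lra.
have aa : - a <= a by lra.
have [I1 I2] := integral_powR_end_le aa q34.
apply: le_trans (lee_wpmul2l _ (leeD I1 I2)) _; first by rewrite lee_fin.
rewrite -EFinD -EFinM lee_fin (le_trans _ (UC a ap ar))//.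
have -> : (1 - 3 / 4 : R) = 4^-1 by lra.
have -> : a - - a = 2 * a by ring.
rewrite invrK powRM ?(ltW ap)//.
have h2 : 2 `^ 4^-1 <= 2 :> R.
  rewrite -[leRHS](@powRr1 R 2)// ler_powR ?ler1n//; lra.
have aE : a `^ (3 / 4) = a `^ 2^-1 * a `^ 4^-1.
  by rewrite -powRD ?(gt_eqF ap) ?implybT//; congr powR; field.
rewrite aE /W.
have X0 : 0 <= slice_cst sigma * U a * expR (- F a) * a `^ 2^-1 * a `^ 4^-1.
  by rewrite !mulr_ge0 ?expR_ge0 ?powR_ge0.
have := ler_wpM2l X0 h2.
by move: (2 `^ 4^-1) => w; lra.
Qed.

End Majorant.

(** * The choice of lam and the resulting weight *)

Section Weight.
Context {R : realType} (k : nat) (sigma t0 m : R).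
Hypotheses (sigma0 : 0 < sigma) (t00 : 0 < t0) (t0k : ln_chain_ge_e k.+1 t0^-1) (m1 : 1 < m).

Notation F := (F_geom k.+1 sigma).
Notation amp := (amp k sigma).
Notation ell := (ell k).
Notation c1 := (area_cst sigma).

(** The lam of the bound on [Psi_ratio]. The factor 2 (2 + sigma) is what makes the root of
    [quotient_bound] cost only (r/t)^(1/2). *)
Definition exponent_scale (t : R) : R := 2 * (2 + sigma) * amp t.

(** The first term comes from defect_cst lam^(m-1), measured in units of amp^(m-1); the second
    absorbs amp^2, as ln amp <= amp^(m-1) / (m - 1). *)
Definition growth_cst : R :=
  defect_cst m * (2 * (2 + sigma)) `^ (m - 1) + 2 / (m - 1).

(** Bounds 2 K G / beta at |y.1| = t, apart from a factor t / gap. *)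
Definition quotient_bound (r t : R) : R := 16 * c1 * (r / t) * amp t ^+ 2 * expR (F t - F r).

Lemma exponent_scale_ge4 t : 0 < t -> t <= t0 -> 4 <= exponent_scale t.
Proof.
move=> tp tt; have A := amp_ge1 sigma0 t00 t0k tp tt.
have := sigma0; rewrite /exponent_scale; nra.
Qed.

Lemma quotient_bound_ge1 r t : 0 < t -> t <= r -> r <= t0 -> 1 <= quotient_bound r t.
Proof.
move=> tp tr rt; have tt := le_trans tr rt.
have A := amp_ge1 sigma0 t00 t0k tp tt.
have c11 := @area_cst_ge1 R sigma sigma0.
have e1 : 1 <= expR (F t - F r).
  by rewrite -[leLHS]expR0 ler_expR subr_ge0 (F_geom_le sigma0 t00 t0k tp tr rt).
have rt1 : 1 <= r / t by rewrite ler_pdivlMr// mul1r.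
rewrite /quotient_bound -[leLHS](mulr1 1) ler_pM// -[leLHS](mulr1 1) ler_pM//; last first.
  exact: exprn_ege1.
by rewrite -[leLHS](mulr1 1) ler_pM//; lra.
Qed.

(** Here ln (r/t) + F(t) - F(r) <= (2 + sigma) amp t ln (r/t) = lam ln (r/t) / 2, while amp^2 costs
    only a factor e because 2 ln amp <= lam. *)
Lemma quotient_bound_root r t : 0 < t -> t <= r -> r <= t0 ->
  quotient_bound r t `^ (exponent_scale t)^-1 <= 16 * c1 * expR 1 * (r / t) `^ 2^-1.
Proof.
move=> tp tr rt; have tt := le_trans tr rt; have rp := lt_le_trans tp tr.
have A := amp_ge1 sigma0 t00 t0k tp tt; have A0 : 0 < amp t by exact: lt_le_trans A.
have c11 := @area_cst_ge1 R sigma sigma0.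
have L4 := exponent_scale_ge4 tp tt; have L0 : 0 < exponent_scale t by exact: lt_le_trans L4.
have Q1 := quotient_bound_ge1 tp tr rt.
have Q0 : 0 < quotient_bound r t by exact: lt_le_trans Q1.
have rt0 : 0 < r / t by rewrite divr_gt0.
have c0 : 0 < 16 * c1 by lra.
have s0 : 0 <= ln (r / t) by rewrite ln_ge0// ler_pdivlMr// mul1r.
have lc0 : 0 <= ln (16 * c1) by rewrite ln_ge0//; lra.
have -> : 16 * c1 * expR 1 * (r / t) `^ 2^-1 = expR (ln (16 * c1) + 1 + 2^-1 * ln (r / t)).
  by rewrite !expRD lnK ?posrE// /powR gt_eqF.
rewrite /powR gt_eqF// ler_expR mulrC ler_pdivrMr//.
have -> : ln (quotient_bound r t) = ln (16 * c1) + ln (r / t) + 2 * ln (amp t) + (F t - F r).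
  have lnMp (x y : R) : 0 < x -> 0 < y -> ln (x * y) = ln x + ln y.
    by move=> x0 y0; rewrite lnM ?posrE.
  have a20 : 0 < amp t ^+ 2 by rewrite exprn_gt0.
  have ca0 : 0 < 16 * c1 * (r / t) by rewrite mulr_gt0.
  rewrite /quotient_bound (lnMp _ _ (mulr_gt0 ca0 a20) (expR_gt0 _)) expRK.
  by rewrite (lnMp _ _ ca0 a20) (lnMp _ _ c0 rt0) lnXn// [2 * _]mulr_natl.
have H1 := F_geom_sub_le sigma0 t00 t0k tp tr rt.
have H2 : ln (amp t) <= amp t by exact: ln_le_id.
have H3 : ln (16 * c1) <= ln (16 * c1) * exponent_scale t by rewrite ler_peMr//; lra.
have H4 : 2 * amp t <= exponent_scale t by have := sigma0; rewrite /exponent_scale; nra.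
have H5 : ln (r / t) + (1 + sigma) * amp t * ln (r / t) <= 2^-1 * ln (r / t) * exponent_scale t.
  have -> : 2^-1 * ln (r / t) * exponent_scale t = (2 + sigma) * amp t * ln (r / t).
    by rewrite /exponent_scale; field.
  have : ln (r / t) <= amp t * ln (r / t) by rewrite ler_peMl.
  by lra.
rewrite [leRHS]mulrDl [X in _ <= X + _]mulrDl mul1r.
move: (F t - F r) (ln (amp t)) (ln (16 * c1) * exponent_scale t) H1 H2 H3 => z la x1y H1 H2 H3.
move: (2^-1 * _ * _) ((1 + sigma) * _ * _) H5 H1 => x2y w H5 H1.
by clear -H1 H2 H3 H4 H5; lra.
Qed.

Lemma amp_expR_le t : 0 < t -> t <= t0 ->
  amp t ^+ 2 * expR (defect_cst m * exponent_scale t `^ (m - 1))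
    <= expR (growth_cst * ell t `^ (sigma * (m - 1))).
Proof.
move=> tp tt; have A := amp_ge1 sigma0 t00 t0k tp tt; have A0 : 0 < amp t by exact: lt_le_trans A.
have m10 : 0 < m - 1 by rewrite subr_gt0.
have ampE : amp t `^ (m - 1) = ell t `^ (sigma * (m - 1)) by rewrite ampE powRrM.
rewrite -ampE /growth_cst mulrDl expRD mulrC /exponent_scale.
have s0 : 0 <= 2 * (2 + sigma) by have := sigma0; lra.
rewrite powRM ?(ltW A0)// mulrA ler_pM2l ?expR_gt0//.
have -> : amp t ^+ 2 = expR (2 * ln (amp t)).
  by rewrite mulr_natl -lnXn// lnK// posrE exprn_gt0.
rewrite ler_expR mulrAC -mulrA ler_pM2l// ler_pdivlMr// mulrC.
by rewrite -ln_powR ln_le_id// powR_gt0.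
Qed.

(** The identity r^(1/2) t^(1/2) = r exp (- ln (r/t) / 2) supplies the negative term of
    [ell_powR_absorb]. *)
Lemma weight_le : (0 < k)%N \/ sigma * (m - 1) < 1 -> exists2 D, 0 <= D &
  forall t r, 0 < t -> t <= r -> r <= t0 ->
    amp t ^+ 2 * expR (defect_cst m * exponent_scale t `^ (m - 1)) * (r `^ 2^-1 * t `^ 2^-1)
      <= expR D * (r * expR (growth_cst * 2 `^ (sigma * (m - 1)) * ell r `^ (sigma * (m - 1)))).
Proof.
move=> kp; have m10 : 0 < m - 1 by rewrite subr_gt0.
have p0 : 0 < sigma * (m - 1) by rewrite mulr_gt0.
have m0 : 0 < m by exact: lt_trans m1.
have g0 : 0 <= growth_cst.
  rewrite /growth_cst addr_ge0 ?divr_ge0 ?(ltW m10)// mulr_ge0 ?powR_ge0//.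
  by rewrite /defect_cst mulr_ge0 ?powR_ge0 ?(ltW m0).
have [D D0 DP] := ell_powR_absorb t00 t0k g0 p0 kp.
exists D => // t r tp tr rt; have tt := le_trans tr rt; have rp := lt_le_trans tp tr.
have -> : r `^ 2^-1 * t `^ 2^-1 = r * expR (- (ln (r / t) / 2)).
  rewrite -{2}(lnK (rp : r \is Num.pos)) -expRD /powR !gt_eqF// -expRD.
  by congr (expR _); rewrite ln_div ?posrE//; field.
rewrite mulrCA [leRHS]mulrCA ler_pM2l// -expRD.
apply: le_trans (ler_wpM2r (expR_ge0 _) (amp_expR_le tp tt)) _.
by rewrite -expRD ler_expR; exact: DP.
Qed.

End Weight.

(* The library's instance for product measures is not found by unification. *)
Lemma leb2_sigma_finite (R : realType) : sigma_finite [set: plane (R := R)] (@leb2 R).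
Proof.
by case: (lebesgue_integral_fubini.measure_function_Measure_isSigmaFinite__to__measure_function_isSigmaFinite
  (@lebesgue_measure R) (@lebesgue_measure R)).
Qed.

Definition sigma_finite_leb2 (R : realType) : {sigma_finite_measure set (plane (R := R)) -> \bar R} :=
  HB.pack (@lebesgue_measure R \x @lebesgue_measure R)%E
    (Measure_isSigmaFinite.Build _ _ _ (@lebesgue_measure R \x @lebesgue_measure R)%E
      (leb2_sigma_finite R)).

(** * The inequality on one ball *)

Section Sobolev.
Context {R : realType} (k : nat) (sigma m M t0 : R).
Hypotheses (sigma0 : 0 < sigma) (t00 : 0 < t0) (t0k : ln_chain_ge_e k.+1 t0^-1).
Hypotheses (m1 : 1 < m) (M1 : 1 < M).
Variables (f : R -> R) (r : R).
Hypothesis f0 : f 0 = 0.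
Hypothesis fE : forall x, 0 < `|x| <= t0 -> f x = expR (- F_geom k.+1 sigma `|x|).
Hypotheses (r0 : 0 < r) (rt : 5 * r <= t0).
Variables (phi C : R).
Hypotheses (phir : r <= phi) (C1 : 1 <= C).

Notation F := (F_geom k.+1 sigma).
Notation amp := (amp k sigma).
Notation plane := (plane (R := R)).
Notation scale := (exponent_scale k sigma).
Notation B := (cball f origin r).
Notation b := (Psi_slope m M).
Notation c3 := (16 * area_cst sigma * expR 1).

(** The form in which the size of phi bounds the integral of Z by |B(0,r)|; [weight_le] provides
    it. *)
Hypothesis phi_ge : forall t, 0 < t -> t <= r ->
  64 * b * area_cst sigma * slice_cst sigma * c3 *
  (amp t ^+ 2 * expR (defect_cst m * scale t `^ (m - 1)) * (r `^ 2^-1 * t `^ 2^-1)) <= C * phi.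

Let rt' : r <= t0.
Proof. by rewrite (le_trans _ rt)// ler_peMl ?(ltW r0)// ler1n. Qed.

Let phi0 : 0 < phi. Proof. exact: lt_le_trans phir. Qed.
Let C0 : 0 < C. Proof. exact: lt_le_trans C1. Qed.
Let Cphi0 : 0 < C * phi. Proof. exact: mulr_gt0. Qed.
Let b0 : 0 < b. Proof. by rewrite (lt_le_trans ltr01)// Psi_slope_ge1. Qed.
Let c10 : 0 < area_cst sigma. Proof. by rewrite (lt_le_trans ltr01)// area_cst_ge1. Qed.
Let c30 : 0 < c3. Proof. by rewrite !mulr_gt0 ?expR_gt0. Qed.

Let mB : measurable B.
Proof. by apply: (cball_measurable fE); rewrite normr0 add0r. Qed.

Let vol := fine (leb2 B).

Let B_fin : leb2 B \is a fin_num.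
Proof.
rewrite ge0_fin_numE// (le_lt_trans (cball_origin_area_le sigma0 t00 t0k f0 fE r0 rt'))//.
exact: ltry.
Qed.

Let vol_le : vol <= 8 * r ^+ 2 * f r.
Proof.
by rewrite -lee_fin /vol fineK//; exact: (cball_origin_area_le sigma0 t00 t0k f0 fE r0 rt').
Qed.

Let vol0 : 0 < vol.
Proof.
have := @cball_area_ge _ k sigma t0 f sigma0 t00 t0k fE origin r (lexx _) r0.
rewrite /= add0r => /(_ rt'); rewrite -(fineK B_fin) lee_fin; apply: lt_le_trans.
have A0 : 0 < amp r by rewrite (lt_le_trans ltr01)// (amp_ge1 sigma0 t00 t0k r0 rt').
have fr0 := profile_pos fE r0 rt'.
rewrite divr_gt0 ?(mulr_gt0 c10 (exprn_gt0 2 A0))//.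
by rewrite (mulr_gt0 fr0 (exprn_gt0 2 r0)).
Qed.

(** Solved from the last condition of [Psi_kernel_split], which becomes an equality once Q^(1/lam)
    is replaced by its bound c3 (r/a)^(1/2) (a/gap)^(1/4). *)
Let weight (a : R) : R :=
  2 * vol * b * c3 / (C * phi) * kernel_coef k sigma a *
  expR (defect_cst m * scale a `^ (m - 1)) * (r `^ 2^-1 * a `^ (- 4^-1)).

Let weight_ge0 a : 0 <= weight a.
Proof.
have K0 := kernel_coef_ge0 k sigma0 a.
rewrite /weight (mulr_ge0 _ (mulr_ge0 (powR_ge0 _ _) (powR_ge0 _ _)))//.
rewrite (mulr_ge0 _ (expR_ge0 _))// (mulr_ge0 _ K0)// (divr_ge0 _ (ltW Cphi0))//.
by rewrite (mulr_ge0 _ (ltW c30))// (mulr_ge0 _ (ltW b0))// (mulr_ge0 _ (ltW vol0)).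
Qed.

Let measurable_weight : measurable_fun setT weight.
Proof.
apply: measurable_funM; last first.
  by apply: measurable_funM => //; exact: measurable_powR.
apply: measurable_funM; first by apply: measurable_funM => //; exact: measurable_kernel_coef.
apply: measurableT_comp; first exact: measurable_expR.
apply: measurable_funM => //; apply: (measurableT_comp (@measurable_powR R (m - 1))).
by apply: measurable_funM => //; exact: measurable_amp.
Qed.

Let integral_weight (q : plane) :
  (\int[@lebesgue_measure R \x @lebesgue_measure R]_p
     (sliced k sigma r weight (5 / 4) (p, q))%:E <= vol%:E)%E.
Proof.
apply: integral_sliced_le => //; last exact: (ltW vol0).
move=> a a0 ar; have := phi_ge a0 (ltW ar).
have aE : a `^ 2^-1 = a `^ (- 4^-1) * a `^ (3 / 4).
  rewrite -powRD; last by rewrite (gt_eqF a0) implybT.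
  by congr powR; field.
rewrite aE /weight /kernel_coef -[X in _ <= X -> _]mulr1 -ler_pdivrMl// => h.
rewrite -[leRHS]mulr1.
have -> : 32 * slice_cst sigma * (2 * vol * b * c3 / (C * phi) *
    (area_cst sigma * amp a ^+ 2 * expR (F a)) *
    expR (defect_cst m * scale a `^ (m - 1)) * (r `^ 2^-1 * a `^ (- 4^-1))) *
    expR (- F a) * a `^ (3 / 4) =
  vol * ((C * phi)^-1 * (64 * b * area_cst sigma * slice_cst sigma * c3 *
   (amp a ^+ 2 * expR (defect_cst m * scale a `^ (m - 1)) *
    (r `^ 2^-1 * (a `^ (- 4^-1) * a `^ (3 / 4)))))).
  have E : expR (F a) * expR (- F a) = 1 by rewrite -expRD subrr expR0.
  by rewrite -[RHS]mul1r -[X in _ = X * _]E; field; rewrite (gt_eqF C0) (gt_eqF phi0).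
by rewrite ler_wpM2l ?(ltW vol0).
Qed.

Let kernel_split Gh z w : 0 < Gh -> 0 < w ->
  sliced k sigma r (kernel_coef k sigma) 1 z * Gh * Psi_ratio m M w <=
  w / 2 * Psi_ratio m M w + sliced k sigma r weight (5 / 4) z * Psi M m (C * phi * Gh / vol) / 2.
Proof.
move=> Gh0 w0; rewrite /sliced; case: ifPn => [/and3P[h1 h2 _]|_]; last first.
  rewrite !mul0r addr0; apply: mulr_ge0; last exact: (ltW (Psi_ratio_gt0 m1 M1 w0)).
  by apply: divr_ge0 => //; exact: ltW.
set a := `|z.2.1| in h1 h2 *; set tau := gap z.
have a0 : 0 < a by rewrite (le_lt_trans _ h1).
have tau0 : 0 < tau by rewrite /tau /gap subr_gt0.
have taua : tau <= a by rewrite /tau /gap gerDl oppr_le0.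
have ar := ltW h2; have at0 : a <= t0 := le_trans ar rt'.
have K0 := @kernel_coef_ge0 R k sigma sigma0 a.
have L4 := exponent_scale_ge4 sigma0 t00 t0k a0 at0.
have Q1 := quotient_bound_ge1 sigma0 t00 t0k a0 ar rt'.
have Qr := quotient_bound_root sigma0 t00 t0k a0 ar rt'.
have at1 : 1 <= a / tau by rewrite ler_pdivlMr// mul1r.
have L0 : 0 < scale a by exact: lt_le_trans L4.
rewrite powR_inv1 ?(ltW tau0)//.
apply: (@Psi_kernel_split _ _ _ m1 M1 _ _ _ _ (quotient_bound k sigma r a * (a / tau)) (scale a)) => //.
- by rewrite divr_ge0 ?(ltW tau0).
- by rewrite divr_gt0 ?mulr_gt0.
- by rewrite -[leLHS](mulr1 1) ler_pM.
- by rewrite (le_trans _ L4)// ler1n.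
- rewrite /quotient_bound /kernel_coef expRD.
  have fr := profileE fE r0 rt'.
  (* One factor r of the area bound is spent on r <= C phi; its constant 8, doubled, is the 16 of
     [quotient_bound]. *)
  have vC : vol <= 8 * r * f r * (C * phi).
    rewrite (le_trans vol_le)//.
    have h : r <= C * phi by rewrite (le_trans phir)// ler_peMl// ltW.
    have fr0 : 0 <= 8 * r * f r by rewrite fr !mulr_ge0 ?expR_ge0 ?(ltW r0).
    by have := ler_wpM2l fr0 h; rewrite expr2; lra.
  rewrite fr in vC.
  have X0 : 0 <= 2 * area_cst sigma * amp a ^+ 2 * expR (F a) / tau * Gh / vol.
    rewrite (divr_ge0 _ (ltW vol0))// (mulr_ge0 _ (ltW Gh0))// (divr_ge0 _ (ltW tau0))//.
    by rewrite (mulr_ge0 _ (expR_ge0 _))// (mulr_ge0 _ (sqr_ge0 _))// (mulr_ge0 _ (ltW c10)).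
  have := ler_wpM2l X0 vC.
  by congr (_ <= _); field; rewrite !gt_eqF.
- have Qat : (quotient_bound k sigma r a * (a / tau)) `^ (scale a)^-1 <=
      c3 * (r / a) `^ 2^-1 * (a / tau) `^ 4^-1.
    rewrite powRM ?(le_trans ler01 Q1) ?(le_trans ler01 at1)//.
    rewrite ler_pM ?powR_ge0// ler_powR// lef_pV2 ?posrE//.
  pose X := 2 * (kernel_coef k sigma a / tau) * Gh.
  have X0 : 0 <= X.
    by rewrite /X (mulr_ge0 _ (ltW Gh0))// (mulr_ge0 _ (divr_ge0 K0 (ltW tau0))).
  apply: (@le_trans _ _ (X * (b * (c3 * (r / a) `^ 2^-1 * (a / tau) `^ 4^-1 *
      expR (defect_cst m * scale a `^ (m - 1)))))).
    by rewrite ler_wpM2l// ler_wpM2l ?(ltW b0)// ler_wpM2r ?expR_ge0.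
  rewrite /X /weight.
  have rE : (r / a) `^ 2^-1 = r `^ 2^-1 * a `^ (- 2^-1).
    by rewrite powRM ?invr_ge0 ?(ltW r0) ?(ltW a0)// -(powR_inv1 (ltW a0)) -powRrM mulN1r.
  have tE : (a / tau) `^ 4^-1 = a `^ 4^-1 * tau `^ (- 4^-1).
    by rewrite powRM ?invr_ge0 ?(ltW tau0) ?(ltW a0)// -(powR_inv1 (ltW tau0)) -powRrM mulN1r.
  have aE : a `^ (- 4^-1) = a `^ (- 2^-1) * a `^ 4^-1.
    by rewrite -powRD ?(gt_eqF a0) ?implybT//; congr powR; field.
  have tauE : tau `^ (- (5 / 4)) = tau^-1 * tau `^ (- 4^-1).
    by rewrite -(powR_inv1 (ltW tau0)) -powRD ?(gt_eqF tau0) ?implybT//; congr powR; field.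
  rewrite rE tE aE tauE.
  move: (a `^ (- 2^-1)) (a `^ 4^-1) (tau `^ (- 4^-1)) (r `^ 2^-1) (expR _) => y1 y2 y3 y4 y5.
  rewrite le_eqVlt; apply/orP; left; apply/eqP; field.
  by rewrite !gt_eqF.
Qed.

Lemma sobolev_ball (g : plane -> R) : (forall y, 0 <= g y) ->
  (mu_ball f r).-integrable B (EFin \o g) ->
  (er_map (Psi_inv M m)
     (\int[mu_ball f r]_(x in B) er_map (Psi M m) (opT f F r g x))
   <= (C * phi)%:E * \int[mu_ball f r]_(x in B) `|(g x)%:E|)%E.
Proof.
move=> g0 /integrableP[mg ig].
have absg : (\int[mu_ball f r]_(x in B) `|(g x)%:E| = vol^-1%:E * \int[leb2]_(x in B) (g x)%:E)%E.
  rewrite /mu_ball ge0_integral_mscale//=; last first.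
    by apply/measurable_EFinP; apply: measurableT_comp => //; apply/measurable_EFinP.
  by congr (_ * _)%E; apply: eq_integral => x _; rewrite ger0_norm.
pose h := patch (fun=> 0) B g.
have h0 y : 0 <= h y by rewrite /h patchE; case: ifP.
have mh : measurable_fun setT h.
  have mg' : measurable_fun B g by apply/measurable_EFinP.
  exact: (measurable_restrictT g mB).1 mg'.
have I0 : (0 <= \int[leb2]_(x in B) (g x)%:E)%E by apply: integral_ge0 => x _; rewrite lee_fin.
have Ifin : (\int[leb2]_(x in B) (g x)%:E)%E \is a fin_num.
  rewrite ge0_fin_numE// ltey; apply/eqP => Ioo.
  by move: ig; rewrite absg Ioo gt0_muley ?lte_fin ?invr_gt0.
pose G := fine (\int[leb2]_(x in B) (g x)%:E)%E.
have GE : (\int[leb2]_(x in B) (g x)%:E = G%:E)%E by rewrite fineK.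
have G0 : 0 <= G by rewrite fine_ge0.
have hG : (\int[@lebesgue_measure R \x @lebesgue_measure R]_y (h y)%:E = G%:E)%E.
  rewrite -GE [RHS]integral_mkcond; apply: eq_integral => y _.
  by rewrite /h !patchE; case: ifP.
have opT_bounds x : B x -> (0 <= opT f F r g x)%E /\ (opT f F r g x <=
    \int[@lebesgue_measure R \x @lebesgue_measure R]_y
      (sliced k sigma r (kernel_coef k sigma) 1 (x, y) * h y)%:E)%E.
  move=> Bx; split.
    by apply: integral_ge0 => y By; rewrite lee_fin mulr_ge0// kernelK_ge0.
  rewrite /opT integral_mkcond; apply: ge0_le_integral_nonmeas => y _; rewrite /h !patchE.
    by case: ifP => _//; rewrite lee_fin mulr_ge0// kernelK_ge0.
  case: ifPn => [/set_mem By|_]; last by rewrite mulr0.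
  by rewrite lee_fin ler_wpM2r// (kernelK_le sigma0 t00 t0k f0 fE r0 rt).
rewrite absg GE -!EFinM.
set V := (\int[_]_(x in B) _)%E.
have HV Gh : 0 < Gh -> G <= Gh -> (V <= (Psi M m (C * phi * Gh / vol))%:E)%E.
  move=> Gh0 GGh.
  have beta0 : 0 < C * phi * Gh / vol by rewrite divr_gt0 ?mulr_gt0.
  have K0 := kernel_coef_ge0 k sigma0.
  have := @Psi_operator_le R m M m1 M1 _ plane (sigma_finite_leb2 R)
    (sliced k sigma r (kernel_coef k sigma) 1) (sliced k sigma r weight (5 / 4)) h G Gh
    (C * phi * Gh / vol) vol (fun z => @sliced_ge0 R k sigma r _ 1 z K0)
    (@measurable_sliced R k sigma r _ 1 (@measurable_kernel_coef R k sigma))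
    (fun z => @sliced_ge0 R k sigma r _ (5 / 4) z weight_ge0)
    (@measurable_sliced R k sigma r _ (5 / 4) measurable_weight)
    h0 mh beta0 Gh0 GGh (ltW vol0) hG (fun z w => @kernel_split Gh z w Gh0) integral_weight
    (NngNum (inv_area_ge0 B)) B (opT f F r g) mB opT_bounds.
  by rewrite -/V /= -/vol mulrCA mulVf ?gt_eqF// mulr1.
have V0 : (0 <= V)%E.
  apply: integral_ge0 => x Bx; have [+ _] := opT_bounds x Bx.
  case: (opT f F r g x) => [v|//|//]; rewrite /= !lee_fin le_eqVlt => /predU1P[<-|v0].
    by rewrite Psi0.
  by rewrite ltW// Psi_gt0.
(* One admissible Gh already shows that [V] is finite; then Gh = G + d with d small gives the bound
   up to [e]. *)
have := HV (G + 1); rewrite ltr_wpDl// lerDl => /(_ isT ler01).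
case: V HV V0 => [v|//|//] HV V0 _ /=.
rewrite lee_fin; apply/ler_addgt0Pr => e e0.
pose d := e * vol / (C * phi).
have d0 : 0 < d by rewrite /d divr_gt0 ?mulr_gt0.
have Gd : 0 < G + d by rewrite ltr_wpDl.
have := HV (G + d) Gd; rewrite lerDl (ltW d0) => /(_ isT); rewrite lee_fin => Hv.
have bd : 0 <= C * phi * (G + d) / vol by rewrite divr_ge0 ?mulr_ge0 ?(ltW C0) ?(ltW phi0) ?(ltW Gd) ?(ltW vol0).
rewrite (le_trans (Psi_inv_le m1 M1 bd Hv))//.
have -> : C * phi * (G + d) / vol = C * phi * (vol^-1 * G) + e.
  by rewrite /d; field; rewrite !gt_eqF.
exact: lexx.
Qed.

End Sobolev.

(* The factor 2 ^ (sigma (m - 1)) pays for replacing ell k t by ell k r for all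
   t <= r: either ell k t <= 2 ell k r, or t is so small that the factor
   (t / r) ^ (1/2) of the weight absorbs the exponential. *)
Definition growth_rate (R : realType) (sigma m : R) :=
  growth_cst sigma m * 2 `^ (sigma * (m - 1)).

Lemma growth_rate_gt0 (R : realType) (sigma m : R) : 0 < sigma -> 1 < m -> 0 < growth_rate sigma m.
Proof.
move=> s0 m1; rewrite /growth_rate /growth_cst mulr_gt0 ?powR_gt0//.
rewrite ltr_wpDl ?divr_gt0 ?subr_gt0// mulr_ge0 ?powR_ge0// /defect_cst.
by rewrite mulr_ge0 ?powR_ge0// (le_trans ler01)// ltW.
Qed.

(** Because r^(1 / ln (1/r)) = 1/e. *)
Lemma phi_ge2E (R : realType) k (m sigma Cm r : R) : 0 < r -> r < 1 ->
  phi_ge2 k.+1 m sigma Cm r = r * expR (Cm * ell k r `^ (sigma * (m - 1))).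
Proof.
move=> r0 r1; have L0 : 0 < - ln r by rewrite oppr_gt0 ln_lt0// r0.
rewrite /phi_ge2 /ell -[X in _ = X * _](lnK (r0 : r \is Num.pos)) -expRD /powR gt_eqF// lnV//.
congr expR; move: (_ * (m - 1)) (iter _ _ _) => p y.
by move: (if _ then _ else _) => z; field; rewrite -oppr_eq0 gt_eqF.
Qed.

Lemma phi_1E (R : realType) (m sigma Cm r : R) : 0 < r -> r < 1 ->
  phi_1 m sigma Cm r = r * expR (Cm * ell 0 r `^ (sigma * (m - 1))).
Proof.
move=> r0 r1; have L0 : 0 < ln r^-1 by rewrite lnV// oppr_gt0 ln_lt0// r0.
rewrite -phi_ge2E// /phi_1 /phi_ge2 /=; congr (_ `^ (_ - Cm * _)).
rewrite powRD; last by rewrite (gt_eqF L0) implybT.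
by rewrite powRr1 ?ltW// powRN div1r invfM invrK mulrC.
Qed.

Lemma strong_sobolev_near0 (R : realType) k (sigma m M : R) (phi : R -> R) :
  0 < sigma -> 1 < m -> 1 < M -> (0 < k)%N \/ sigma * (m - 1) < 1 ->
  (forall r, 0 < r -> r < 1 ->
     phi r = r * expR (growth_rate sigma m * ell k r `^ (sigma * (m - 1)))) ->
  forall r1, 0 < r1 -> exists2 beta, 0 < beta &
    forall f, is_profile (F_geom k.+1 sigma) r1 f ->
    strong_sobolev f (F_geom k.+1 sigma) M m phi beta.
Proof.
move=> s0 m1 M1 kp phiE r1 r10; have [X X0 XP] := @ln_chain_exists R k.+1.
(* [X^-1] secures the iterated logarithms, and [r1 / 2] keeps |x| <= t0 strictly within the range of
   the profile. *)
pose t0 := Num.min X^-1 (r1 / 2).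
have t00 : 0 < t0 by rewrite lt_min invr_gt0 X0 divr_gt0.
have t0k : ln_chain_ge_e k.+1 t0^-1.
  by apply: XP; rewrite -[leLHS]invrK lef_pV2 ?posrE ?invr_gt0// /t0 ge_min lexx.
have t01 : t0 < 1.
  rewrite -[t0]invrK invf_lt1 ?invr_gt0//.
  by apply: lt_le_trans (t0k _ (leq0n _)); rewrite expR_gt1.
have t0r : t0 < r1.
  by rewrite (@le_lt_trans _ _ (r1 / 2)) ?ltr_pdivrMr ?ltr_pMr ?ltr1n// /t0 ge_min lexx orbT.
have [D D0 DP] := weight_le s0 t00 t0k m1 kp.
pose C0 := 64 * Psi_slope m M * area_cst sigma * slice_cst sigma *
  (16 * area_cst sigma * expR 1).
have C00 : 0 <= C0.
  have b0 := le_trans ler01 (Psi_slope_ge1 m1 M1).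
  have c0 := le_trans ler01 (area_cst_ge1 s0).
  have h0 : 0 <= 16 * area_cst sigma * expR 1 by rewrite mulr_ge0 ?expR_ge0// mulr_ge0.
  have h1 : 0 <= slice_cst sigma by rewrite /slice_cst mulr_ge0 ?expR_ge0.
  by rewrite /C0 (mulr_ge0 _ h0)// (mulr_ge0 _ h1)// (mulr_ge0 _ c0)// (mulr_ge0 _ b0).
(* Gives 5 r <= t0, as the kernel bound requires. *)
exists (t0 / 5); first by rewrite divr_gt0.
move=> f [f0 fE]; exists (Num.max 1 (C0 * expR D)); first by rewrite lt_max ltr01.
move=> r /andP[r0]; rewrite ler_pdivlMr// mulrC => rt g g0 ig.
have rt0 : r <= t0 by rewrite (le_trans _ rt)// ler_peMl ?(ltW r0)// ler1n.
have phirE := phiE _ r0 (le_lt_trans rt0 t01).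
have phir : r <= phi r.
  rewrite phirE ler_peMr ?(ltW r0)// -expR0 ler_expR mulr_ge0 ?powR_ge0//.
  exact/ltW/growth_rate_gt0.
have fE' x : 0 < `|x| <= t0 -> f x = expR (- F_geom k.+1 sigma `|x|).
  by move=> /andP[x0 xt]; apply: fE; rewrite x0 (le_lt_trans xt).
apply: (@sobolev_ball R k sigma m M t0 s0 t00 t0k m1 M1 f r f0 fE' r0 rt) => //.
  by rewrite le_max lexx.
move=> t tp tr; rewrite (le_trans (ler_wpM2l C00 (DP t r tp tr rt0)))//.
rewrite -phirE mulrA ler_wpM2r ?(le_trans (ltW r0))//.
by rewrite le_max lexx orbT.
Qed.

Unset Implicit Arguments.

Theorem corollary97 (R : realType) (m : R) (hm : 1 < m) :
  exists2 M0 : R, 1 < M0 &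
  forall M : R, M0 <= M ->
  forall sigma : R, 0 < sigma ->
  (exists2 Cm : R, 0 < Cm &
     forall k : nat, (2 <= k)%N ->
     forall r1 : R, 0 < r1 ->
     exists2 beta : R, 0 < beta &
     forall f : R -> R, is_profile (F_geom k sigma) r1 f ->
     strong_sobolev f (F_geom k sigma) M m (phi_ge2 k m sigma Cm) beta)
  /\
  (sigma < 1 / (m - 1) ->
   exists2 Cm : R, 0 < Cm &
     forall r1 : R, 0 < r1 ->
     exists2 beta : R, 0 < beta &
     forall f : R -> R, is_profile (F_geom 1 sigma) r1 f ->
     strong_sobolev f (F_geom 1 sigma) M m (phi_1 m sigma Cm) beta).
Proof.
exists 2; first by rewrite ltr1n.
move=> M M2 sigma s0; have M1 : 1 < M by rewrite (lt_le_trans _ M2)// ltr1n.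
split.
  (* This constant is built from sigma and m alone, so it serves every [k] and every [M]. *)
  exists (growth_rate sigma m); first exact: growth_rate_gt0.
  case=> // k k1 r1 r10.
  apply: (strong_sobolev_near0 s0 hm M1) r10; first by left.
  by move=> r r0 r_lt1; rewrite phi_ge2E.
move=> sm; exists (growth_rate sigma m); first exact: growth_rate_gt0.
move=> r1 r10; apply: (strong_sobolev_near0 s0 hm M1) r10.
  by right; rewrite -ltr_pdivlMr ?subr_gt0.
by move=> r r0 r_lt1; rewrite phi_1E.
Qed.
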